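(* Let $\mathbb{K}$ be a field of characteristic $p>2$, let $u$ be the restricted enveloping algebra of $\mathfrak{sl}_2$ over $\mathbb{K}$ with its relative cell datum described in the context, and let $\Delta(\lambda)$, $L(\lambda)$, $P(\lambda)$ for $\lambda\in X=\{0,\dots,p-1\}$ be the cell modules, their simple quotients, and the indecomposable projectives with head $L(\lambda)$. Then: (a) The cell modules $\Delta(\lambda)$ are of dimension $p$ and isomorphic to the baby Verma modules of highest weight $\lambda$. (b) The simple quotients $L(\lambda)$ of $\Delta(\lambda)$ are of dimension $\lambda+1$; for $0\leq\lambda\leq p-2$ there is a short exact sequence $0\to L(p-\lambda-2)\to\Delta(\lambda)\to L(\lambda)\to0$, and $\Delta(p-1)\cong L(p-1)$. (c) For $0\leq\lambda\leq p-2$ there is a short exact sequence $0\to\Delta(p-\lambda-2)\to P(\lambda)\to\Delta(\lambda)\to0$, and $P(p-1)\cong\Delta(p-1)$. (d) The algebra $u$ is non-semisimple and non-cellular, and its core $\bigoplus_{\lambda\in X}1_{\lambda}u1_{\lambda}$ is a cellular algebra.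
   Context: The algebra. $u$ is the associative unital $\mathbb{K}$-algebra generated by $\mathsf{E},\mathsf{F},\mathsf{H}$ subject to $\mathsf{H}\mathsf{E}-\mathsf{E}\mathsf{H}=2\mathsf{E}$, $\mathsf{H}\mathsf{F}-\mathsf{F}\mathsf{H}=-2\mathsf{F}$, $\mathsf{E}\mathsf{F}-\mathsf{F}\mathsf{E}=\mathsf{H}$, $\mathsf{E}^p=\mathsf{F}^p=\mathsf{H}^p-\mathsf{H}=0$. Identify $\{0,\dots,p-1\}$ with $\mathbb{F}_p$. For $\lambda\in X=\{0,\dots,p-1\}$ let $1_{\lambda}=-\prod_{\mu\in\mathbb{F}_p,\mu\neq\lambda}(\mathsf{H}-\mu)$; these are pairwise orthogonal idempotents summing to $1$. Cell datum. $M(\lambda)=\{0,\dots,p-1\}$; $C^{\lambda}_{S,T}=\mathsf{F}^S1_{\lambda}\mathsf{E}^T$; ${}^{\star}$ is the anti-involution with $(\mathsf{F}^S1_{\lambda}\mathsf{E}^T)^{\star}=\mathsf{F}^T1_{\lambda}\mathsf{E}^S$; the orders are $\lambda+2(p-1)<_{1_{\lambda}}\cdots<_{1_{\lambda}}\lambda+4<_{1_{\lambda}}\lambda+2<_{1_{\lambda}}\lambda$ (modulo $p$); and $\varepsilon_S=1_{\lambda-2S}$ for $S\in M(\lambda)$. One has for $a\in u$: $aC^{\lambda}_{S,T}\in\sum_{S'}r_a(S',S)C^{\lambda}_{S',T}+u(<_{\varepsilon_T}\lambda)\varepsilon_T$ with scalars $r_a(S',S)$ independent of $T$, where $u(<_{\varepsilon}\lambda)$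 is the span of all $C^{\mu}_{A,B}$ with $\mu<_{\varepsilon}\lambda$. Modules (finite-dimensional, left). $\Delta(\lambda)$ has basis $\{m^{\lambda}_S\mid S\in M(\lambda)\}$ with $a\cdot m^{\lambda}_S=\sum_{S'}r_a(S',S)m^{\lambda}_{S'}$. The form $\Phi^{\lambda}(m^{\lambda}_S,m^{\lambda}_T)=r_{C^{\lambda}_{U,S}}(U,T)$ (independent of $U$) has radical $\mathrm{rad}(\lambda)$, which is a submodule; $L(\lambda)=\Delta(\lambda)/\mathrm{rad}(\lambda)$. Here $\Phi^\lambda\ne 0$ for all $\lambda\in X$ and the $L(\lambda)$ are all simple modules up to isomorphism, without repetition. The baby Verma module of highest weight $\lambda$ is $u\otimes_{u_{\geq0}}\mathbb{K}_{\lambda}$, where $u_{\geq0}$ is the subalgebra generated by $\mathsf{H},\mathsf{E}$ and $\mathbb{K}_{\lambda}$ is the one-dimensional module on which $\mathsf{E}$ acts by $0$ and $\mathsf{H}$ by $\lambda$. Cellular algebra (Graham–Lehrer). A unital algebra $A$ is cellular if there are a poset $(Y,<)$, finite sets $M(\lambda)$ ($\lambda\in Y$), an injective map $\coprod_{\lambda}M(\lambda)\times M(\lambda)\to A$, $(S,T)\mapsto C^{\lambda}_{S,T}$, with image a basis of $A$, and an anti-involution ${}^{\star}$ of $A$ with $(C^{\lambda}_{S,T})^{\star}=C^{\lambda}_{T,S}$, such that for all $a\in A$: $aC^{\lambda}_{S,T}\in\sum_{S'\in M(\lambda)}r_a(S',S)C^{\lambda}_{S',T}+A(<\lambda)$ with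 $r_a(S',S)$ independent of $T$, where $A(<\lambda)$ is the span of the $C^{\mu}_{A,B}$ with $\mu<\lambda$. *)

(* Defs.v *)
From HB Require Import structures.
From mathcomp Require Import all_boot all_order all_algebra.

Set Implicit Arguments.
Unset Strict Implicit.
Unset Printing Implicit Defensive.

Import Order.TTheory GRing.Theory Num.Theory.
Local Open Scope ring_scope.

Definition surj (X Y : Type) (f : X -> Y) : Prop := forall y, exists x, f x = y.

(* ** Linear algebra over a field *)

Section LinearAlgebra.
Context {K : fieldType} {V : lmodType K}.

Definition span (G : V -> Prop) (x : V) : Prop :=
  exists (n : nat) (c : 'I_n -> K) (g : 'I_n -> V),
    (forall i, G (g i)) /\ x = \sum_i c i *: g i.

(* Possibly infinite families are allowed, hence the finite subfamilies [s];
   independence as a family makes [b] injective. *)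
Definition is_basis (I : eqType) (b : I -> V) : Prop :=
  (forall x, span (fun y => exists i, y = b i) x) /\
  (forall (s : seq I) (c : I -> K), uniq s ->
     \sum_(i <- s) c i *: b i = 0 -> forall i, i \in s -> c i = 0).

Definition has_dim (n : nat) : Prop := exists b : 'I_n -> V, is_basis b.
Definition fin_dim : Prop := exists n, has_dim n.

End LinearAlgebra.

Arguments has_dim {K} V n.
Arguments fin_dim {K} V.

(* ** The K-vector space underlying a left module over a K-algebra *)

Definition kspace (K : fieldType) (A : algType K) (V : lmodType A) : Type := V.

Section KSpace.
Context (K : fieldType) (A : algType K) (V : lmodType A).

HB.instance Definition _ := GRing.Zmodule.on (kspace V).

Definition kscale (k : K) (v : kspace V) : kspace V := (k%:A : A) *: (v : V).

Fact kscaleA a b v : kscale a (kscale b v) = kscale (a * b) v.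
Proof. by rewrite /kscale scalerA -scalerAl mul1r scalerA. Qed.

Fact kscale1 : left_id 1 kscale.
Proof. by move=> v; rewrite /kscale !scale1r. Qed.

Fact kscaleDr : right_distributive kscale +%R.
Proof. by move=> a u v; rewrite /kscale scalerDr. Qed.

Fact kscaleDl v : {morph kscale^~ v : a b / a + b}.
Proof. by move=> a b; rewrite /kscale !scalerDl. Qed.

HB.instance Definition _ := GRing.Zmodule_isLmodule.Build K (kspace V)
  kscaleA kscale1 kscaleDr kscaleDl.

End KSpace.

(* ** Modules over a ring; submodules are predicates N with submod_closed N *)

Section Modules.
Context {R : nzRingType}.

Definition isomorphic (V W : lmodType R) : Prop :=
  exists f : {linear V -> W}, bijective f.

Definition short_exact (U V W : lmodType R) : Prop :=
  exists (f : {linear U -> V}) (g : {linear V -> W}),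
    [/\ injective f, surj g & forall v, g v = 0 <-> exists x, f x = v].

Definition simple_submod (V : lmodType R) (N : {pred V}) : Prop :=
  [/\ submod_closed N,
      exists2 v, v \in N & v <> 0
    & forall N' : {pred V}, submod_closed N' -> {subset N' <= N} ->
        (forall v, v \in N' -> v = 0) \/ {subset N <= N'}].

Definition maximal_submod (V : lmodType R) (N : {pred V}) : Prop :=
  [/\ submod_closed N,
      exists v, v \notin N
    & forall N' : {pred V}, submod_closed N' -> {subset N <= N'} ->
        {subset N' <= N} \/ (forall v, v \in N')].

Definition radical (V : lmodType R) (v : V) : Prop :=
  forall N : {pred V}, maximal_submod N -> v \in N.

(* L is isomorphic to the quotient of V by its radical. *)
Definition has_head (V L : lmodType R) : Prop :=
  exists f : {linear V -> L}, surj f /\ forall v, f v = 0 <-> radical v.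

Definition indecomposable (V : lmodType R) : Prop :=
  (exists v : V, v <> 0) /\
  forall N1 N2 : {pred V}, submod_closed N1 -> submod_closed N2 ->
    (forall v, exists v1 v2, [/\ v1 \in N1, v2 \in N2 & v = v1 + v2]) ->
    (forall v, v \in N1 -> v \in N2 -> v = 0) ->
    (forall v, v \in N1 -> v = 0) \/ (forall v, v \in N2 -> v = 0).

Definition projective (P : lmodType R) : Prop :=
  forall (V W : lmodType R) (g : {linear V -> W}) (f : {linear P -> W}),
    surj g -> exists h : {linear P -> V}, forall x, g (h x) = f x.

End Modules.

(* The left regular module is a finite direct sum of simple submodules. *)
Definition semisimple_ring (R : nzRingType) : Prop :=
  exists (n : nat) (N : 'I_n -> {pred R^o}),
    (forall i, simple_submod (N i)) /\
    forall x : R^o, exists! y : {ffun 'I_n -> R^o},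
      (forall i, y i \in N i) /\ x = \sum_i y i.

(* ** Extension of scalars *)

(* V, with the map b : R x M -> V, is the left R-module R (x)_S M, where S is a
   subring of R acting on the abelian group M; only the values of [act] on S
   matter. *)
Section Tensor.
Context (R : nzRingType) (S : R -> Prop) (M : zmodType) (act : R -> M -> M).

Definition balanced (W : zmodType) (b : R -> M -> W) : Prop :=
  [/\ forall x y k, b (x + y) k = b x k + b y k,
      forall x k l, b x (k + l) = b x k + b x l
    & forall x s k, S s -> b (x * s) k = b x (act s k)].

Definition is_tensor (V : lmodType R) (b : R -> M -> V) : Prop :=
  [/\ balanced b,
      forall a x k, b (a * x) k = a *: b x k
    & forall (W : zmodType) (beta : R -> M -> W), balanced beta ->
        exists g : {additive V -> W},
          (forall x k, g (b x k) = beta x k) /\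
          forall g' : {additive V -> W},
            (forall x k, g' (b x k) = beta x k) -> g' =1 g].

End Tensor.

(* ** Cellular algebras (Graham-Lehrer) *)

Definition anti_involution (K : fieldType) (A : algType K) (star : A -> A) : Prop :=
  [/\ forall (k : K) x y, star (k *: x + y) = k *: star x + star y,
      forall x y, star (x * y) = star y * star x
    & involutive star].

Definition cellular (K : fieldType) (A : algType K) : Prop :=
  exists (d : Order.disp_t) (Y : porderType d) (M : Y -> finType)
         (C : forall l, M l -> M l -> A) (star : A -> A),
    [/\ is_basis (fun i : {l : Y & (M l * M l)%type} =>
                    C (tag i) (tagged i).1 (tagged i).2),
        anti_involution star,
        forall l S T, star (C l S T) = C l T S
      & forall l, exists r : A -> M l -> M l -> K, forall a S T,
          exists2 x, span (fun y => exists mu S' T', (mu < l)%O /\ y = C mu S' T') x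
                   & a * C l S T = \sum_S' r a S' S *: C l S' T + x].

(* ** The restricted enveloping algebra of sl_2 and its relative cell datum *)

Definition sl2_relations (K : fieldType) (p : nat) (A : algType K) (e f h : A) : Prop :=
  [/\ [/\ h * e - e * h = e *+ 2, h * f - f * h = - (f *+ 2) & e * f - f * e = h],
      e ^+ p = 0, f ^+ p = 0 & h ^+ p - h = 0].

(* u is presented by the generators E, F, H and the above relations. *)
Definition restricted_enveloping_sl2 (K : fieldType) (p : nat)
    (u : algType K) (E F H : u) : Prop :=
  sl2_relations p E F H /\
  forall (A : algType K) (e f h : A), sl2_relations p e f h ->
    exists g : {lrmorphism u -> A},
      [/\ g E = e, g F = f & g H = h] /\
      forall g' : {lrmorphism u -> A},
        [/\ g' E = e, g' F = f & g' H = h] -> g' =1 g.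

Section RelativeCellDatum.
Context {K : fieldType} (p : nat) {u : algType K} (E F H : u).

(* 1_z for the class of the integer z in F_p; the factors commute. *)
Definition idem (z : int) : u :=
  - \prod_(mu < p | (mu%:Z != z %[mod p])%Z) (H - mu%:R).

Definition cellC (lam S T : 'I_p) : u := F ^+ S * idem lam%:Z * E ^+ T.

Definition cell_eps (lam S : 'I_p) : u := idem (lam%:Z - (2 * S)%:Z).

(* mu <_(1_z) nu: in the list z, z + 2, .., z + 2(p-1) modulo p, later entries
   are smaller. *)
Definition weight_lt (z : int) (mu nu : 'I_p) : Prop :=
  exists i j : 'I_p,
    [/\ (mu%:Z = z + (2 * i)%:Z %[mod p])%Z,
        (nu%:Z = z + (2 * j)%:Z %[mod p])%Z
      & (j < i)%N].

(* u(<_eps lam) for eps = 1_z. *)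
Definition cell_lower (z : int) (lam : 'I_p) : u -> Prop :=
  span (fun y => exists mu A B : 'I_p, weight_lt z mu lam /\ y = cellC mu A B).

(* r lam a S' S stands for r_a(S', S), with S, S' in M(lam). *)
Definition relative_cell_datum (star : u -> u)
    (r : 'I_p -> u -> 'I_p -> 'I_p -> K) : Prop :=
  [/\ anti_involution star,
      forall lam S T : 'I_p, star (cellC lam S T) = cellC lam T S
    & forall (lam : 'I_p) a (S T : 'I_p),
        exists2 x, cell_lower (lam%:Z - (2 * T)%:Z) lam x
                 & a * cellC lam S T =
                     \sum_S' r lam a S' S *: cellC lam S' T + x * cell_eps lam T].

Definition cell_module (r : 'I_p -> u -> 'I_p -> 'I_p -> K) (lam : 'I_p)
    (D : lmodType u) (m : 'I_p -> D) : Prop :=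
  is_basis (m : 'I_p -> kspace D) /\
  forall a (S : 'I_p), a *: m S = \sum_S' (r lam a S' S)%:A *: m S'.

Definition cell_form (r : 'I_p -> u -> 'I_p -> 'I_p -> K) (lam : 'I_p)
    (D : lmodType u) (m : 'I_p -> D) (Phi : kspace D -> kspace D -> K) : Prop :=
  [/\ forall (k : K) x y z, Phi (k *: x + y) z = k * Phi x z + Phi y z,
      forall (k : K) x y z, Phi z (k *: x + y) = k * Phi z x + Phi z y
    & forall U S T : 'I_p, Phi (m S) (m T) = r lam (cellC lam U S) U T].

(* L, with the projection pi, is the quotient of D by the radical of Phi. *)
Definition form_quotient (D : lmodType u) (Phi : kspace D -> kspace D -> K)
    (L : lmodType u) (pi : {linear D -> L}) : Prop :=
  surj pi /\ forall x, pi x = 0 <-> forall y, Phi x y = 0.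

Definition borel (x : u) : Prop :=
  forall B : {pred u}, subalg_closed B -> H \in B -> E \in B -> x \in B.

(* s in u_(>=0) acts on the one-dimensional module K_lam by the scalar chi s. *)
Definition borel_weight (lam : 'I_p) (chi : u -> K) : Prop :=
  [/\ chi 1 = 1,
      forall (k : K) x y, borel x -> borel y -> chi (k *: x + y) = k * chi x + chi y,
      forall x y, borel x -> borel y -> chi (x * y) = chi x * chi y,
      chi E = 0
    & chi H = lam%:R].

Definition is_baby_verma (lam : 'I_p) (V : lmodType u) : Prop :=
  exists (chi : u -> K) (b : u -> K -> V),
    borel_weight lam chi /\ is_tensor borel (fun s k => chi s * k) b.

(* The 1_lam are orthogonal idempotents with sum 1, so the sum of the corners is
   direct and is a subalgebra of u containing 1. *)
Definition core (x : u) : Prop :=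
  exists y : 'I_p -> u, x = \sum_(lam < p) idem lam%:Z * y lam * idem lam%:Z.

End RelativeCellDatum.

(* Main.v *)
Require Import Defs.
From HB Require Import structures.
From mathcomp Require Import all_boot all_order all_algebra.
From mathcomp Require Import boolp ring zify.

Set Implicit Arguments.
Unset Strict Implicit.
Unset Printing Implicit Defensive.

Import Order.TTheory GRing.Theory Num.Theory.
Local Open Scope ring_scope.

(** Weights are taken modulo p. The elements F^S 1_lam E^T form a basis of u: their span is stable
    under left multiplication by the generators, and they are independent because u acts on an
    explicit module of dimension p^2 with basis F^s E^t v for every weight of v. Hence the scalars r
    are determined by the cell datum, Delta(lam) has basis F^S m_0 with m_0 a highest weight vector,
    and E^S F^S m_0 = kappa m_0 where kappa is nonzero exactly for S <= lam; this gives (a) and (b).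

    For (c), lift the highest weight vector of L(lam) to w in P(lam), of weight lam and in the
    generalized eigenspace of the Casimir element. With n = p - 1 - lam, the vector y = E^n w is a
    highest weight vector and E^T w is a multiple of F^(n-T) y for 0 < T <= n, so that P(lam) is
    spanned by the F^S w and the F^S y. On projective modules the kernel of F is the image of
    F^(p-1) and likewise for E; this forces F^(p-1) y <> 0, and y generates a copy of
    Delta(p-lam-2), the quotient by which is Delta(lam).

    Suppose that u is cellular, with anti-involution * and cell modules W_l. For idempotents e, f
    one has dim e u f* = sum_l (dim e W_l)(dim f W_l). As E acts exactly on the projective module
    u f*, taking e = 1_0 or e = 1_2 gives the same dimension, and therefore
    sum_l (dim 1_0 W_l - dim 1_2 W_l)^2 = 0. But dim 1_0 W - dim 1_2 W is the difference of the
    multiplicities of L(0) and L(p-2) in W, so these two simple modules occur together in every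
    W_l. Each is the head of the smallest cell module in which it occurs, so both are the head of
    the same cell module, a contradiction. *)

(** * Weight idempotents *)

(** Why the weights 0 and 2 detect non-cellularity: modulo p, L(0) has only the weight 0 and L(p-2)
    has every weight except 0, each once, while on every other L(lam) the weights 0 and 2 have equal
    multiplicity. Ranks are compared rather than traces, because a trace in K only counts modulo p
    and could not force a sum of squares to vanish. Nothing is known about the anti-involution of a
    putative cell structure, not even that it preserves the weight idempotents; this is why the
    image of an idempotent under it is treated as an arbitrary idempotent, and why only left
    multiplication by E is used on that side. The poset of a cell structure is arbitrary as well, so
    its finiteness on the labels that matter must first be extracted from the dimension of u.
    Exchanging E and F while negating H preserves the presentation. Hence exactness is proved for F
    alone, and a lowest weight vector is treated as a highest weight vector for the exchanged
    triple. *)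

Section PrimeField.
Context (K : fieldType) (p : nat) (charK : p \in [pchar K]).
Implicit Types (y z : int) (c : K).

Let p_pr : prime p := pcharf_prime charK.
Let p_gt1 : (1 < p)%N := prime_gt1 p_pr.

Lemma natr_eq0_pchar n : (n%:R == 0 :> K) = (p %| n)%N.
Proof. by rewrite (dvdn_pcharf charK). Qed.

Lemma intr_eq_mod y z : (y%:~R == z%:~R :> K) = (y == z %[mod p])%Z.
Proof.
rewrite eqz_mod_dvd -subr_eq0 -rmorphB /=.
case: (y - z) => n; first by rewrite natr_eq0_pchar.
by rewrite NegzE rmorphN oppr_eq0 natr_eq0_pchar dvdzE abszN.
Qed.

Lemma natr_inj_pchar m n : (m < p)%N -> (n < p)%N -> m%:R = n%:R :> K -> m = n.
Proof.
move=> mp np /eqP; rewrite -[m%:R]/((m : int)%:~R) -[n%:R]/((n : int)%:~R).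
by rewrite intr_eq_mod !modz_small //= => /eqP [].
Qed.

Definition ord_of_int z : 'I_p := Ordinal (ltn_pmod `|(z %% p)%Z| (ltnW p_gt1)).

Lemma ord_of_intE z : ((ord_of_int z)%:R = z%:~R :> K).
Proof.
apply/eqP; rewrite -[X in X == _]/(((ord_of_int z : nat) : int)%:~R) intr_eq_mod /=.
have p0 : (p%:Z != 0) by rewrite eqz_nat -lt0n ltnW.
by rewrite -modz_nat gez0_abs ?modz_ge0 // !modz_mod.
Qed.

Lemma prod_XsubC_prime_field :
  'X^p - 'X = \prod_(mu < p) ('X - (mu%:R : K)%:P).
Proof.
have sizeX : size ('X : {poly K}) = 2 by rewrite size_polyX.
have sizeP : size ('X^p - 'X : {poly K}) = p.+1.
  by rewrite size_polyDl ?size_polyXn // size_polyN size_polyX ltnS.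
rewrite [LHS](@all_roots_prod_XsubC _ _ [seq (mu : nat)%:R | mu : 'I_p <- enum 'I_p]).
- rewrite big_map big_enum lead_coefDl ?lead_coefXn ?scale1r //.
  by rewrite size_polyN sizeX size_polyXn ltnS.
- by rewrite sizeP size_map size_enum_ord.
- apply/allP => _ /mapP [mu _ ->]; rewrite rootE !hornerE subr_eq0.
  by rewrite -(pFrobenius_autE charK) pFrobenius_aut_nat.
rewrite uniq_rootsE map_inj_in_uniq ?enum_uniq // => i j _ _ ij.
by apply/val_inj/(natr_inj_pchar _ _ ij).
Qed.

(** Lagrange interpolation polynomial of the point z of F_p. The sign is Wilson's theorem: the
    product takes the value (p-1)! = -1 at z. *)
Definition lagr z : {poly K} :=
  - \prod_(mu < p | (mu%:Z != z %[mod p])%Z) ('X - mu%:R%:P).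

Lemma lagrM z : ('X - (z%:~R)%:P) * lagr z = 'X - 'X^p.
Proof.
rewrite mulrN -[RHS]opprB prod_XsubC_prime_field; congr (- _).
rewrite [RHS](bigD1 (ord_of_int z)) //= ord_of_intE; congr (_ * _).
apply: eq_bigl => mu; rewrite -intr_eq_mod -(ord_of_intE z); congr (~~ _).
by apply/eqP/eqP => [/natr_inj_pchar e|->//]; apply: val_inj; apply: e.
Qed.

Lemma horner_lagr z y : (lagr z).[y%:~R] = (y%:~R == z%:~R :> K)%:R.
Proof.
have Fr (w : int) : w%:~R ^+ p = w%:~R :> K.
  by rewrite -(pFrobenius_autE charK) pFrobenius_aut_int.
have /(congr1 (fun q => q.[y%:~R])) := lagrM z.
case: eqP => [yz _|/eqP yz]; last first.
  rewrite hornerM !hornerE Fr subrr => /eqP.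
  by rewrite mulf_eq0 subr_eq0 (negbTE yz) => /eqP.
(* At y = z the factorisation is differentiated: X - X^p has derivative 1 in characteristic p, and
   on the left only the value of [lagr z] survives. *)
have /(congr1 (fun q => q^`().[y%:~R])) := lagrM z.
rewrite derivM !derivB derivXn derivX derivC subr0 mul1r !hornerE yz subrr mul0r.
by rewrite addr0 => ->; rewrite hornerMn -mulr_natr (pcharf0 charK) mulr0 subr0.
Qed.

Lemma size_lagr z : (size (lagr z) <= p)%N.
Proof.
have := congr1 (fun q : {poly K} => size q) (lagrM z).
have ->: size ('X - 'X^p : {poly K}) = p.+1.
  by rewrite -opprB size_polyN size_polyDl ?size_polyXn // size_polyN size_polyX ltnS.
have [->|nz] := eqVneq (lagr z) 0; first by rewrite mulr0 size_poly0.
by rewrite size_monicM ?monicXsubC // size_XsubC add2n => -[->].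
Qed.

(** The difference of the two sides has degree below p and vanishes at the p elements of the prime
    field. *)
Lemma sum_lagr : \sum_(lam < p) lagr lam%:Z = 1.
Proof.
apply/eqP; rewrite -subr_eq0; apply/eqP.
apply: (@roots_geq_poly_eq0 _ _ [seq (mu : nat)%:R | mu : 'I_p <- enum 'I_p]).
- apply/allP => _ /mapP [mu _ ->]; rewrite rootE !hornerE horner_sum (bigD1 mu) //=.
  rewrite -[(mu : nat)%:R]/((mu : int)%:~R) horner_lagr eqxx big1 ?addr0 ?subrr // => nu.
  move=> numu; rewrite horner_lagr; case: eqP => //= /natr_inj_pchar e.
  by rewrite -val_eqE /= e ?eqxx in numu.
- rewrite map_inj_in_uniq ?enum_uniq // => i j _ _ ij.
  by apply/val_inj/(natr_inj_pchar _ _ ij).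
rewrite size_map size_enum_ord (leq_trans (size_polyD _ _)) // geq_max size_polyN.
rewrite size_polyC oner_eq0 (ltnW p_gt1) andbT.
by apply: (leq_trans (size_sum _ _ _)); apply/bigmax_leqP => i _; apply: size_lagr.
Qed.

End PrimeField.

Section Brackets.
Context (R : pzRingType) (E F H : R).

(** Kept apart from the relations on p-th powers and stated over any ring: the model below needs the
    commutation formulas in order to prove that the p-th powers vanish there. *)
Definition sl2_brackets : Prop :=
  [/\ H * E - E * H = E *+ 2, H * F - F * H = - (F *+ 2) & E * F - F * E = H].

Hypothesis br : sl2_brackets.

Lemma brackets_HE : H * E = E * (H + 2%:R).
Proof. by case: br => /(canRL (subrK _)) -> _ _; rewrite mulrDr mulr_natr addrC. Qed.

Lemma brackets_HF : H * F = F * (H - 2%:R).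
Proof. by case: br => _ /(canRL (subrK _)) -> _; rewrite mulrBr mulr_natr addrC. Qed.

Lemma brackets_EF : E * F = F * E + H.
Proof. by case: br => _ _ /(canRL (subrK _)) ->; rewrite addrC. Qed.

Lemma comm_EFn n : E * F ^+ n.+1 = F ^+ n.+1 * E + F ^+ n * (H - n%:R) *+ n.+1.
Proof.
elim: n => [|n IH]; first by rewrite expr1 expr0 subr0 mul1r brackets_EF.
rewrite exprSr mulrA IH mulrDl -mulrA brackets_EF mulrDr mulrA -exprSr -addrA; congr (_ + _).
have HnF : (H - n%:R) * F = F * (H - n.+2%:R).
  by rewrite mulrBl brackets_HF -(commr_nat F n) -mulrBr -addrA -opprD -natrD add2n.
rewrite mulrnAl -mulrA HnF mulrA -exprSr -!mulrnAr -mulrDr; congr (_ * _).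
have -> : H - n.+2%:R = H - n.+1%:R - 1 by rewrite -[n.+2%:R]natr1 opprD addrA.
by rewrite mulrnBl [RHS]mulrS addrA addrAC.
Qed.

End Brackets.

(* Modules over [A] are regarded as vector spaces through the scalars [k%:A]. *)
Section Weights.
Context (K : fieldType) (p : nat) (charK : p \in [pchar K]).
Context (u : algType K) (E F H : u).
Implicit Types (V W : lmodType u) (y z : int) (k : K).

Lemma scaleAC V (a : u) k (v : V) : a *: (k%:A *: v) = k%:A *: (a *: v).
Proof. by rewrite !scalerA mulr_algl mulr_algr. Qed.

Lemma scale_regE (a b : u) : a *: (b : u^o) = a * b.
Proof. by []. Qed.

Lemma scaleA0 V (v : V) : (0 : K)%:A *: v = 0 :> V.
Proof. by rewrite !scale0r. Qed.

Lemma scaleA1 V (v : V) : (1 : K)%:A *: v = v.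
Proof. by rewrite !scale1r. Qed.

Lemma scaleAA V k l (v : V) : (k%:A : u) *: ((l%:A : u) *: v) = ((k * l)%:A : u) *: v.
Proof. by rewrite !scalerA mulr_algl scalerA. Qed.

Lemma scaleAe V k (a : u) (v : V) : (k *: a) *: v = k%:A *: (a *: v).
Proof. by rewrite scalerA mulr_algl. Qed.

Lemma scaleAN V k (v : V) : (- k)%:A *: v = - (k%:A *: v) :> V.
Proof. by rewrite !scaleNr. Qed.

Lemma scaleADl V k l (v : V) : (k + l)%:A *: v = k%:A *: v + l%:A *: v :> V.
Proof. by rewrite !scalerDl. Qed.

Lemma scaleAn V n (v : V) : (n%:R : K)%:A *: v = v *+ n :> V.
Proof. by rewrite scaler_nat -mulr_natl mulr1 scaler_nat. Qed.

Lemma scaleAI V k (v : V) : k != 0 -> k%:A *: v = 0 :> V -> v = 0.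
Proof.
move=> k0 /(congr1 (fun w => k^-1%:A *: w)).
by rewrite scaleAA mulVf // scaleA1 scaler0.
Qed.

Definition weight V z (v : V) : Prop := H *: v = z%:~R%:A *: v.

Lemma weight_mod V y z (v : V) : y%:~R = z%:~R :> K -> weight y v -> weight z v.
Proof. by rewrite /weight => ->. Qed.

Lemma linear_weight V W (g : {linear V -> W}) z v : weight z v -> weight z (g v).
Proof. by rewrite /weight -linearZZ => ->; rewrite linearZZ. Qed.

Lemma idem_lagr z : idem p H z = horner_alg H (lagr K p z).
Proof.
rewrite /idem /lagr rmorphN rmorph_prod; congr (- _); apply: eq_bigr => mu _.
by rewrite rmorphB /= horner_algX horner_algC scaler_nat.
Qed.

Context (rel : sl2_relations p E F H).

Let br : sl2_brackets E F H. Proof. by case: rel. Qed.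

Let Fr (w : int) : w%:~R ^+ p = w%:~R :> K.
Proof. by rewrite -(pFrobenius_autE charK) pFrobenius_aut_int. Qed.

Lemma H_idem z : H * idem p H z = z%:~R *: idem p H z.
Proof.
apply/eqP; rewrite -subr_eq0 -mulr_algl -mulrBl idem_lagr.
have := congr1 (horner_alg H) (lagrM charK z).
rewrite rmorphM !rmorphB /= rmorphXn /= horner_algX horner_algC => ->.
by case: rel => _ _ _ /eqP; rewrite subr_eq0 => /eqP ->; rewrite subrr.
Qed.

Lemma weight_idem V z (v : V) : weight z (idem p H z *: v).
Proof. by rewrite /weight scalerA H_idem scaleAe. Qed.

Lemma horner_weight V z (v : V) q :
  weight z v -> horner_alg H q *: v = (q.[z%:~R])%:A *: v.
Proof.
move=> wv; elim/poly_ind: q => [|q c IH]; first by rewrite rmorph0 horner0 !scale0r.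
rewrite rmorphD rmorphM /= horner_algX horner_algC hornerMXaddC.
by rewrite [LHS]scalerDl -[in LHS]scalerA [H *: v]wv scaleAC IH scaleAA scaleADl mulrC.
Qed.

Lemma idem_weightE V y z (v : V) : weight y v ->
  idem p H z *: v = if y%:~R == z%:~R :> K then v else 0.
Proof.
move=> wv; rewrite idem_lagr (horner_weight _ wv) horner_lagr //.
by case: eqP; rewrite ?scaleA1 ?scaleA0.
Qed.

Lemma idem_weight V z (v : V) : weight z v -> idem p H z *: v = v.
Proof. by move=> wv; rewrite (idem_weightE _ wv) eqxx. Qed.

Lemma idem_self_weight z : weight z (idem p H z : u^o).
Proof. exact: etrans (H_idem z) (esym (mulr_algl _ _)). Qed.

Lemma sum_idem : \sum_(lam < p) idem p H lam%:Z = 1.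
Proof.
under eq_bigr do rewrite idem_lagr.
by rewrite -rmorph_sum sum_lagr //= rmorph1.
Qed.

Lemma idem_congr y z : y%:~R = z%:~R :> K -> idem p H y = idem p H z.
Proof.
move=> yz; rewrite !idem_lagr; congr horner_alg; congr (- _).
by apply: eq_bigl => mu; rewrite -!(intr_eq_mod charK) yz.
Qed.

Lemma weightE V z (v : V) : weight z v -> weight (z + 2) (E *: v).
Proof.
rewrite /weight scalerA (brackets_HE br) -scalerA scalerDl => ->.
by rewrite scaler_nat -(scaleAn 2) -scaleADl scaleAC rmorphD.
Qed.

Lemma weightF V z (v : V) : weight z v -> weight (z - 2) (F *: v).
Proof.
rewrite /weight scalerA (brackets_HF br) -scalerA scalerBl => ->.
by rewrite scaler_nat -(scaleAn 2) -scaleAN -scaleADl scaleAC rmorphB.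
Qed.

Lemma weightEn V z n (v : V) : weight z v -> weight (z + (2 * n)%:Z) (E ^+ n *: v).
Proof.
elim: n => [|n IH] wv; first by rewrite muln0 addr0 expr0 scale1r.
have -> : z + (2 * n.+1)%:Z = z + (2 * n)%:Z + 2 by lia.
by rewrite exprS -scalerA; apply: weightE; apply: IH.
Qed.

Lemma weightFn V z n (v : V) : weight z v -> weight (z - (2 * n)%:Z) (F ^+ n *: v).
Proof.
elim: n => [|n IH] wv; first by rewrite muln0 subr0 expr0 scale1r.
have -> : z - (2 * n.+1)%:Z = z - (2 * n)%:Z - 2 by lia.
by rewrite exprS -scalerA; apply: weightF; apply: IH.
Qed.

Lemma idemM y z : idem p H y * idem p H z = if z%:~R == y%:~R :> K then idem p H z else 0.
Proof. by have := idem_weightE y (idem_self_weight z); rewrite scale_regE. Qed.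

(** Checked against each 1_lam on the right: by weights, both sides keep E^n 1_lam exactly when lam
    + 2n = z modulo p. *)
Lemma idem_En z n : idem p H z * E ^+ n = E ^+ n * idem p H (z - (2 * n)%:Z).
Proof.
rewrite -[RHS]mulr1 -[LHS]mulr1 -sum_idem !mulr_sumr; apply: eq_bigr => lam _.
have wl := idem_self_weight lam%:Z.
have := idem_weightE z (weightEn n wl); rewrite !scale_regE -!mulrA => ->.
have := idem_weightE (z - (2 * n)%:Z) wl; rewrite !scale_regE => ->.
have -> : ((lam%:Z + (2 * n)%:Z)%:~R == z%:~R :> K) = (lam%:Z%:~R == (z - (2 * n)%:Z)%:~R :> K).
  by rewrite !rmorphD !rmorphN -subr_eq0 -[RHS]subr_eq0 ?opprD ?opprK ?addrA; congr (_ == _); ring.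
by case: ifP; rewrite ?mulr0.
Qed.

Lemma idem_Fn z n : idem p H z * F ^+ n = F ^+ n * idem p H (z + (2 * n)%:Z).
Proof.
rewrite -[RHS]mulr1 -[LHS]mulr1 -sum_idem !mulr_sumr; apply: eq_bigr => lam _.
have wl := idem_self_weight lam%:Z.
have := idem_weightE z (weightFn n wl); rewrite !scale_regE -!mulrA => ->.
have := idem_weightE (z + (2 * n)%:Z) wl; rewrite !scale_regE => ->.
have -> : ((lam%:Z - (2 * n)%:Z)%:~R == z%:~R :> K) = (lam%:Z%:~R == (z + (2 * n)%:Z)%:~R :> K).
  by rewrite !rmorphD !rmorphN -subr_eq0 -[RHS]subr_eq0 ?opprD ?opprK ?addrA; congr (_ == _); ring.
by case: ifP; rewrite ?mulr0.
Qed.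

End Weights.

(** * The PBW basis *)

Section Subalgebra.
Context (K : fieldType) (A : algType K) (B : {pred A}).

(** A subalgebra as an algebra in its own right: the universal property of u can be applied to it,
    and the core becomes an algebra whose cellularity can be stated. *)
Record subalg (hB : subalg_closed B) : Type :=
  Subalg { subalg_val : A; subalg_valP : subalg_val \in B }.

Context (hB : subalg_closed B).

HB.instance Definition _ := [isSub for @subalg_val hB].
HB.instance Definition _ := [Choice of subalg hB by <:].
HB.instance Definition _ :=
  GRing.SubChoice_isSubAlgebra.Build K A B (subalg hB) (GRing.subalg_closed_semi hB).

Definition subalg_incl : subalg hB -> A := \val.
HB.instance Definition _ := GRing.Linear.on subalg_incl.
HB.instance Definition _ := GRing.RMorphism.on subalg_incl.

Lemma subalg_incl_inj : injective subalg_incl.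
Proof. exact: val_inj. Qed.

End Subalgebra.

Lemma sl2_relations_inj (K : fieldType) p (A B : algType K) (g : {lrmorphism A -> B}) e f h :
  injective g -> sl2_relations p (g e) (g f) (g h) -> sl2_relations p e f h.
Proof.
move=> inj_g [[r1 r2 r3] r4 r5 r6].
by split; [split|..]; apply: inj_g; rewrite ?(rmorph0, rmorphB, rmorphM, rmorphXn, rmorphMn, rmorphN).
Qed.

Section Generation.
Context (K : fieldType) (p : nat) (u : algType K) (E F H : u).
Hypothesis hu : restricted_enveloping_sl2 p E F H.

(** The universal property gives a map from u to B. Followed by the inclusion it fixes the
    generators, so by uniqueness it is the identity, and every element lies in B. *)
Lemma enveloping_generated (B : {pred u}) : subalg_closed B ->
  E \in B -> F \in B -> H \in B -> forall x, x \in B.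
Proof.
move=> hB EB FB HB x; have [rel univ] := hu.
have [|g [[gE gF gH] _]] := univ (subalg hB) (Subalg hB EB) (Subalg hB FB) (Subalg hB HB).
  by apply: (@sl2_relations_inj _ _ _ _ (@subalg_incl _ _ _ hB)) => //; apply: subalg_incl_inj.
have [id_u [_ id_uniq]] := univ u E F H rel.
have gI : [/\ subalg_incl (g E) = E, subalg_incl (g F) = F & subalg_incl (g H) = H].
  by rewrite gE gF gH.
have /(_ x) /= incl_g := id_uniq (@subalg_incl _ _ _ hB \o g) gI.
have /(_ x) /= -> := id_uniq (idfun : {lrmorphism u -> u}) (And3 erefl erefl erefl).
by rewrite -incl_g; apply: (subalg_valP (g x)).
Qed.

(** The Chevalley involution, through which statements about F become statements about E. Oddness of
    p gives (-H)^p = -(H^p). *)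
Lemma enveloping_swap : odd p -> restricted_enveloping_sl2 p F E (- H).
Proof.
move=> podd.
have swap (A : algType K) (e f h : A) : sl2_relations p e f h -> sl2_relations p f e (- h).
  move=> [[r1 r2 r3] r4 r5 r6]; split=> //.
    split.
    - by rewrite mulNr mulrN opprK addrC -opprB r2 opprK.
    - by rewrite mulNr mulrN opprK addrC -opprB r1.
    - by rewrite -opprB r3.
  by rewrite exprNn -signr_odd podd expr1 mulN1r -opprD r6 oppr0.
have [rel univ] := hu; split=> [|A e f h /swap /univ [g [[gE gF gH] uniq_g]]].
  exact: swap.
exists g; split; first (split; [exact: gF|exact: gE|by rewrite rmorphN /= gH opprK]).
move=> g' [g'F g'E g'H]; apply: uniq_g; split=> //.
by rewrite -g'H rmorphN opprK.
Qed.

End Generation.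

(** * A module of dimension p^2 for each weight *)

Section Model.
Context (K : fieldType) (p : nat) (charK : p \in [pchar K]) (mu : int).

Let p_pr : prime p := pcharf_prime charK.
Let p_gt0 : (0 < p)%N := prime_gt0 p_pr.
Let M : vectType K := 'M[K]_p.

(* [b s t] stands for F^s E^t v, where v has weight mu. *)
Let b (s t : nat) : M := \matrix_(i, j) ((i == s :> nat) && (j == t :> nat))%:R.

Let b_out s t : ~~ ((s < p) && (t < p))%N -> b s t = 0.
Proof.
move=> st; apply/matrixP => i j; rewrite !mxE; case: eqP => //= is_.
by case: eqP => //= jt; rewrite -is_ -jt !ltn_ord in st.
Qed.

Let b_sum (phi : M) : phi = \sum_i \sum_j phi i j *: b i j.
Proof.
apply/matrixP => i j; rewrite summxE (bigD1 i) //= summxE (bigD1 j) //=.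
rewrite !mxE !eqxx mulr1 big1 ?addr0 => [|j' jj']; last first.
  by rewrite !mxE eqxx /= eq_sym val_eqE (negbTE jj') mulr0.
rewrite big1 ?addr0 // => i' ii'; rewrite summxE big1 // => j' _.
by rewrite !mxE eq_sym val_eqE (negbTE ii') mulr0.
Qed.

Let op (img : nat -> nat -> M) (phi : M) : M := \sum_i \sum_j phi i j *: img i j.

Let op_linear img : linear (op img).
Proof.
move=> k x y; rewrite /op scaler_sumr -big_split; apply: eq_bigr => i _ /=.
rewrite scaler_sumr -big_split; apply: eq_bigr => j _ /=.
by rewrite !mxE scalerDl scalerA.
Qed.

Let lop img : 'End(M) :=
  linfun (HB.pack_for {linear M -> M} (op img) (GRing.isLinear.Build _ _ _ _ _ (op_linear img))).

Let lop_b img s t : (s < p)%N -> (t < p)%N -> lop img (b s t) = img s t.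
Proof.
move=> sp tp; rewrite lfunE /= /op (bigD1 (Ordinal sp)) //= (bigD1 (Ordinal tp)) //=.
rewrite !mxE !eqxx scale1r big1 ?addr0 => [|j jt]; last first.
  by rewrite !mxE eqxx /= -(inj_eq val_inj) /= in jt *; rewrite (negbTE jt) scale0r.
rewrite big1 ?addr0 // => i it; rewrite big1 // => j _.
by rewrite !mxE -(inj_eq val_inj) /= in it *; rewrite (negbTE it) scale0r.
Qed.

Let c (s t : nat) : int := mu + (2 * t)%:Z - (2 * s)%:Z.
Let opF := lop (fun s t => b s.+1 t).
Let opH := lop (fun s t => (c s t)%:~R *: b s t).
(** From E F^s = F^s E + s F^(s-1) (H - s + 1), applied to E^t v of weight mu + 2t. *)
Let opE := lop (fun s t => b s t.+1 + (s%:R * (mu + (2 * t)%:Z - s%:Z + 1)%:~R) *: b s.-1 t).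

Let opFb s t : opF (b s t) = b s.+1 t.
Proof.
case: (boolP ((s < p) && (t < p))%N) => [/andP [sp tp]|st]; first by rewrite lop_b.
by rewrite !b_out ?linear0 //; apply: contra st; lia.
Qed.

Let opHb s t : opH (b s t) = (c s t)%:~R *: b s t.
Proof.
case: (boolP ((s < p) && (t < p))%N) => [/andP [sp tp]|st]; first by rewrite lop_b.
by rewrite !b_out ?linear0 ?scaler0 //; apply: contra st; lia.
Qed.

Let opEb s t :
  opE (b s t) = b s t.+1 + (s%:R * (mu + (2 * t)%:Z - s%:Z + 1)%:~R) *: b s.-1 t.
Proof.
case: (boolP ((s < p) && (t < p))%N) => [/andP [sp tp]|st]; first by rewrite lop_b.
rewrite (b_out st) linear0 b_out ?add0r; last by apply: contra st; lia.
(* The one boundary case: at s = p the vector is 0 but its predecessor is not, and the coefficient s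
   vanishes in K. *)
have [->|sp] := eqVneq s p; first by rewrite (pcharf0 charK) mul0r scale0r.
by rewrite b_out ?scaler0 //; apply: contra st; lia.
Qed.

Let end_ext (x y : 'End(M)) : (forall s t, x (b s t) = y (b s t)) -> x = y.
Proof.
move=> xy; apply/lfunP => phi; rewrite [phi]b_sum !linear_sum; apply: eq_bigr => i _.
by rewrite !linear_sum; apply: eq_bigr => j _; rewrite !linearZ /= xy.
Qed.

Let dimM : (0 < dim M)%N.
Proof. by rewrite dim_matrix muln_gt0 p_gt0. Qed.

Let A : algType K := lfun_algType dimM.

Let mulAE (x y : A) (v : M) : (x * y : 'End(M)) v = (y : 'End(M)) ((x : 'End(M)) v).
Proof. by rewrite [LHS]lfunE. Qed.

Let expAE (x : 'End(M)) n (v : M) : ((x : A) ^+ n : 'End(M)) v = iter n x v.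
Proof.
by elim: n => [|n IH]; rewrite ?expr0 ?[LHS]lfunE //= exprSr mulAE IH.
Qed.

(* The product of [lfun_algType] is composition in reverse order, so A contains the opposite of
   the usual endomorphism algebra: the roles of E and F are exchanged. *)
Let e : A := opF.
Let f : A := opE.
Let h : A := opH.

Let iterF n s t : iter n opF (b s t) = b (n + s) t.
Proof. by elim: n => [|n IH] //=; rewrite IH opFb. Qed.

Let iterE0 n t : iter n opE (b 0 t) = b 0 (n + t).
Proof. by elim: n => [|n IH] //=; rewrite IH opEb mul0r scale0r addr0. Qed.

Let iterH n s t : iter n opH (b s t) = (c s t)%:~R ^+ n *: b s t.
Proof.
elim: n => [|n IH] /=; first by rewrite scale1r.
by rewrite IH linearZ /= opHb scalerA -exprSr.
Qed.

Let brackets_model : sl2_brackets e f h.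
Proof.
split; apply: end_ext => s t; rewrite add_lfunE opp_lfunE !mulAE /e /f /h.
- rewrite opHb linearZ /= opFb opHb mulr2n add_lfunE opFb -scalerBl.
  have -> : c s t = c s.+1 t + 2 by rewrite /c; lia.
  by rewrite rmorphD /= addrAC subrr add0r scaler_nat mulr2n.
- rewrite opHb linearZ /= mulr2n opprD add_lfunE opp_lfunE opEb [opH (_ + _)]linearD /= [opH (_ *: _)]linearZ /= !opHb.
  have -> : (c s t.+1)%:~R = (c s t)%:~R + 2%:R :> K by rewrite /c; ring.
  rewrite scalerA; case: s => [|s].
    rewrite !mul0r !scale0r !addr0 scalerDl opprD addrA subrr add0r.
    by rewrite scaler_nat mulr2n opprD.
  have -> : (c s.+1.-1 t)%:~R = (c s.+1 t)%:~R + 2%:R :> K by rewrite /c /=; ring.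
  set x := (c s.+1 t)%:~R; set k := _ * _%:~R; set v := b _ _; set w := b _ _.
  by apply/matrixP => i j; rewrite !mxE; ring.
- rewrite opFb !opEb linearD linearZ /= !opFb opHb opprD addrACA subrr add0r.
  case: s => [|s]; last by rewrite -scalerBl; congr (_ *: _); rewrite /c; ring.
  by rewrite mul0r scale0r subr0 mul1r; congr (_ *: _); rewrite /c; ring.
Qed.

Lemma relations_model : sl2_relations p e f h.
Proof.
have be := brackets_model; split=> //.
- apply: end_ext => s t; rewrite expAE zero_lfunE iterF b_out //.
  by rewrite negb_and -leqNgt leq_addr.
- (* In characteristic p the p-th power of f commutes with e, and it kills b 0 t. *)
  have fe : GRing.comm e (f ^+ p).
    rewrite /GRing.comm -(prednK p_gt0) (comm_EFn be) (prednK p_gt0).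
    by rewrite -mulr_natr -[p%:R]scaler_nat (pcharf0 charK) scale0r mulr0 addr0.
  have fb t : ((f ^+ p : A) : 'End(M)) (b 0 t) = 0.
    by rewrite expAE iterE0 b_out //= negb_and -!leqNgt leq_addr orbT.
  apply: end_ext => s t; rewrite zero_lfunE.
  have -> : b s t = ((e ^+ s : A) : 'End(M)) (b 0 t) by rewrite expAE iterF addn0.
  by rewrite -mulAE -(commrX s (commr_sym fe)) mulAE fb linear0.
- apply: end_ext => s t; rewrite add_lfunE opp_lfunE expAE iterH opHb zero_lfunE.
  by rewrite -(pFrobenius_autE charK) pFrobenius_aut_int subrr.
Qed.

Lemma model_idem (u : algType K) (H : u) (g : {lrmorphism u -> A}) z : g H = h ->
  ((g (idem p H z) : A) : 'End(M)) (b 0 0) = (mu%:~R == z%:~R :> K)%:R *: b 0 0.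
Proof.
move=> gH; rewrite idem_lagr -(horner_lagr charK).
elim/poly_ind: (lagr K p z) => [|q k IH].
  by rewrite rmorph0 /= rmorph0 zero_lfunE horner0 scale0r.
rewrite rmorphD rmorphM /= horner_algX horner_algC rmorphD rmorphM /= gH hornerMXaddC.
have -> : g k%:A = k *: (1 : A) by rewrite linearZ rmorph1.
rewrite add_lfunE mulAE IH linearZ /= opHb scale_lfunE [(1 : A) _]id_lfunE.
by rewrite scalerDl scalerA /c muln0 addr0 subr0.
Qed.

(** T is evaluation at b 0 0. Rewriting F^S 1_lam as 1_(lam-2S) F^S makes the idempotent act first,
    products acting in reverse order. So T sends the basis elements with lam - 2S = mu to distinct
    matrix units and kills the others; letting mu vary yields independence. *)
Lemma model_cellC (u : algType K) (E F H : u) : restricted_enveloping_sl2 p E F H ->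
  exists T : {linear u -> M}, forall lam S R : 'I_p,
    T (cellC E F H lam S R) = (mu%:~R == (lam%:Z - (2 * S)%:Z)%:~R :> K)%:R *: b R S.
Proof.
move=> [rel /(_ A e f h relations_model) [g [[gE gF gH] _]]].
pose T (x : u) : M := ((g x : A) : 'End(M)) (b 0 0).
have linT : linear T by move=> k x y; rewrite /T linearP add_lfunE scale_lfunE.
exists (HB.pack_for {linear u -> M} T (GRing.isLinear.Build _ _ _ _ _ linT)) => lam S R.
rewrite /= /T /cellC -[lam%:Z](subrK (2 * S)%:Z) -(idem_Fn charK rel).
rewrite !rmorphM !rmorphXn /= gE gF !mulAE (model_idem _ gH) !linearZ /=.
by rewrite !expAE iterE0 iterF !addn0 addrK.
Qed.

End Model.

Section PBW.
Context (K : fieldType) (p : nat) (charK : p \in [pchar K]).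
Context (u : algType K) (E F H : u).
Hypothesis hu : restricted_enveloping_sl2 p E F H.

Let rel : sl2_relations p E F H := hu.1.
Let br : sl2_brackets E F H. Proof. by case: rel. Qed.

Definition pbw (c : 'I_p -> 'I_p -> 'I_p -> K) : u :=
  \sum_lam \sum_S \sum_R c lam S R *: cellC E F H lam S R.

Lemma pbw_coeff0 c : pbw c = 0 -> forall lam S R, c lam S R = 0.
Proof.
move=> c0 lam S R; pose mu := lam%:Z - (2 * S)%:Z.
have [T TE] := model_cellC charK mu hu.
have := congr1 (fun y : 'M[K]_p => y R S) (congr1 T c0).
rewrite linear0 mxE => <-; rewrite /pbw !linear_sum summxE (bigD1 lam) //=.
rewrite linear_sum summxE (bigD1 S) //= linear_sum summxE (bigD1 R) //=.
rewrite !linearZ /= TE !mxE !eqxx !mulr1 !big1 ?addr0 //= => [l' l'l|S' S'S|R' R'R]; first 1 last.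
- rewrite linear_sum summxE big1 // => R' _; rewrite linearZ /= TE !mxE.
  by rewrite [S == _ :> nat]eq_sym [S' == S :> nat](negbTE S'S) andbF !mulr0.
- rewrite linearZ /= TE !mxE [R == _ :> nat]eq_sym [R' == R :> nat](negbTE R'R).
  by rewrite !mulr0.
rewrite linear_sum summxE big1 // => S' _; rewrite linear_sum summxE big1 // => R' _.
rewrite linearZ /= TE !mxE; case: (S =P S' :> nat) => [SS|_]; last by rewrite andbF !mulr0.
rewrite /mu SS; case: eqP => [|_]; last by rewrite mul0r mulr0.
move/eqP; rewrite !rmorphB /= (inj_eq (addIr _)) => /eqP ll.
case/eqP: l'l; apply/val_inj.
by apply: (natr_inj_pchar charK (ltn_ord l') (ltn_ord lam)); apply: esym ll.
Qed.

Definition in_pbw (x : u) : Prop := exists c, x = pbw c.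

Lemma in_pbw0 : in_pbw 0.
Proof.
exists (fun _ _ _ => 0); rewrite /pbw !big1 // => i _; rewrite big1 // => j _.
by rewrite big1 // => k _; rewrite scale0r.
Qed.

Lemma in_pbwD x y : in_pbw x -> in_pbw y -> in_pbw (x + y).
Proof.
move=> [c ->] [d ->]; exists (fun i j k => c i j k + d i j k); rewrite /pbw.
rewrite -big_split; apply: eq_bigr => i _; rewrite -big_split; apply: eq_bigr => j _.
by rewrite -big_split; apply: eq_bigr => k _; rewrite /= -scalerDl.
Qed.

Lemma in_pbwZ k x : in_pbw x -> in_pbw (k *: x).
Proof.
move=> [c ->]; exists (fun a b d => k * c a b d); rewrite /pbw.
do 3! [rewrite scaler_sumr; apply: eq_bigr => ? _]; by rewrite scalerA.
Qed.

Lemma in_pbw_sum (I : Type) (s : seq I) (f : I -> u) :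
  (forall i, in_pbw (f i)) -> in_pbw (\sum_(i <- s) f i).
Proof. by move=> h; elim/big_ind: _ => *; [apply: in_pbw0|apply: in_pbwD|]. Qed.

Lemma in_pbw_cell (a b : nat) z : in_pbw (F ^+ a * idem p H z * E ^+ b).
Proof.
have [_ Ep Fp _] := rel.
have [ap|ap] := ltnP a p; last by rewrite -(subnK ap) exprD Fp mulr0 !mul0r; apply: in_pbw0.
have [bp|bp] := ltnP b p; last by rewrite -(subnK bp) [E ^+ _]exprD Ep !mulr0; apply: in_pbw0.
pose l := ord_of_int charK z; pose i := Ordinal ap; pose j := Ordinal bp.
exists (fun a' b' d' => ((a' == l) && (b' == i) && (d' == j))%:R).
rewrite /pbw (bigD1 l) //= (bigD1 i) //= (bigD1 j) //= !eqxx scale1r.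
rewrite !big1 ?addr0 => [|k kl|k ki|k kj].
- rewrite /cellC (idem_congr charK H (esym (ord_of_intE charK z) : _ = (l%:Z)%:~R)) //.
- by rewrite big1 // => ? _; rewrite big1 // => ? _; rewrite (negbTE kl) scale0r.
- by rewrite big1 // => ? _; rewrite (negbTE ki) andbF scale0r.
- by rewrite (negbTE kj) andbF scale0r.
Qed.

Lemma in_pbwM a : (forall i j z, in_pbw (a * (F ^+ i * idem p H z * E ^+ j))) ->
  forall x, in_pbw x -> in_pbw (a * x).
Proof.
move=> ha x [c ->]; rewrite /pbw.
do 3! [rewrite mulr_sumr; apply: in_pbw_sum => ?]; rewrite -scalerAr.
by apply: in_pbwZ; apply: ha.
Qed.

Lemma in_pbwF x : in_pbw x -> in_pbw (F * x).
Proof.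
apply: in_pbwM => a b z.
by rewrite !mulrA -exprS; apply: in_pbw_cell.
Qed.

Lemma in_pbwE x : in_pbw x -> in_pbw (E * x).
Proof.
apply: in_pbwM => a b z; have cEi : E * idem p H z = idem p H (z + 2) * E.
  by have /= := idem_En charK rel (z + 2) 1; rewrite expr1 muln1 addrK => <-.
case: a => [|a].
  by rewrite expr0 mul1r mulrA cEi -mulrA -exprS -[idem _ _ _]mul1r -(expr0 F); apply: in_pbw_cell.
rewrite !mulrA (comm_EFn br) !mulrDl -[_ * E * _]mulrA cEi -!mulrA -exprS !mulrA.
apply: in_pbwD; first exact: in_pbw_cell.
have -> : (F ^+ a * (H - a%:R)) *+ a.+1 * idem p H z * E ^+ b =
    (a.+1%:R * (z%:~R - a%:R)) *: (F ^+ a * idem p H z * E ^+ b).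
  rewrite mulrnAl -[_ * _ * idem _ _ _]mulrA mulrBl (H_idem charK rel) mulr_natl.
  by rewrite -!scaler_nat -scalerBl -scalerAr scalerA -[in LHS]scalerAl.
by apply: in_pbwZ; apply: in_pbw_cell.
Qed.

(** The elements whose left multiplication preserves the span form a subalgebra containing E, F and
    H = EF - FE, so all of u; and 1, the sum of the 1_lam, lies in the span. *)
Lemma in_pbwT x : in_pbw x.
Proof.
pose B := [pred a | `[< forall y, in_pbw y -> in_pbw (a * y) >]].
have BP a : reflect (forall y, in_pbw y -> in_pbw (a * y)) (a \in B) by apply: asboolP.
have hB : subalg_closed B.
  split=> [|k a b /BP ha /BP hb|a b /BP ha /BP hb]; apply/BP => y hy.
  - by rewrite mul1r.
  - by rewrite mulrDl -scalerAl; apply/in_pbwD/hb => //; apply/in_pbwZ/ha.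
  - by rewrite -mulrA; apply/ha/hb.
have EB : E \in B by apply/BP/in_pbwE.
have FB : F \in B by apply/BP/in_pbwF.
have HB : H \in B.
  apply/BP => y hy; have -> : H = E * F + (-1) *: (F * E).
    by rewrite scaleN1r (brackets_EF br) addrAC subrr add0r.
  rewrite mulrDl -scalerAl -!mulrA; apply: in_pbwD; first exact/in_pbwE/in_pbwF.
  exact/in_pbwZ/in_pbwF/in_pbwE.
rewrite -[x]mulr1; have /BP := enveloping_generated hu hB EB FB HB x; apply.
rewrite -(sum_idem charK H); apply: in_pbw_sum => lam.
by rewrite -[idem _ _ _]mulr1 -(expr0 E) -[idem _ _ _]mul1r -(expr0 F); apply: in_pbw_cell.
Qed.

(** u is free over K[F]/(F^p) with basis the 1_lam E^R; such a row is the coefficient of one power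
    of F. *)
Definition pbw_row (c : 'I_p -> 'I_p -> K) : u :=
  \sum_lam \sum_R c lam R *: (idem p H lam%:Z * E ^+ R).

Let p_gt0 : (0 < p)%N := prime_gt0 (pcharf_prime charK).

Lemma pbw_rowE c : pbw c = \sum_(S < p) F ^+ S * pbw_row (fun lam R => c lam S R).
Proof.
rewrite /pbw exchange_big; apply: eq_bigr => S _ /=.
rewrite mulr_sumr; apply: eq_bigr => lam _; rewrite mulr_sumr; apply: eq_bigr => R _.
by rewrite -scalerAr mulrA.
Qed.

Lemma pbw_row_inj c : F ^+ p.-1 * pbw_row c = 0 -> pbw_row c = 0.
Proof.
have p1 : (p.-1 < p)%N by rewrite prednK.
move=> c0; rewrite /pbw_row big1 // => lam _; rewrite big1 // => R _.
pose c' lam' (S : 'I_p) R' := if S == p.-1 :> nat then c lam' R' else 0.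
have: pbw c' = 0.
  rewrite pbw_rowE (bigD1 (Ordinal p1)) //= {1}/c' /= eqxx c0 add0r big1 // => S Sp.
  rewrite /pbw_row big1 ?mulr0 // => l _; rewrite big1 // => r _.
  by rewrite /c' [S == _ :> nat](negbTE Sp) scale0r.
by move/pbw_coeff0/(_ lam (Ordinal p1) R); rewrite /c' /= eqxx => ->; rewrite scale0r.
Qed.

Lemma F_exact k x : (k <= p)%N -> F ^+ k * x = 0 -> exists y, x = F ^+ (p - k) * y.
Proof.
move=> kp; have [_ _ Fp _] := rel; have [c ->] := in_pbwT x; rewrite pbw_rowE.
pose y (S : 'I_p) := pbw_row (fun lam R => c lam S R).
rewrite -/(\sum_(S < p) F ^+ S * y S) => Fkx.
have y0 (S : 'I_p) : (S < p - k)%N -> y S = 0.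
  elim/ltn_ind: {S}(S : nat) {-2}S (erefl (S : nat)) => n IH S Sn Spk.
  apply: pbw_row_inj.
  (* F^(p-1-S) is a multiple of F^k as S < p - k. It annihilates the terms above S and moves the
     S-th term to the top power, where [pbw_row_inj] applies. *)
  have : F ^+ (p.-1 - S) * (\sum_(S' < p) F ^+ S' * y S') = 0.
    have -> : (p.-1 - S = (p.-1 - S - k) + k)%N by lia.
    by rewrite exprD -mulrA Fkx mulr0.
  rewrite mulr_sumr (bigD1 S) //= mulrA -exprD subnK; last by rewrite -ltnS prednK.
  rewrite big1 ?addr0 // => S' S'S; case: (ltngtP S' S) => [lt|lt|/val_inj eq].
  - by rewrite (IH S') ?mulr0 -?Sn //; apply: ltn_trans Spk.
  - rewrite mulrA -exprD; have -> : (p.-1 - S + S' = p + (S' - S.+1))%N by have := ltn_ord S; lia.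
    by rewrite exprD Fp !mul0r.
  - by rewrite eq eqxx in S'S.
exists (\sum_(S < p) F ^+ (S - (p - k)) * y S); rewrite mulr_sumr; apply: eq_bigr => S _.
have [lt|le] := ltnP S (p - k)%N; first by rewrite y0 ?mulr0.
by rewrite mulrA -exprD subnKC.
Qed.

(* The coefficients depend only on [a] and the weight, not on the module. *)
Lemma hw_action a z : exists beta : 'I_p -> K, forall (V : lmodType u) (v : V),
  E *: v = 0 -> weight H z v -> a *: v = \sum_S (beta S)%:A *: (F ^+ S *: v).
Proof.
have [c ->] := in_pbwT a; pose l := ord_of_int charK z; pose o := Ordinal p_gt0.
exists (fun S => c l S o) => V v Ev wv.
rewrite /pbw exchange_big scaler_suml; apply: eq_bigr => S _ /=; rewrite scaler_suml.
rewrite (bigD1 l) //= [X in _ + X]big1 ?addr0 => [|k kl].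
- rewrite scaler_suml (bigD1 o) //= big1 ?addr0 => [|R Ro].
    rewrite scaleAe /cellC expr0 mulr1 -scalerA (idem_weight charK) //.
    by apply: weight_mod wv; rewrite -(ord_of_intE charK).
  rewrite scaleAe /cellC -(prednK (_ : (0 < R)%N)) ?lt0n //.
  by rewrite exprSr -!scalerA Ev !scaler0.
rewrite scaler_suml big1 // => R _; rewrite scaleAe /cellC.
have [R0|R0] := posnP R; last by rewrite -(prednK R0) exprSr -!scalerA Ev !scaler0.
rewrite R0 expr0 mulr1 -scalerA (idem_weightE charK _ wv) -(ord_of_intE charK) ifN ?scaler0 //.
apply: contra kl => /eqP /(natr_inj_pchar charK (ltn_ord _) (ltn_ord _)) kl.
exact/eqP/esym/val_inj.
Qed.

End PBW.

(** * Cell modules and their simple quotients *)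

Section LinearMaps.
Context (R : nzRingType).
Implicit Types (U V W : lmodType R).

Lemma linear_of_fun V W (f : V -> W) : linear f -> exists g : {linear V -> W}, g =1 f.
Proof.
move=> lf.
by exists (HB.pack_for {linear V -> W} f (GRing.isLinear.Build _ _ _ _ _ lf)).
Qed.

Lemma factor_linear V W U (q : {linear V -> W}) (g : {linear V -> U}) :
  surj q -> (forall x, q x = 0 -> g x = 0) ->
  exists h : {linear W -> U}, forall x, h (q x) = g x.
Proof.
move=> sq kq; have sqb y : exists x, q x == y by have [x <-] := sq y; exists x.
pose s y := xchoose (sqb y).
have sK y : q (s y) = y by apply/eqP/(xchooseP (sqb y)).
have gq x y : q x = q y -> g x = g y.
  by move=> e; apply/eqP; rewrite -subr_eq0 -linearB kq // linearB /= e subrr.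
have [h hE] : exists h : {linear W -> U}, h =1 g \o s.
  apply: linear_of_fun => a x y /=; rewrite -linearP; apply: gq.
  by rewrite linearP !sK.
by exists h => x; rewrite hE; apply: gq; rewrite sK.
Qed.

Lemma cyclic_linear V W (v : V) (w : W) : (forall x, exists b, x = b *: v) ->
  (forall b, b *: v = 0 -> b *: w = 0) -> exists g : {linear V -> W}, g v = w.
Proof.
move=> gen ann; have genb x : exists b, b *: v == x by have [b ->] := gen x; exists b.
pose s x := xchoose (genb x).
have sK x : s x *: v = x by apply/eqP/(xchooseP (genb x)).
have wd a b : a *: v = b *: v -> a *: w = b *: w.
  by move=> e; apply/eqP; rewrite -subr_eq0 -scalerBl ann // scalerBl e subrr.
have [g gE] : exists g : {linear V -> W}, g =1 (fun x => s x *: w).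
  apply: linear_of_fun => a x y; rewrite scalerA -scalerDl; apply: wd.
  by rewrite scalerDl -scalerA !sK.
by exists g; rewrite gE -[RHS]scale1r; apply: wd; rewrite sK scale1r.
Qed.

Lemma bijective_linear V W (f : {linear V -> W}) : surj f ->
  (forall x, f x = 0 -> x = 0) -> bijective f.
Proof.
move=> sf kf; have sfb y : exists x, f x == y by have [x <-] := sf y; exists x.
have sK y : f (xchoose (sfb y)) = y by apply/eqP/(xchooseP (sfb y)).
exists (fun y => xchoose (sfb y)) => // x.
by apply/eqP; rewrite -subr_eq0; apply/eqP/kf; rewrite linearB /= sK subrr.
Qed.

Lemma injective_linear V W (f : {linear V -> W}) :
  (forall x, f x = 0 -> x = 0) -> injective f.
Proof.
by move=> kf x y e; apply/eqP; rewrite -subr_eq0; apply/eqP/kf; rewrite linearB /= e subrr.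
Qed.

End LinearMaps.

Section Bases.
Context (K : fieldType) (V : lmodType K).

Lemma is_basis_sum (I : finType) (b : I -> V) : is_basis b ->
  (forall x, exists c, x = \sum_i c i *: b i) /\
  (forall c, \sum_i c i *: b i = 0 -> forall i, c i = 0).
Proof.
move=> [sp fr]; split=> [x|c c0 i]; last first.
  by apply: (fr (index_enum I) c (index_enum_uniq I) c0); rewrite mem_index_enum.
have [n [c [g [gb ->]]]] := sp x.
have ex i : exists j, g i == b j by have [j ->] := gb i; exists j.
pose s i := xchoose (ex i); have sE i : g i = b (s i) by apply/eqP/(xchooseP (ex i)).
exists (fun j => \sum_(i | s i == j) c i).
rewrite (partition_big s predT) //=; apply: eq_bigr => j _.
by rewrite scaler_suml; apply: eq_bigr => i /eqP <-; rewrite sE.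
Qed.

Lemma is_basisP (I : finType) (b : I -> V) :
  (forall x, exists c, x = \sum_i c i *: b i) ->
  (forall c, \sum_i c i *: b i = 0 -> forall i, c i = 0) -> is_basis b.
Proof.
move=> sp fr; split=> [x|s c us c0 i si].
  have [c ->] := sp x; exists #|I|, (c \o enum_val), (b \o enum_val); split=> [i|].
    by exists (enum_val i).
  by rewrite (reindex _ (onW_bij _ (@enum_val_bij I))).
have := fr (fun i => if i \in s then c i else 0) _ i; rewrite si; apply.
rewrite -[RHS]c0 (big_uniq _ us) [RHS]big_mkcond; apply: eq_bigr => j _.
by case: ifP => _; rewrite ?scale0r.
Qed.

End Bases.

Section HighestWeight.
Context (K : fieldType) (p : nat) (charK : p \in [pchar K]).
Context (u : algType K) (E F H : u).
Hypothesis hu : restricted_enveloping_sl2 p E F H.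

Let rel : sl2_relations p E F H := hu.1.
Let br : sl2_brackets E F H. Proof. by case: rel. Qed.
Let Fp : F ^+ p = 0. Proof. by case: rel. Qed.
Let p_gt0 : (0 < p)%N := prime_gt0 (pcharf_prime charK).

Implicit Types (V W : lmodType u) (z : int).

Definition hw_vector V z (v : V) : Prop := E *: v = 0 /\ weight H z v.

(** The product of the scalars met while E^n climbs back from F^n v to v. For z = lam in [0, p) the
    factor k = lam makes it vanish as soon as n > lam. *)
Definition kappa z n : K := \prod_(k < n) (k.+1%:R * (z%:~R - k%:R)).

Lemma E_Fn_hw V z (v : V) n : hw_vector z v ->
  E *: (F ^+ n.+1 *: v) = (n.+1%:R * (z%:~R - n%:R))%:A *: (F ^+ n *: v).
Proof.
move=> [Ev wv]; rewrite scalerA (comm_EFn br) [LHS]scalerDl.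
rewrite -[(_ * E) *: v]scalerA Ev scaler0 add0r -mulr_natr -!mulrA -[LHS]scalerA -scaleAC.
congr (_ *: _); rewrite -[LHS]scalerA scaler_nat -scalerMnr scalerBl [H *: v]wv scaler_nat.
by rewrite -(scaleAn n) -scaleAN -scaleADl -(scaleAn n.+1) scaleAA.
Qed.

Lemma En_Fn_hw V z (v : V) n : hw_vector z v -> E ^+ n *: (F ^+ n *: v) = (kappa z n)%:A *: v.
Proof.
move=> hv; elim: n => [|n IH]; first by rewrite /kappa big_ord0 !scale1r.
rewrite exprSr -scalerA (E_Fn_hw n hv) scaleAC IH scaleAA /kappa big_ord_recr /=.
by rewrite mulrC.
Qed.

Lemma kappa_neq0 (lam n : nat) : (n <= lam)%N -> (lam < p)%N -> kappa lam%:Z n != 0.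
Proof.
move=> nl lp; apply/prodf_neq0 => k _; have kn := ltn_ord k.
rewrite -[lam%:Z%:~R]/(lam%:R) -natrB; last exact: leq_trans (ltnW kn) nl.
by rewrite mulf_neq0 // (natr_eq0_pchar charK) gtnNdvd // ?subn_gt0; lia.
Qed.

(** The singular vector: E brings F^(lam+1) v back with the factor lam - lam = 0. *)
Lemma hw_Fn V (v : V) (lam : nat) : hw_vector lam%:Z v ->
  hw_vector (- (lam + 2)%:Z) (F ^+ lam.+1 *: v).
Proof.
move=> hv; split.
  by rewrite (E_Fn_hw lam hv) subrr mulr0 scaleA0.
have := weightFn charK rel lam.+1 hv.2; congr (weight H _ _); lia.
Qed.

Definition verma_basis V (v : V) : Prop :=
  (forall x, exists c : 'I_p -> K, x = \sum_S (c S)%:A *: (F ^+ S *: v)) /\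
  (forall c : 'I_p -> K, \sum_S (c S)%:A *: (F ^+ S *: v) = 0 -> forall S, c S = 0).

(** E^S F^R v has weight lam + 2(S - R); since p is odd and |S - R| < p, this is lam modulo p only
    for R = S. These operators read off coordinates in the basis F^R v. *)
Lemma idem_En_Fn V (v : V) (lam S R : 'I_p) : (2 < p)%N -> hw_vector lam%:Z v ->
  (idem p H lam%:Z * E ^+ S) *: (F ^+ R *: v) =
  if R == S then (kappa lam%:Z S)%:A *: v else 0.
Proof.
move=> p2 hv; rewrite -scalerA; case: eqP => [->|RS].
  by rewrite (En_Fn_hw S hv) scaleAC (idem_weight charK hv.2).
have w := weightEn charK rel S (weightFn charK rel R hv.2).
rewrite (idem_weightE charK _ w) ifN // (intr_eq_mod charK).
rewrite eqz_mod_dvd; apply/negP => dv; case: RS; apply/ord_inj.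
have {}dv : (p %| `|(S : int) - (R : int)|)%N.
  have: (p%:Z %| 2 * (S%:Z - R%:Z))%Z by move: dv; congr (_ %| _)%Z; lia.
  rewrite dvdzE abszM Euclid_dvdM ?(pcharf_prime charK) // => /orP [] //=.
  by rewrite gtnNdvd.
have := ltn_ord S; have := ltn_ord R.
have [|d0] := posnP `|(S : int) - (R : int)|%N; first by lia.
by have := dvdn_leq d0 dv; lia.
Qed.

(** The universal property of Verma modules: by [hw_action] any b has the same coefficients on v and
    on w, and freeness over v makes them vanish once b kills v. *)
Lemma verma_linear V W z (v : V) (w : W) : verma_basis v -> hw_vector z v ->
  hw_vector z w -> exists g : {linear V -> W}, g v = w.
Proof.
move=> [sp fr] hv hw; apply: cyclic_linear => [x|b bv].
  have [c ->] := sp x; exists (\sum_S c S *: F ^+ S).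
  by rewrite scaler_suml; apply: eq_bigr => S _; rewrite [RHS]scaleAe.
have [beta act] := hw_action charK hu b z; rewrite (act _ _ hw.1 hw.2).
rewrite (act _ _ hv.1 hv.2) in bv.
by rewrite big1 // => S _; rewrite (fr _ bv) scaleA0.
Qed.

(** A vector with a nonzero coordinate at some S <= lam generates the whole module, so every proper
    submodule lies in the span of the F^R v with R > lam. Simplicity of L(lam) comes from this. *)
Lemma verma_generated V (lam : 'I_p) (v : V) (c : 'I_p -> K) (S : 'I_p) : (2 < p)%N ->
  hw_vector lam%:Z v -> (S <= lam)%N -> c S != 0 ->
  exists a, a *: (\sum_R (c R)%:A *: (F ^+ R *: v)) = v.
Proof.
move=> p2 hv Sl cS; have kS := kappa_neq0 Sl (ltn_ord lam).
exists ((c S * kappa lam%:Z S)^-1 *: (idem p H lam%:Z * E ^+ S)).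
rewrite [LHS]scaleAe scaler_sumr (bigD1 S) //= scaleAC idem_En_Fn // eqxx big1 ?addr0 => [|R RS].
  by rewrite !scaleAA -mulrA mulVf ?scaleA1 // mulf_neq0.
by rewrite scaleAC idem_En_Fn // (negbTE RS) scaler0.
Qed.

End HighestWeight.

Section CellModules.
Context (K : fieldType) (p : nat) (p_gt2 : (2 < p)%N) (charK : p \in [pchar K]).
Context (u : algType K) (E F H : u).
Hypothesis hu : restricted_enveloping_sl2 p E F H.
Context (star : u -> u) (r : 'I_p -> u -> 'I_p -> 'I_p -> K).
Hypothesis hcell : relative_cell_datum E F H star r.

Let rel : sl2_relations p E F H := hu.1.
Let br : sl2_brackets E F H. Proof. by case: rel. Qed.
Let Fp : F ^+ p = 0. Proof. by case: rel. Qed.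
Let p_gt0 : (0 < p)%N := prime_gt0 (pcharf_prime charK).
Let o : 'I_p := Ordinal p_gt0.

(* Modulo the elements with no component F^S 1_lam, the cell datum determines r. *)
Let low (lam : 'I_p) (x : u) : Prop :=
  exists c, x = pbw E F H c /\ forall S, c lam S o = 0.

Let lowD lam x y : low lam x -> low lam y -> low lam (x + y).
Proof.
move=> [c [-> c0]] [d [-> d0]]; exists (fun i j k => c i j k + d i j k); split.
  rewrite /pbw -big_split; apply: eq_bigr => i _; rewrite -big_split; apply: eq_bigr => j _.
  by rewrite -big_split; apply: eq_bigr => k _ /=; rewrite -scalerDl.
by move=> S; rewrite c0 d0 addr0.
Qed.

Let lowZ lam k x : low lam x -> low lam (k *: x).
Proof.
move=> [c [-> c0]]; exists (fun a b d => k * c a b d); split=> [|S].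
  by rewrite /pbw; do 3! [rewrite scaler_sumr; apply: eq_bigr => ? _]; rewrite scalerA.
by rewrite c0 mulr0.
Qed.

Let low_cell lam mu A B : (B != o) || (mu != lam) -> low lam (cellC E F H mu A B).
Proof.
move=> Bm; exists (fun i j k => ((i == mu) && (j == A) && (k == B))%:R); split=> [|S].
  rewrite /pbw (bigD1 mu) //= (bigD1 A) //= (bigD1 B) //= !eqxx scale1r.
  rewrite !big1 ?addr0 => [//|k kl|k ki|k kj].
  - by rewrite big1 // => ? _; rewrite big1 // => ? _; rewrite (negbTE kl) scale0r.
  - by rewrite big1 // => ? _; rewrite (negbTE ki) andbF scale0r.
  - by rewrite (negbTE kj) andbF scale0r.
case: eqP => [lm|//]; rewrite -lm eqxx orbF eq_sym in Bm.
by rewrite (negbTE Bm) andbF.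
Qed.

Let low0 lam : low lam 0.
Proof.
by rewrite -[0](scale0r (cellC E F H lam o (Ordinal (ltnW p_gt2 : 1 < p)%N)));
  apply/lowZ/low_cell.
Qed.

Let weight_lt_neq z (mu lam : 'I_p) : weight_lt z mu lam -> mu != lam.
Proof.
move=> [i [j [mE lE ji]]]; apply/eqP => ml; have ip := ltn_ord i.
have {mE lE} : (z + (2 * i)%:Z = z + (2 * j)%:Z %[mod p])%Z by rewrite -mE -lE ml.
move/eqP; rewrite eqz_mod_dvd.
have -> : z + (2 * i)%:Z - (z + (2 * j)%:Z) = (2 * (i - j))%N by lia.
rewrite dvdzE /= Euclid_dvdM ?(pcharf_prime charK) // => /orP [].
  by rewrite gtnNdvd.
by rewrite gtnNdvd ?subn_gt0 //; lia.
Qed.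

(** F^A 1_mu E^B 1_lam is either 0 or F^A 1_mu E^B, by weights, and mu differs from lam. *)
Let low_lower (lam : 'I_p) x : cell_lower E F H (lam%:Z - (2 * o)%:Z) lam x ->
  low lam (x * cell_eps H lam o).
Proof.
move=> [n [c [g [hg ->]]]]; rewrite mulr_suml; elim/big_ind: _ => [|y z|i _].
- exact: low0.
- exact: lowD.
rewrite -scalerAl; apply: lowZ; have [mu [A [B [lt ->]]]] := hg i.
have e : E ^+ B * cell_eps H lam o = idem p H (lam%:Z - (2 * o)%:Z + (2 * B)%:Z) * E ^+ B.
  by rewrite (idem_En charK rel) addrK.
rewrite /cellC -!mulrA e [idem _ _ mu%:Z * _]mulrA (idemM charK rel).
case: eqP => [me|_]; last by rewrite mul0r mulr0; apply: low0.
rewrite (idem_congr charK H me) mulrA; apply: low_cell.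
by rewrite (weight_lt_neq lt) orbT.
Qed.

(** As r does not depend on T, comparing at T = 0 is enough, and there the F^S' 1_lam are
    independent modulo low elements. *)
Lemma cell_coeff (lam S : 'I_p) a (e : 'I_p -> K) x : low lam x ->
  a * cellC E F H lam S o = \sum_S' e S' *: cellC E F H lam S' o + x ->
  forall S', r lam a S' S = e S'.
Proof.
move=> lx ea S'; have [_ _ /(_ lam a S o) [y ly]] := hcell; rewrite ea => e1.
have [c [cE c0]] : low lam (x - y * cell_eps H lam o).
  by rewrite -scaleN1r; apply/lowD/lowZ/low_lower.
pose d i j k := c i j k - (if (i == lam) && (k == o) then r lam a j S - e j else 0).
have d0 : pbw E F H d = 0.
  have -> : pbw E F H d = pbw E F H c - \sum_S' (r lam a S' S - e S') *: cellC E F H lam S' o.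
    rewrite /pbw -[in RHS](big_pred1_eq +%R lam
      (fun l => \sum_S' (r lam a S' S - e S') *: cellC E F H l S' o)).
    rewrite [X in _ - X]big_mkcond -sumrB; apply: eq_bigr => l _ /=.
    case: eqP => [->|/eqP ll]; last first.
      by rewrite subr0; do 2! [apply: eq_bigr => ? _]; rewrite /d (negbTE ll) subr0.
    rewrite -sumrB; apply: eq_bigr => j _.
    rewrite -(big_pred1_eq +%R o (fun R => (r lam a j S - e j) *: cellC E F H lam j R)).
    rewrite [X in _ - X]big_mkcond -sumrB; apply: eq_bigr => k _ /=.
    by rewrite /d eqxx /= scalerBl; case: eqP => //= _; rewrite scale0r.
  rewrite -cE; under [X in _ - _ - X]eq_bigr do rewrite scalerBl.
  by rewrite sumrB opprB addrC addrACA e1 -opprD subrr.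
have := pbw_coeff0 charK hu d0 lam S' o; rewrite /d !eqxx c0 sub0r => /eqP.
by rewrite oppr_eq0 subr_eq0 => /eqP.
Qed.

Context (lam : 'I_p) (D : lmodType u) (m : 'I_p -> D).
Hypothesis hD : cell_module r lam m.

Let cell_act a (e : 'I_p -> K) x S : low lam x ->
  a * cellC E F H lam S o = \sum_S' e S' *: cellC E F H lam S' o + x ->
  a *: m S = \sum_S' (e S')%:A *: m S'.
Proof.
move=> lx ea; rewrite hD.2; apply: eq_bigr => S' _.
by rewrite (cell_coeff lx ea).
Qed.

Lemma cell_Fn S : m S = F ^+ S *: m o.
Proof.
have Fm (T T' : 'I_p) : T' = T.+1 :> nat -> F *: m T = m T'.
  move=> TT; rewrite (@cell_act _ (fun S' => (S' == T')%:R) 0 _ (low0 _)).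
    rewrite (bigD1 T') //= eqxx scaleA1 big1 ?addr0 // => j /negbTE ->.
    exact: scaleA0.
  rewrite addr0 (bigD1 T') //= eqxx scale1r big1 ?addr0 => [|j /negbTE ->].
    by rewrite /cellC TT exprS !mulrA.
  by rewrite scale0r.
elim/ltn_ind: {S}(S : nat) {-2}S (erefl (S : nat)) => n IH S Sn.
case: n => [|n] in IH Sn *.
  by rewrite Sn scale1r; congr (m _); apply: ord_inj.
have np : (n < p)%N by apply: ltn_trans (ltn_ord S); rewrite Sn.
by rewrite Sn exprS -scalerA -(IH n _ (Ordinal np)) // (Fm _ S).
Qed.

Lemma cell_hw : hw_vector E H lam%:Z (m o).
Proof.
split.
  rewrite (@cell_act _ (fun=> 0) (E * cellC E F H lam o o)).
  - by rewrite big1 // => j _; rewrite scaleA0.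
  (* E 1_lam = 1_(lam+2) E is itself a basis element; its exponent of E is 1, so it is low. *)
  - pose mu := ord_of_int charK (lam%:Z + 2).
    have -> : E * cellC E F H lam o o =
        cellC E F H mu o (Ordinal (ltnW p_gt2 : 1 < p)%N).
      rewrite /cellC !expr0 !mul1r mulr1 /= expr1.
      have := idem_En charK rel (lam%:Z + 2) 1; rewrite expr1 muln1 addrK => <-.
      by congr (_ * _); apply: (idem_congr charK); apply/esym/(ord_of_intE charK).
    exact: low_cell.
  - by rewrite big1 ?add0r // => j _; rewrite scale0r.
rewrite /weight (@cell_act _ (fun S' => if S' == o then lam%:R else 0) 0 _ (low0 _)).
  rewrite (bigD1 o) //= ?eqxx big1 ?addr0 // => j /negbTE ->.
  exact: scaleA0.
rewrite addr0 (bigD1 o) //= ?eqxx big1 ?addr0 => [|j /negbTE ->]; last by rewrite scale0r.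
by rewrite /cellC !expr0 mul1r mulr1 (H_idem charK rel).
Qed.

Lemma cell_verma : verma_basis p F (m o).
Proof.
have [sp fr] := is_basis_sum hD.1; split=> [x|c c0].
  by have [c ->] := sp x; exists c; apply: eq_bigr => S _; rewrite -cell_Fn.
by apply: fr; rewrite -[RHS]c0; apply: eq_bigr => S _; rewrite -cell_Fn.
Qed.

(** With U = 0 the form is the coefficient of m_0 in 1_lam E^S F^T m_0, which [idem_En_Fn]
    computes. *)
Lemma cell_formE Phi : cell_form E F H r lam m Phi ->
  forall S T, Phi (m S) (m T) = if T == S then kappa K lam%:Z S else 0.
Proof.
move=> [_ _ hPhi] S T; rewrite (hPhi o).
have [_ fr] := is_basis_sum hD.1.
have := hD.2 (cellC E F H lam o S) T.
rewrite /cellC expr0 mul1r {1}(cell_Fn T) (idem_En_Fn charK hu _ _ p_gt2 cell_hw) => e.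
pose c S' := r lam (idem p H lam%:Z * E ^+ S) S' T -
  (if (S' == o) && (T == S) then kappa K lam%:Z S else 0).
apply/eqP; rewrite -subr_eq0; apply/eqP.
apply: etrans (fr c _ o); first by rewrite /c eqxx.
under eq_bigr do rewrite scalerBl.
rewrite sumrB; apply/eqP; rewrite subr_eq0; apply/eqP; apply: etrans (esym e) _.
rewrite (bigD1 o) //= big1 ?addr0 => [|j /negbTE ->]; last exact: scaleA0.
by case: ifP => _; [|exact: esym (scaleA0 _)].
Qed.

End CellModules.

(** * Simple quotients of highest weight modules *)

Section SimpleQuotients.
Context (K : fieldType) (p : nat) (p_gt2 : (2 < p)%N) (charK : p \in [pchar K]).
Context (u : algType K) (E F H : u).
Hypothesis hu : restricted_enveloping_sl2 p E F H.

Let rel : sl2_relations p E F H := hu.1.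
Let Fp : F ^+ p = 0. Proof. by case: rel. Qed.
Let p_gt0 : (0 < p)%N := prime_gt0 (pcharf_prime charK).

Implicit Types (V D L W : lmodType u) (lam mu : 'I_p).

Definition comb V (v : V) (c : 'I_p -> K) : V := \sum_S (c S)%:A *: (F ^+ S *: v).

Lemma linear_comb V W (g : {linear V -> W}) v c : g (comb v c) = comb (g v) c.
Proof. by rewrite linear_sum; apply: eq_bigr => S _; rewrite !linearZZ. Qed.

Definition verma_mod D (v : D) (lam : 'I_p) : Prop :=
  hw_vector E H lam%:Z v /\ verma_basis p F v.

(** The shape in which L(lam) is used once [form_verma_quotient] has eliminated the form. *)
Definition verma_quotient D (v : D) lam L (pi : {linear D -> L}) : Prop :=
  surj pi /\ forall c, pi (comb v c) = 0 <-> forall S : 'I_p, (S <= lam)%N -> c S = 0.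

Lemma comb_single V (v : V) (S : 'I_p) k :
  comb v (fun R => if R == S then k else 0) = k%:A *: (F ^+ S *: v).
Proof.
rewrite /comb (bigD1 S) //= eqxx big1 ?addr0 // => R /negbTE ->.
exact: scaleA0.
Qed.

Lemma form_verma_quotient (r : 'I_p -> u -> 'I_p -> 'I_p -> K) lam D (m : 'I_p -> D) v Phi L
    (pi : {linear D -> L}) :
  verma_mod v lam -> (forall S, m S = F ^+ S *: v) ->
  cell_form E F H r lam m Phi ->
  (forall S T, Phi (m S) (m T) = if T == S then kappa K lam%:Z S else 0) ->
  form_quotient Phi pi -> verma_quotient v lam pi.
Proof.
move=> [hv [sp fr]] mE [PhiDl PhiDr _] PhiE [spi kpi]; split=> // c; rewrite kpi.
have Phi0l z : Phi 0 z = 0.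
  have := PhiDl 0 0 0 z; rewrite scale0r addr0 mul0r add0r.
  by have := PhiDl 1 0 0 z; rewrite scale1r addr0 mul1r => /eqP; rewrite addrC -subr_eq subrr eq_sym => /eqP.
have Phi0r z : Phi z 0 = 0.
  by have := PhiDr 1 0 0 z; rewrite scale1r addr0 mul1r => /eqP; rewrite addrC -subr_eq subrr eq_sym => /eqP.
have PhiD (d : 'I_p -> K) T : Phi (comb v d) (m T) = d T * kappa K lam%:Z T.
  transitivity (\sum_S d S * Phi (m S) (m T)).
    rewrite /comb; elim: (index_enum _) => [|S s IH]; first by rewrite !big_nil Phi0l.
    by rewrite !big_cons -IH -(mE S); apply: PhiDl.
  by rewrite (bigD1 T) //= PhiE eqxx big1 ?addr0 // => S /negbTE ST; rewrite PhiE eq_sym ST mulr0.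
split=> [c0 S Sl|c0 y].
  have /eqP := PhiD c S; rewrite c0 eq_sym mulf_eq0 (negbTE (kappa_neq0 charK Sl _)) ?orbF //.
  by move/eqP.
have [d ->] := sp y; elim: (index_enum _) => [|S s IH]; first by rewrite big_nil Phi0r.
have := PhiDr (d S) (m S) (\sum_(j <- s) (d j)%:A *: (F ^+ j *: v)) (comb v c).
rewrite big_cons -(mE S) => e; apply: etrans e _; rewrite IH PhiD addr0.
have [Sl|lS] := leqP S lam; first by rewrite c0 ?mul0r ?mulr0.
rewrite (_ : kappa _ _ _ = 0) ?mulr0 //; apply/eqP/prodf_eq0.
by exists (Ordinal lS) => //=; rewrite mulf_eq0 subr_eq0 eqxx orbT.
Qed.

Section Fixed.
Context (lam : 'I_p) (D L : lmodType u) (v : D) (pi : {linear D -> L}).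
Hypotheses (vD : verma_mod v lam) (qL : verma_quotient v lam pi).

Let l := pi v.

Lemma quotient_hw : hw_vector E H lam%:Z l.
Proof.
case: vD => [[Ev wv] _]; split; first by rewrite -linearZZ Ev linear0.
exact: linear_weight wv.
Qed.

Lemma quotient_Fn n : (lam < n)%N -> F ^+ n *: l = 0.
Proof.
move=> ln; have [pn|np] := leqP p n.
  by rewrite -(subnK pn) exprD Fp mulr0 scale0r.
rewrite -linearZZ -[_ *: v]scaleA1 -(comb_single v (Ordinal np) 1) qL.2 => S Sl.
by case: eqP => // SE; move: Sl; rewrite SE /= leqNgt ln.
Qed.

Lemma quotient_basis :
  is_basis ((fun i : 'I_lam.+1 => F ^+ i *: l) : 'I_lam.+1 -> kspace L).
Proof.
have lp : (lam.+1 <= p)%N := ltn_ord lam.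
have combE c : pi (comb v c) = \sum_(i < lam.+1) (c (widen_ord lp i))%:A *: (F ^+ i *: l).
  rewrite linear_comb /comb (bigID (fun S : 'I_p => (S < lam.+1)%N)) /=.
  rewrite [X in _ + X]big1 ?addr0 => [|S]; last by rewrite -leqNgt => /quotient_Fn ->; rewrite scaler0.
  by rewrite (big_ord_narrow lp).
apply: is_basisP => [y|c c0 i].
  have [x <-] := qL.1 y; have [c ->] := vD.2.1 x.
  by exists (fun i => c (widen_ord lp i)); apply: combE.
pose d (S : 'I_p) := if insub (S : nat) is Some j then c j else 0.
have dE (j : 'I_lam.+1) : d (widen_ord lp j) = c j by rewrite /d insubT //= => jl; congr c; apply: ord_inj.
have /qL.2/(_ (widen_ord lp i)) : pi (comb v d) = 0.
  by rewrite combE; under eq_bigr do rewrite dE.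
by rewrite dE; apply; rewrite -ltnS /=.
Qed.

Lemma quotient_simple y : y <> 0 -> exists a, a *: y = l.
Proof.
move=> y0; have [x xy] := qL.1 y; have [c xc] := vD.2.1 x.
have [S [Sl cS]] : exists S : 'I_p, (S <= lam)%N /\ c S != 0.
  apply/not_existsP => h; case: y0; rewrite -xy xc; apply/(qL.2 c) => S Sl.
  by apply/eqP; have /not_andP [//|/negP/negPn] := h S.
have [a av] := verma_generated charK hu p_gt2 vD.1 Sl cS.
by exists a; rewrite -xy xc -linearZZ av.
Qed.

Lemma quotient_generated y : exists b, y = b *: l.
Proof.
have [x <-] := qL.1 y; have [c ->] := vD.2.1 x; exists (\sum_S c S *: F ^+ S).
rewrite -linearZZ scaler_suml; congr (pi _); apply: eq_bigr => S _.
by rewrite [RHS]scaleAe.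
Qed.

Lemma quotient_neq0 : l <> 0.
Proof.
move=> l0; have := (qL.2 (fun S => if S == Ordinal p_gt0 then 1 else 0)).1.
rewrite comb_single scaleA1 scale1r => /(_ l0 (Ordinal p_gt0)) /(_ isT) /eqP.
by rewrite ?eqxx oner_eq0.
Qed.

Lemma quotient_top : lam = p.-1 :> nat -> isomorphic D L.
Proof.
move=> lp; exists pi; apply: bijective_linear qL.1 _ => x.
have [c ->] := vD.2.1 x; move/(qL.2 c) => c0; rewrite /comb big1 // => S _.
by rewrite c0 ?scaleA0 // lp -ltnS prednK.
Qed.

End Fixed.

Lemma verma_hom_mod lam mu D V (v : D) (w : V) (mu_lam : mu = (p - lam - 2)%N :> nat) :
  (lam <= p - 2)%N -> verma_mod v mu -> hw_vector E H lam%:Z w ->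
  exists g : {linear D -> V}, g v = F ^+ lam.+1 *: w.
Proof.
move=> lp [hv bv] hw; apply: (verma_linear charK hu bv hv).
have [E0 wt] := hw_Fn charK hu hw; split=> //; apply: weight_mod wt.
rewrite mu_lam; apply/eqP; rewrite (intr_eq_mod charK) eqz_mod_dvd.
have -> : - (lam + 2)%:Z - (p - lam - 2)%N%:Z = - (p%:Z) by lia.
by rewrite dvdzE abszN.
Qed.

Definition ext0 (c : 'I_p -> K) (n : nat) : K := if insub n is Some j then c j else 0.

Lemma ext0E c (i : 'I_p) : ext0 c i = c i.
Proof. by rewrite /ext0 insubT //= => ip; congr c; apply: ord_inj. Qed.

Lemma comb_shift V (w : V) c k : (k <= p)%N ->
  comb (F ^+ k *: w) c = comb w (fun R => if (k <= R)%N then ext0 c (R - k) else 0).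
Proof.
move=> kp; pose f j := (if (k <= j)%N then ext0 c (j - k) else 0)%:A *: (F ^+ j *: w).
rewrite /comb -(big_mkord xpredT f) (@big_cat_nat _ _ _ k) //= [X in _ = X + _]big1_seq ?add0r => [|j]; last first.
  by rewrite mem_index_iota /f ltnNge => /andP [_ /negbTE ->]; rewrite scaleA0.
pose g i := (ext0 c i)%:A *: (F ^+ i *: (F ^+ k *: w)).
transitivity (\sum_(i < p) g i); first by apply: eq_bigr => i _; rewrite /g ext0E.
rewrite -(big_mkord xpredT g) (@big_cat_nat _ _ _ (p - k)) ?leq_subr //=.
rewrite [X in _ + X]big1_seq ?addr0 => [|i]; last first.
  rewrite mem_index_iota => /andP [_ /andP [pk _]]; rewrite /g [F ^+ i *: _]scalerA -exprD.
  have -> : (i + k = (i + k - p) + p)%N by lia.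
  by rewrite exprD Fp mulr0 scale0r scaler0.
rewrite -{2}[k]add0n big_addn; apply: eq_bigr => i _.
by rewrite /f /g leq_addl addnK [F ^+ i *: _]scalerA -exprD.
Qed.

(** The map sends F^S v' to F^(S+lam+1) v, which vanishes exactly for S > mu. So it induces an
    injection of L', whose image is spanned by the F^R v with R > lam, that is, by the kernel of
    [pi]. *)
Lemma verma_exact lam mu D L D' L' (v : D) (pi : {linear D -> L}) (v' : D')
    (pi' : {linear D' -> L'}) :
  (lam <= p - 2)%N -> mu = (p - lam - 2)%N :> nat ->
  verma_mod v lam -> verma_quotient v lam pi ->
  verma_mod v' mu -> verma_quotient v' mu pi' -> short_exact L' D L.
Proof.
move=> lp mul vD qL vD' qL'.
have [g gv] := verma_hom_mod mul lp vD' vD.1.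
have gE c : g (comb v' c) = comb (F ^+ lam.+1 *: v) c by rewrite linear_comb gv.
pose sh (c : 'I_p -> K) (R : 'I_p) := if (lam < R)%N then ext0 c (R - lam.+1) else 0.
have {}gE c : g (comb v' c) = comb v (sh c) by rewrite gE comb_shift.
have kg c : g (comb v' c) = 0 <-> forall S : 'I_p, (S <= mu)%N -> c S = 0.
  rewrite gE; split=> [c0 S Sm|c0].
    have Sp : (S + lam.+1 < p)%N by lia.
    have := vD.2.2 _ c0 (Ordinal Sp).
    by rewrite /sh /= leq_addl addnK ext0E.
  rewrite /comb big1 // => R _; rewrite /sh; case: ifP => lR; last exact: scaleA0.
  have Rp : (R - lam.+1 < p)%N by have := ltn_ord R; lia.
  rewrite (ext0E c (Ordinal Rp)) c0 ?scaleA0 //=; have := ltn_ord R; lia.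
have [h hE] : exists h : {linear L' -> D}, forall x, h (pi' x) = g x.
  apply: factor_linear qL'.1 _ => x; have [c ->] := vD'.2.1 x.
  by move/(qL'.2 c) => c0; apply/kg.
exists h, pi; split.
- apply: injective_linear => y; have [x <-] := qL'.1 y; have [c ->] := vD'.2.1 x.
  by rewrite hE => /kg c0; apply/(qL'.2 c).
- exact: qL.1.
move=> y; split=> [|[x <-]].
  have [c ->] := vD.2.1 y => /(qL.2 c) c0.
  exists (pi' (comb v' (fun S => ext0 c (S + lam.+1)))); rewrite hE gE.
  apply: eq_bigr => R _; congr (_%:A *: _); rewrite /sh.
  case: ltnP => [lR|Rl]; last by rewrite c0.
  have Rp : (R - lam.+1 < p)%N by have := ltn_ord R; lia.
  by rewrite (ext0E _ (Ordinal Rp)) /= subnK ?ext0E.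
have [x' <-] := qL'.1 x; have [c ->] := vD'.2.1 x'; rewrite hE gE.
by apply/(qL.2 _) => S Sl; rewrite /sh ltnNge Sl.
Qed.

End SimpleQuotients.

(** * Cell modules as induced modules *)

Section BabyVerma.
Context (K : fieldType) (p : nat) (p_gt2 : (2 < p)%N) (charK : p \in [pchar K]).
Context (u : algType K) (E F H : u).
Hypothesis hu : restricted_enveloping_sl2 p E F H.

Let rel : sl2_relations p E F H := hu.1.
Let p_gt0 : (0 < p)%N := prime_gt0 (pcharf_prime charK).
Let o : 'I_p := Ordinal p_gt0.

Lemma borel_idem z n (k : K) : borel E H (k *: (idem p H z * E ^+ n)).
Proof.
move=> B [B1 BZ BM] HB EB.
have B0 : 0 \in B by rewrite -(addNr (1 : u)) -scaleN1r; apply: BZ.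
have scB c x : x \in B -> c *: x \in B by move=> xB; rewrite -[c *: x]addr0; apply: BZ.
have addB x y : x \in B -> y \in B -> x + y \in B.
  by move=> xB yB; rewrite -[x]scale1r; apply: BZ.
have EnB : E ^+ n \in B by elim: n => [|n IH]; rewrite ?expr0 // exprS; apply: BM.
apply/scB/BM => //; rewrite idem_lagr.
elim/poly_ind: (lagr K p z) => [|q c IH]; first by rewrite rmorph0.
rewrite rmorphD rmorphM /= horner_algX horner_algC.
by apply: addB; [apply: BM|apply: scB].
Qed.

Context (lam : 'I_p) (D : lmodType u) (v : D).
Hypothesis vD : verma_mod E F H v lam.

Lemma verma_coord : exists co : D -> 'I_p -> K,
  (forall x, x = comb F v (co x)) /\ (forall c, co (comb F v c) =1 c).
Proof.
have [sp fr] := vD.2; pose co x := projT1 (cid (sp x)).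
have coE x : x = comb F v (co x) := projT2 (cid (sp x)).
exists co; split=> // c S; apply/eqP; rewrite -subr_eq0.
apply/eqP/(fr (fun S => co (comb F v c) S - c S)).
under eq_bigr do rewrite scalerBl scalerBl.
by rewrite sumrB -[X in _ - X = _]/(comb F v c) {2}(coE (comb F v c)) subrr.
Qed.

(** Every basis element of u is F^S times an element of the Borel subalgebra, so a balanced map is
    determined by its values at the F^S; since the F^S v form a basis, these values define a map on
    D. *)
Lemma verma_is_baby_verma : is_baby_verma E H lam D.
Proof.
have [co [coE co_comb]] := verma_coord; have [[Ev wv] [_ fr]] := vD.
have co_uniq x c S : x = comb F v c -> co x S = c S by move=> ->; apply: co_comb.
have coD x y S : co (x + y) S = co x S + co y S.
  apply: (co_uniq _ (fun S => co x S + co y S)); rewrite {1}(coE x) {1}(coE y).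
  by rewrite /comb -big_split; apply: eq_bigr => R _; rewrite /= scaleADl.
have co_mono k S R : co (F ^+ (S : 'I_p) *: (k%:A *: v)) R = if R == S then k else 0.
  by apply: (co_uniq _ (fun R => if R == S then k else 0)); rewrite comb_single scaleAC.
pose chi x := co (x *: v) o.
have chi_uniq x k : x *: v = k%:A *: v -> chi x = k.
  by move=> e; rewrite /chi e -[_ *: _]scale1r -(expr0 F) (co_mono k o) eqxx.
(* The elements acting on v by a scalar form a subalgebra containing H and E. *)
have chiE x : borel E H x -> x *: v = (chi x)%:A *: v.
  move=> bx; pose B := [pred x : u | x *: v == (chi x)%:A *: v].
  have BP y k : y *: v = k%:A *: v -> y \in B.
    by move=> e; rewrite inE; apply/eqP; rewrite (chi_uniq _ _ e).
  suff: x \in B by rewrite inE => /eqP.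
  apply: bx.
  - split=> [|k a b|a b]; rewrite ?inE.
    + by apply/(BP _ 1); rewrite scaleA1 scale1r.
    + move=> /eqP ex /eqP ey; apply/(BP _ (k * chi a + chi b)).
      by rewrite [LHS]scalerDl scaleAe ex ey scaleAA -scaleADl.
    + move=> /eqP ex /eqP ey; apply/(BP _ (chi b * chi a)).
      by rewrite -[LHS]scalerA ey scaleAC ex scaleAA.
  - by apply: (BP _ lam%:R); rewrite [LHS]wv.
  - by apply: (BP _ 0); rewrite Ev scaleA0.
exists chi, (fun x k => x *: (k%:A *: v)); split.
  split.
  - by apply: chi_uniq; rewrite scaleA1 scale1r.
  - move=> k x y bx bY; apply: chi_uniq.
    by rewrite [LHS]scalerDl scaleAe (chiE x bx) (chiE y bY) scaleAA -scaleADl.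
  - move=> x y bx bY; apply: chi_uniq.
    by rewrite -[LHS]scalerA (chiE y) // scaleAC chiE // scaleAA mulrC.
  - by apply: chi_uniq; rewrite Ev scaleA0.
  - by apply: chi_uniq; rewrite [LHS]wv.
split.
- split=> [x y k|x k l|x s k bs].
  + by rewrite scalerDl.
  + by rewrite scaleADl scalerDr.
  + by rewrite -[LHS]scalerA scaleAC chiE // scaleAA mulrC.
- by move=> a x k; rewrite [RHS]scalerA.
move=> W beta [betaDl betaDr betaS].
have beta0r x : beta x 0 = 0 by apply/(addrI (beta x 0)); rewrite -betaDr !addr0.
have beta0l k : beta 0 k = 0 by apply/(addrI (beta 0 k)); rewrite -betaDl !addr0.
pose g y := \sum_S beta (F ^+ (S : 'I_p)) (co y S).
have gD : {morph g : x y / x + y}.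
  move=> x y; rewrite /g -big_split; apply: eq_bigr => S _.
  by rewrite coD betaDr.
have g0 : g 0 = 0 by apply/(addrI (g 0)); rewrite -gD !addr0.
have gb x k : g (x *: (k%:A *: v)) = beta x k.
  have [c ->] := in_pbwT charK hu x; rewrite /pbw.
  do 3! [elim/big_ind: _ => [|? ? e1 e2|? _];
    [by rewrite scale0r g0 beta0l|by rewrite scalerDl gD betaDl e1 e2|]].
  set S := (X in c _ X _); set R := (X in c _ _ X); set l := (X in c X).
  have := @borel_idem l%:Z R (c l S R); set s := _ *: _ => bs.
  have -> : c l S R *: cellC E F H l S R = F ^+ S * s by rewrite /s -scalerAr mulrA.
  rewrite (betaS _ _ _ bs) -scalerA scaleAC (chiE s) // scaleAA mulrC.
  rewrite /g (bigD1 S) //= co_mono eqxx big1 ?addr0 // => T /negbTE TS.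
  by rewrite co_mono TS.
have [G GE] : exists G : {additive D -> W}, G =1 g.
  have gB : additive g.
    by move=> x y; apply/(addIr (g y)); rewrite -gD !subrK.
  by exists (HB.pack_for {additive D -> W} g (GRing.isZmodMorphism.Build _ _ _ gB)).
exists G; split=> [x k|g' g'b y]; first by rewrite GE gb.
rewrite GE (coE y) raddf_sum /g; apply: eq_bigr => S _.
by rewrite co_comb -scaleAC g'b.
Qed.

End BabyVerma.

(** * Projective covers *)

Section Nakayama.
Context (K : fieldType) (u : algType K) (V : lmodType u).

Let submodP (N : {pred V}) : submod_closed N ->
  [/\ 0 \in N, forall a x, x \in N -> a *: x \in N & forall x y, x \in N -> y \in N -> x + y \in N].
Proof.
move=> [N0 NZ]; split=> // [a x xN|x y xN yN]; first by rewrite -[_ *: _]addr0; apply: NZ.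
by rewrite -[x]scale1r; apply: NZ.
Qed.

Lemma maximal_submod_exists m (N : {pred V}) (b : 'I_m -> V) : submod_closed N ->
  (exists x, x \notin N) ->
  (forall x, exists (c : 'I_m -> K) (y : V), y \in N /\ x = y + \sum_i (c i)%:A *: b i) ->
  exists2 N' : {pred V}, maximal_submod N' & {subset N <= N'}.
Proof.
elim: m => [|m IH] in N b *.
  move=> hN [x xN] /(_ x) [c [y [yN xE]]].
  by rewrite xE big_ord0 addr0 yN in xN.
move=> hN Nproper span; have [max|nmax] := EM (maximal_submod N); first by exists N.
have [N' [hN' NN' [y yN' yN] N'proper]] : exists N' : {pred V},
    [/\ submod_closed N', {subset N <= N'}, exists2 y, y \in N' & y \notin N
      & exists x, x \notin N'].
  apply/not_existsP => h; apply: nmax; split=> // N' hN' NN'.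
  have := h N'; apply: contra_notP => /not_orP [n1 n2]; split=> //.
    move: n1; apply: contra_notP => h1 x xN'; apply/negP => /negP xN.
    by apply: h1; exists x.
  by move: n2; apply: contra_notP => h2 x; apply/negP => /negP xN; apply: h2; exists x.
have [c [n [nN yE]]] := span y.
have [[N0 NZ ND] [N0' NZ' ND']] := (submodP hN, submodP hN').
have [i ci] : exists i, c i != 0.
  apply/not_existsP => h; case/negP: yN; rewrite yE big1 ?addr0 // => i _.
  by rewrite (_ : c i = 0) ?scaleA0 //; apply/eqP/negPn/negP/h.
have [|N'' maxN'' sub] := IH N' (fun j => b (lift i j)) hN' N'proper.
  move=> x; have [d [n1 [n1N xE]]] := span x.
  (* y - n lies in N' and involves b i with the nonzero coefficient c i; t times it removes b i from
     the expression of x. *)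
  pose t := d i / c i.
  exists (fun j => d (lift i j) - t * c (lift i j)), (n1 + t%:A *: (y - n)); split.
    apply: (ND' _ _ (NN' _ n1N)); apply/NZ'/ND' => //.
    by rewrite -scaleN1r; apply/NZ'/NN'.
  rewrite xE -addrA; congr (_ + _); rewrite yE addrAC subrr add0r.
  rewrite (bigD1_ord i) //= [in RHS](bigD1_ord i) //= scalerDr scaleAA divfK //.
  rewrite -addrA; congr (_ + _); rewrite scaler_sumr -big_split; apply: eq_bigr => j _ /=.
  by rewrite scaleAA -scaleADl addrCA subrr addr0.
by exists N'' => // x xN; apply/sub/NN'.
Qed.

(** Nakayama: were u v proper, it would lie in a maximal submodule, which contains the radical and
    hence the kernel of f; but u v and that kernel together span V. *)
Lemma cyclic_of_head (L : lmodType u) (f : {linear V -> L}) (v : V) : fin_dim (kspace V) ->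
  (forall x, f x = 0 -> radical x) -> (forall y, exists b, y = b *: f v) ->
  forall x, exists b, x = b *: v.
Proof.
move=> [n [b hb]] frad gen x0; apply: contrapT => nx0.
pose N := [pred x | `[< exists a, x = a *: v >]].
have hN : submod_closed N.
  split=> [|a x y /asboolP [s ->] /asboolP [t ->]]; apply/asboolP.
    by exists 0; rewrite scale0r.
  by exists (a * s + t); rewrite scalerDl scalerA.
have [||N' maxN' NN'] := @maximal_submod_exists n N b hN.
- by exists x0; apply/asboolP.
- move=> x; have [c xE] := (is_basis_sum hb).1 x.
  by exists c, 0; split; [case: hN|rewrite add0r].
have [hN' [z zN'] _] := maxN'; have [N0 NZ ND] := submodP hN'.
have [a az] := gen (f z); case/negP: zN'.
rewrite -(subrK (a *: v) z); apply: ND; last by apply: NN'; apply/asboolP; exists a.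
by apply: frad maxN'; rewrite linearB linearZZ -az subrr.
Qed.

End Nakayama.

(** * The Casimir element *)

Section Casimir.
Context (K : fieldType) (p : nat) (charK : p \in [pchar K]).
Context (u : algType K) (E F H : u).
Hypothesis rel : sl2_relations p E F H.
Let br : sl2_brackets E F H. Proof. by case: rel. Qed.

(* Four times the usual Casimir element, so that no division by 4 is needed. *)
Definition casimir : u := 4%:R *: (F * E) + (H + 1) ^+ 2.

Let shiftE c : (H + c%:A) * E = E * (H + (c + 2)%:A).
Proof.
rewrite mulrDl (brackets_HE br) mulr_algl mulrDr mulr_natr [RHS]mulrDr mulr_algr.
by rewrite scalerDl scaler_nat -addrA; congr (_ + _); rewrite addrC.
Qed.

Let shiftF c : (H + c%:A) * F = F * (H + (c - 2)%:A).
Proof.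
rewrite mulrDl (brackets_HF br) mulr_algl mulrBr mulr_natr [RHS]mulrDr mulr_algr.
by rewrite scalerBl scaler_nat -addrA; congr (_ + _); rewrite addrC.
Qed.

(** Polynomial identities in H are proved by [ring] in the commutative ring K[X] and carried over to
    u. *)
Let hornerS a b c d : horner_alg H (a%:P * ('X + b%:P) + ('X + c%:P) ^+ 2) =
  horner_alg H (('X + d%:P) ^+ 2) -> a%:A * (H + b%:A) + (H + c%:A) ^+ 2 = (H + d%:A) ^+ 2.
Proof. by rewrite !(rmorphD, rmorphM, rmorphXn) /= !horner_algX !horner_algC. Qed.

Lemma casimirE : casimir * E = E * casimir.
Proof.
(* Moving E to the left of F E leaves 4 E (H + 2), and moving it past (H + 1)^2 leaves E (H + 3)^2;
   this identity balances the two. *)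
have id1 : 4%:R%:P * ('X + 2%:R%:P) + ('X + 1%:R%:P) ^+ 2 = ('X + 3%:R%:P) ^+ 2 :> {poly K}.
  by rewrite !polyC_natr; ring.
have {}id1 := hornerS (congr1 (horner_alg H) id1).
have -> : casimir = 4%:R *: (F * E) + (H + 1%:R%:A) ^+ 2 by rewrite /casimir scale1r.
rewrite mulrDl expr2 -mulrA shiftE mulrA shiftE -mulrA.
have -> : (1%:R + 2 = 3%:R :> K) by rewrite -natrD.
rewrite -expr2 -id1 [E * (_ + _ ^+ 2)]mulrDr [RHS]mulrDr addrA; congr (_ + _).
rewrite mulr_algl -!scalerAr -scalerAl -scalerDr; congr (_ *: _).
by rewrite mulrA (brackets_EF br) mulrDl (brackets_HE br) scaler_nat.
Qed.

Lemma casimirF : casimir * F = F * casimir.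
Proof.
have id1 : 4%:R%:P * ('X + 0%:P) + ('X + (1%:R - 2)%:P) ^+ 2 = ('X + 1%:R%:P) ^+ 2 :> {poly K}.
  by rewrite polyCB !polyC_natr addr0; ring.
have {}id1 := hornerS (congr1 (horner_alg H) id1).
have -> : casimir = 4%:R *: (F * E) + (H + 1%:R%:A) ^+ 2 by rewrite /casimir scale1r.
have sF : (H + 1%:R%:A) ^+ 2 * F = F * (H + (1%:R - 2)%:A) ^+ 2.
  by rewrite expr2 -mulrA shiftF mulrA shiftF -mulrA -expr2.
rewrite mulrDl sF -id1 [RHS]mulrDr [F * (_ + _ ^+ 2)]mulrDr addrA.
congr (_ + _); rewrite mulr_algl -!scalerAr -scalerAl -scalerDr; congr (_ *: _).
by rewrite scale0r addr0 -mulrA (brackets_EF br) mulrDr.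
Qed.

Lemma casimirH : casimir * H = H * casimir.
Proof.
have -> : H = E * F - F * E by rewrite (brackets_EF br) addrAC subrr add0r.
rewrite mulrBr mulrBl !mulrA casimirE casimirF -!mulrA casimirE casimirF.
by [].
Qed.

Lemma horner_alg_comm (C x : u) (q : {poly K}) : C * x = x * C ->
  horner_alg C q * x = x * horner_alg C q.
Proof.
move=> cx; elim/poly_ind: q => [|q c IH]; first by rewrite rmorph0 mul0r mulr0.
rewrite rmorphD rmorphM /= horner_algX horner_algC [LHS]mulrDl [RHS]mulrDr -mulrA cx.
by rewrite !mulrA IH mulr_algl mulr_algr.
Qed.

Lemma casimir_weight (V : lmodType u) z (v : V) : weight H z v ->
  casimir *: v = 4%:R%:A *: (F *: (E *: v)) + ((z%:~R + 1) ^+ 2)%:A *: v.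
Proof.
move=> wv; rewrite [LHS]scalerDl scaleAe -[_ *: v]scalerA; congr (_ + _).
have h1 : (H + 1) *: v = (z%:~R + 1)%:A *: v.
  by rewrite [LHS]scalerDl [H *: v]wv scaleADl scaleA1 scale1r.
by rewrite expr2 -[LHS]scalerA h1 scaleAC h1 scaleAA.
Qed.

Lemma casimir_weight_closed (V : lmodType u) z (v : V) (q : {poly K}) :
  weight H z v -> weight H z (horner_alg casimir q *: v).
Proof.
move=> wv; rewrite /weight [LHS]scalerA -(horner_alg_comm _ casimirH) -[LHS]scalerA.
by rewrite [H *: v]wv scaleAC.
Qed.

End Casimir.

Section Exactness.
Context (K : fieldType) (p : nat) (p_gt2 : (2 < p)%N) (charK : p \in [pchar K]).
Context (u : algType K) (E F H : u).
Hypothesis hu : restricted_enveloping_sl2 p E F H.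

Lemma odd_char : odd p.
Proof. by have := even_prime (pcharf_prime charK); case=> // p2; move: p_gt2; rewrite p2. Qed.

Lemma E_exact k x : (k <= p)%N -> E ^+ k * x = 0 -> exists y, x = E ^+ (p - k) * y.
Proof. exact: (F_exact charK (enveloping_swap hu odd_char)). Qed.

(** P is cyclic, hence a direct summand of the regular module: a section carries x into u, where
    exactness is assumed, and the projection brings the preimage back. *)
Lemma projective_exact (P : lmodType u) (w : P) (X : u) :
  projective P -> (forall x, exists b, x = b *: w) ->
  (forall x, X * x = 0 -> exists y, x = X ^+ p.-1 * y) ->
  forall x : P, X *: x = 0 -> exists y, x = X ^+ p.-1 *: y.
Proof.
move=> projP gen exX x Xx.
have [q qE] : exists q : {linear u^o -> P}, q =1 (fun a => a *: w).
  by apply: linear_of_fun => a y z; rewrite scalerDl -scalerA.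
have sq : surj q by move=> y; have [b ->] := gen y; exists b; rewrite qE.
have [s sE] := projP _ _ q idfun sq.
have [y sy] : exists y, s x = X ^+ p.-1 * y.
  by apply: exX; rewrite -[LHS](linearZZ s) Xx linear0.
by exists (y *: w); rewrite -[x]/(idfun x) -sE qE sy -scalerA.
Qed.

End Exactness.

(** * Structure of the projective cover of L(lam) *)

Section ProjectiveCover.
Context (K : fieldType) (p : nat) (p_gt2 : (2 < p)%N) (charK : p \in [pchar K]).
Context (u : algType K) (E F H : u).
Hypothesis hu : restricted_enveloping_sl2 p E F H.

Let rel : sl2_relations p E F H := hu.1.
Let Fp : F ^+ p = 0. Proof. by case: rel. Qed.
Let Ep : E ^+ p = 0. Proof. by case: rel. Qed.
Let p_gt0 : (0 < p)%N := prime_gt0 (pcharf_prime charK).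
Let o : 'I_p := Ordinal p_gt0.

Context (lam : 'I_p) (D L : lmodType u) (v : D) (pi : {linear D -> L}).
Hypotheses (vD : verma_mod E F H v lam) (qL : verma_quotient F v lam pi).
Context (P : lmodType u) (f : {linear P -> L}).
Hypotheses (fdP : fin_dim (kspace P)) (projP : projective P).
Hypotheses (sf : surj f) (kf : forall x, f x = 0 <-> radical x).

Let C := casimir E F H.
(* The eigenvalue of the Casimir element on Delta (lam + 2T): these modules filter u 1_lam,
   and only T = 0 and T = n share the eigenvalue of Delta (lam). *)
Let cT (T : nat) : K := ((lam%:Z + (2 * T)%:Z)%:~R + 1) ^+ 2.
Let n := (p.-1 - lam)%N.
Let l := pi v.

Let cT0 T : cT T - cT 0 = 4%:R * T%:R * (lam + 1 + T)%:R.
Proof. by rewrite /cT muln0 addr0; ring. Qed.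

Let cn : cT n = cT 0.
Proof.
apply/eqP; rewrite -subr_eq0 cT0 (_ : (lam + 1 + n)%N = p); last by have := ltn_ord lam; rewrite /n; lia.
by rewrite (pcharf0 charK) mulr0.
Qed.

Let four_neq0 : 4%:R != 0 :> K.
Proof.
rewrite (natr_eq0_pchar charK) (_ : 4 = 2 * 2)%N // Euclid_dvdM ?(pcharf_prime charK) //.
by rewrite orbb gtnNdvd.
Qed.

Let cT_neq T : (0 < T < p)%N -> T != n -> cT T != cT 0.
Proof.
move=> /andP [T0 Tp] Tn; rewrite -subr_eq0 cT0 !mulf_neq0 ?four_neq0 //.
  by rewrite (natr_eq0_pchar charK) gtnNdvd.
rewrite (natr_eq0_pchar charK); apply/negP => /dvdnP [q qE].
have lp := ltn_ord lam; move: qE Tn; rewrite /n => qE Tn.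
have q1 : q = 1%N by nia.
by rewrite q1 mul1n in qE; move/eqP: Tn; apply; lia.
Qed.

Let casimir_E (V : lmodType u) (w : V) T : weight H lam%:Z w ->
  C *: (E ^+ T *: w) = 4%:R%:A *: (F *: (E ^+ T.+1 *: w)) + (cT T)%:A *: (E ^+ T *: w).
Proof.
by move=> ww; rewrite (casimir_weight E F (weightEn charK rel T ww)) [E *: _]scalerA -exprS.
Qed.

Let hornerC_comm (q : {poly K}) x : C * x = x * C -> horner_alg C q * x = x * horner_alg C q.
Proof. exact: horner_alg_comm. Qed.

Let qT s : {poly K} := \prod_(s <= T < p) ('X - (cT T)%:P).

(** Downward induction from E^p = 0: C - cT s sends E^s w to a multiple of F E^(s+1) w, and C
    commutes with F. *)
Let qT_kill (V : lmodType u) (w : V) s : weight H lam%:Z w -> (s <= p)%N ->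
  horner_alg C (qT s) *: (E ^+ s *: w) = 0.
Proof.
move=> ww sp; have [d] := ubnP (p - s)%N; elim: d => // d IH in s sp *; rewrite ltnS => sd.
move: sp; rewrite leq_eqVlt => /orP [/eqP ->|sp]; first by rewrite Ep scale0r scaler0.
rewrite /qT big_ltn // mulrC rmorphM /= -[LHS]scalerA rmorphB /= horner_algX horner_algC.
rewrite scalerBl casimir_E // addrK scaleAC [_ *: (F *: _)]scalerA.
rewrite (hornerC_comm _ (casimirF rel)) -[_ *: (E ^+ _ *: _)]scalerA IH ?scaler0 //.
by lia.
Qed.

Let good_generator : exists w : P,
  [/\ weight H lam%:Z w, exists2 k, k != 0 & f w = k%:A *: l &
      horner_alg C (('X - (cT 0)%:P) ^+ 2) *: w = 0].
Proof.
have [w0' fw0'] := sf l; pose w0 := idem p H lam%:Z *: w0'.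
have hl := quotient_hw pi vD.
have ww0 : weight H lam%:Z w0 := weight_idem charK rel _ _.
have fw0 : f w0 = l by rewrite linearZZ fw0' (idem_weight charK hl.2).
(* q(C) projects onto the generalized eigenspace of C for cT 0. *)
pose q : {poly K} := \prod_(T < p | (T != o) && (T != n :> nat)) ('X - (cT T)%:P).
have horner_l (r : {poly K}) : horner_alg C r *: l = r.[cT 0]%:A *: l.
  elim/poly_ind: r => [|r c IH]; first by rewrite rmorph0 horner0 !scale0r.
  rewrite rmorphD rmorphM /= horner_algX horner_algC hornerMXaddC [LHS]scalerDl.
  rewrite -[(_ * C) *: l]scalerA (casimir_weight E F hl.2) hl.1 !scaler0 add0r.
  by rewrite scaleAC IH scaleAA scaleADl /cT muln0 addr0 mulrC.
exists (horner_alg C q *: w0); split.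
- exact: (casimir_weight_closed rel).
- exists q.[cT 0]; last by rewrite linearZZ fw0 horner_l.
  rewrite horner_prod; apply/prodf_neq0 => T /andP [To Tn].
  by rewrite !hornerE subr_eq0 eq_sym; apply: cT_neq => //; rewrite ltn_ord andbT lt0n.
rewrite [LHS]scalerA -rmorphM /=.
(* For n > 0 the square accounts for both T = 0 and T = n, since cT n = cT 0. For n = 0 the two
   indices coincide and one factor is left over. *)
have [r ->] : exists r, ('X - (cT 0)%:P) ^+ 2 * q = r * qT 0.
  have -> : qT 0 = ('X - (cT 0)%:P) * \prod_(T < p | T != o) ('X - (cT T)%:P).
    by rewrite /qT big_mkord (bigD1 o).
  have [n0|n0] := posnP n.
    exists ('X - (cT 0)%:P); rewrite expr2 -mulrA; congr (_ * (_ * _)).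
    by apply: eq_bigl => T; rewrite n0 -[T != 0%N :> nat]/(T != o) andbb.
  have np : (n < p)%N by rewrite /n; lia.
  exists 1; rewrite mul1r expr2 -mulrA (bigD1 (Ordinal np)) ?/= -?lt0n // cn.
  by congr (_ * (_ * _)); apply: eq_bigl.
by rewrite rmorphM /= -[LHS]scalerA -[w0]scale1r -(expr0 E) qT_kill ?scaler0.
Qed.

Section Generator.
Context (w : P) (k : K).
Hypotheses (ww : weight H lam%:Z w) (k0 : k != 0) (fw : f w = k%:A *: l).
Hypothesis (Cw : horner_alg C (('X - (cT 0)%:P) ^+ 2) *: w = 0).

Let genP x : exists b, x = b *: w.
Proof.
apply: (cyclic_of_head fdP (fun x => (kf x).1)) => y.
have [b ->] := quotient_generated vD qL y; exists (b * k^-1%:A).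
by rewrite fw -scalerA scaleAA mulVf // scaleA1.
Qed.

Let N : u := C - (cT 0)%:A.

Let N_comm x : C * x = x * C -> N * x = x * N.
Proof. by move=> cx; rewrite mulrBl mulrBr cx mulr_algl mulr_algr. Qed.

Let N2E T : N *: (N *: (E ^+ T *: w)) = 0.
Proof.
have NE : N * E ^+ T = E ^+ T * N.
  apply: N_comm; elim: T => [|T IH]; first by rewrite mulr1 mul1r.
  by rewrite exprS mulrA (casimirE rel) -mulrA IH mulrA.
rewrite [N *: (E ^+ _ *: _)]scalerA NE -[(_ * N) *: w]scalerA [LHS]scalerA NE -[LHS]scalerA.
rewrite [N *: (N *: w)]scalerA.
by move: Cw; rewrite expr2 rmorphM rmorphB /= horner_algX horner_algC => ->; rewrite scaler0.
Qed.

Let N_E T : N *: (E ^+ T *: w) =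
  4%:R%:A *: (F *: (E ^+ T.+1 *: w)) + (cT T - cT 0)%:A *: (E ^+ T *: w).
Proof. by rewrite [LHS]scalerBl casimir_E // -addrA -scaleAN -scaleADl. Qed.

Let N_nilp (V : lmodType u) (x : V) a : a != 0 -> N *: x = a%:A *: x -> N *: (N *: x) = 0 -> x = 0.
Proof.
move=> a0 Nx; rewrite Nx scaleAC Nx scaleAA => /scaleAI; apply.
by rewrite mulf_neq0.
Qed.

(** Descending induction from E^p = 0: once E^(T+1) w = 0, the vector E^T w is an eigenvector of N,
    with nonzero eigenvalue as T > n, while N^2 kills it. *)
Let E_zero T : (n < T)%N -> E ^+ T *: w = 0.
Proof.
have [d] := ubnP (p - T)%N; elim: d => // d IH in T *; rewrite ltnS => Td nT.
have [pT|Tp] := leqP p T; first by rewrite -(subnK pT) exprD Ep mulr0 scale0r.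
apply: (@N_nilp _ _ (cT T - cT 0)); last exact: N2E.
  by rewrite subr_eq0 cT_neq ?Tp ?andbT ?(leq_ltn_trans _ nT) //; move: nT; rewrite ltn_neqAle eq_sym => /andP [].
by rewrite N_E IH ?scaler0 ?add0r //; lia.
Qed.

Let y := E ^+ n *: w.

Let y_hw : hw_vector E H (- (lam + 2)%:Z) y.
Proof.
split; first by rewrite /y scalerA -exprS E_zero.
apply: weight_mod (weightEn charK rel n ww); apply/eqP; rewrite (intr_eq_mod charK).
rewrite eqz_mod_dvd (_ : _ - _ = (2 * p)%N%:Z) ?dvdzE //=; first exact: dvdn_mull.
by have := ltn_ord lam; rewrite /n; lia.
Qed.

Let N_Fy i : N *: (F ^+ i *: y) = 0.
Proof.
have NF : N * F ^+ i = F ^+ i * N.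
  apply: N_comm; elim: i => [|i IH]; first by rewrite mulr1 mul1r.
  by rewrite exprS mulrA (casimirF rel) -mulrA IH mulrA.
rewrite [LHS]scalerA NF -[LHS]scalerA N_E E_zero // scaler0 scaler0 add0r.
by rewrite cn subrr scaleA0 scaler0.
Qed.

Let E_lower T : (0 < T <= n)%N -> exists b : K, E ^+ T *: w = b%:A *: (F ^+ (n - T) *: y).
Proof.
have [d] := ubnP (n - T)%N; elim: d => // d IH in T *; rewrite ltnS => Td /andP [T0 Tn].
move: Tn; rewrite leq_eqVlt => /orP [/eqP Tn|Tn].
  by exists 1; rewrite Tn subnn !scale1r.
have [||b bE] := IH T.+1; [by lia|by rewrite Tn|].
pose a := cT T - cT 0; have a0 : a != 0.
  by rewrite subr_eq0 cT_neq ?T0 ?(ltn_eqF Tn) //; move: Tn; rewrite /n; lia.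
have FE : F *: (E ^+ T.+1 *: w) = b%:A *: (F ^+ (n - T) *: y).
  by rewrite bE scaleAC scalerA -exprS; congr (_ *: (F ^+ _ *: _)); lia.
(* With this constant E^T w + (4b/a) F^(n-T) y is an eigenvector of N for a, because N kills F^(n-T)
   y; as N^2 kills it too, it is zero. *)
exists (- (4%:R * b / a)); rewrite scaleAN; apply/eqP; rewrite -addr_eq0; apply/eqP.
apply: (@N_nilp _ _ a) => //.
  rewrite scalerDr scaleAC N_Fy scaler0 addr0 N_E FE scalerDr !scaleAA addrC.
  by congr (_ + _%:A *: _); rewrite [RHS]mulrC divfK.
by rewrite !scalerDr N2E !scaleAC N_Fy !scaler0 addr0.
Qed.

Let span_P x : exists c d : 'I_p -> K, x = comb F w c + comb F y d.
Proof.
pose Q x := exists c d : 'I_p -> K, x = comb F w c + comb F y d.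
have combD (V : lmodType u) (z : V) c d : comb F z c + comb F z d = comb F z (fun S => c S + d S).
  by rewrite /comb -big_split; apply: eq_bigr => S _; rewrite /= scaleADl.
have comb0 (V : lmodType u) (z : V) : comb F z (fun=> 0) = 0.
  by rewrite /comb big1 // => S _; rewrite scaleA0.
have Q0 : Q 0 by exists (fun=> 0), (fun=> 0); rewrite !comb0 addr0.
have QD a b : Q a -> Q b -> Q (a + b).
  move=> [c [d ->]] [c' [d' ->]]; exists (fun S => c S + c' S), (fun S => d S + d' S).
  by rewrite -!combD addrACA.
have combF (a : K) z i : exists c : 'I_p -> K, a%:A *: (F ^+ i *: z) = comb F z c.
  have [pi_|ip] := leqP p i.
    by exists (fun=> 0); rewrite comb0 -(subnK pi_) exprD Fp mulr0 scale0r scaler0.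
  by exists (fun S => if S == Ordinal ip then a else 0); rewrite comb_single.
have QFw a i : Q (a%:A *: (F ^+ i *: w)).
  by have [c ->] := combF _ a w i; exists c, (fun=> 0); rewrite comb0 addr0.
have QFy a i : Q (a%:A *: (F ^+ i *: y)).
  by have [c ->] := combF _ a y i; exists (fun=> 0), c; rewrite comb0 add0r.
have [b ->] := genP x; have [c ->] := in_pbwT charK hu b; rewrite /pbw.
do 3! [rewrite scaler_suml; elim/big_ind: _ => [//|//|? _]].
rewrite scaleAe /cellC -2!scalerA (idem_weightE charK _ (weightEn charK rel _ ww)).
case: ifP => _; last by rewrite !scaler0.
set R := (X in E ^+ X); have [->|R0] := posnP R; first by rewrite scale1r; apply: QFw.
have [Rn|nR] := leqP R n; last by rewrite E_zero // !scaler0.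
have [|e ->] := @E_lower R; first by rewrite R0.
by rewrite scaleAC [F ^+ _ *: (F ^+ _ *: _)]scalerA -exprD scaleAA; apply: QFy.
Qed.

Context (phi : {linear P -> D}) (phiE : forall x, pi (phi x) = f x).

(** The weight space of Delta(lam) for lam is the line of v, and the factor is nonzero because f w
    is. *)
Let phi_w : exists2 k', k' != 0 & phi w = k'%:A *: v.
Proof.
have [c cE] := vD.2.1 (phi w); have := linear_weight phi ww; move/(idem_weight charK).
rewrite {1}cE scaler_sumr (bigD1 o) //= big1 ?addr0 => [e|S So]; last first.
  have := idem_En_Fn charK hu o S p_gt2 vD.1; rewrite expr0 mulr1 (negbTE So) scaleAC => ->.
  by rewrite scaler0.
rewrite scale1r scaleAC (idem_weight charK vD.1.2) in e; exists (c o) => //.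
apply/eqP => c0; case: (quotient_neq0 charK qL); apply: (scaleAI k0).
by rewrite -/l -fw -phiE -e c0 scaleA0 linear0.
Qed.

Let phi_surj : surj phi.
Proof.
have [k' k'0 phiw] := phi_w; move=> x; have [c ->] := vD.2.1 x.
exists (comb F w (fun S => c S / k')); rewrite linear_comb phiw; apply: eq_bigr => S _.
by rewrite scaleAC scaleAA divfK.
Qed.

Let phi_comb (c : 'I_p -> K) : phi (comb F w c) = 0 -> forall S, c S = 0.
Proof.
have [k' k'0 phiw] := phi_w; rewrite linear_comb phiw => c0 S.
have /vD.2.2/(_ S)/eqP : comb F v (fun S => c S * k') = 0.
  by rewrite -[RHS]c0; apply: eq_bigr => T _; rewrite scaleAC scaleAA.
by rewrite mulf_eq0 (negbTE k'0) orbF => /eqP.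
Qed.

Lemma cover_top : lam = p.-1 :> nat -> isomorphic P D.
Proof.
move=> lp; exists phi; apply: bijective_linear => // x.
have n0 : n = 0%N by rewrite /n lp subnn.
have [b ->] := genP x; rewrite linearZZ => bphi.
have [k' k'0 phiw] := phi_w.
have hw : hw_vector E H lam%:Z w.
  by split=> //; have := E_zero (_ : (n < 1)%N); rewrite n0 expr1; apply.
have [beta act] := hw_action charK hu b lam%:Z.
rewrite (act _ _ hw.1 hw.2) big1 // => S _; rewrite (phi_comb (c := beta)) ?scaleA0 //.
have -> : comb F w beta = b *: w by rewrite (act _ _ hw.1 hw.2).
by rewrite linearZZ.
Qed.

Hypothesis lam_lt : (lam <= p - 2)%N.

Let n0 : (0 < n)%N. Proof. by rewrite /n; lia. Qed.

Let phi_y : phi y = 0.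
Proof.
have [k' k'0 phiw] := phi_w.
by rewrite /y linearZZ phiw scaleAC -(prednK n0) exprSr -scalerA vD.1.1 !scaler0.
Qed.

Let F_exactP (x : P) : F *: x = 0 -> exists x', x = F ^+ p.-1 *: x'.
Proof.
apply: (projective_exact projP genP) => a Fa.
have := F_exact charK hu (k := 1) (ltnW (ltnW p_gt2)); rewrite subn1 expr1; exact.
Qed.

Let E_exactP (x : P) : E *: x = 0 -> exists x', x = E ^+ p.-1 *: x'.
Proof.
apply: (projective_exact projP genP) => a Ea.
have := E_exact p_gt2 charK hu (k := 1) (ltnW (ltnW p_gt2)); rewrite subn1 expr1; exact.
Qed.

Let Fp1 (V : lmodType u) (z : V) (c : 'I_p -> K) : F ^+ p.-1 *: comb F z c = (c o)%:A *: (F ^+ p.-1 *: z).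
Proof.
rewrite /comb scaler_sumr (bigD1 o) //= big1 ?addr0 ?scale1r ?scaleAC // => S So.
rewrite scaleAC scalerA -exprD; have S0 : (0 < S)%N by rewrite lt0n.
have -> : (p.-1 + S = S.-1 + p)%N by lia.
by rewrite exprD Fp mulr0 scale0r scaler0.
Qed.

Let E_top (x : L) : E ^+ p.-1 *: x = 0.
Proof.
have [x' <-] := qL.1 x; have [c ->] := vD.2.1 x'; rewrite linear_comb scaler_sumr big1 // => S _.
rewrite scaleAC -/l; have [Sl|lS] := leqP S lam; last first.
  by rewrite (quotient_Fn hu qL lS) !scaler0.
have hl := quotient_hw pi vD.
have -> : p.-1 = ((p.-1 - S).-1.+1 + S)%N by lia.
by rewrite exprD -scalerA (En_Fn_hw hu S hl) scaleAC exprSr -scalerA hl.1 !scaler0.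
Qed.

(** If y = 0 then E w = 0, so exactness puts w into E^(p-1) P. But E^(p-1) kills L(lam) for lam < p
    - 1, whereas f w is nonzero. *)
Let y_neq0 : y <> 0.
Proof.
move=> y0; have [b Ew] := @E_lower 1 n0; rewrite expr1 y0 !scaler0 in Ew.
have [x' wE] := E_exactP Ew.
case: (quotient_neq0 charK qL); apply: (scaleAI k0).
by rewrite -/l -fw wE linearZZ E_top.
Qed.

(* If F^(p-1) y = 0, then F^(p-1) P is spanned by F^(p-1) w, whereas F^k y lies in the kernel of
   phi, so exactness of F on P kills F^k y for smaller and smaller k. *)
Let Fy_neq0 : F ^+ p.-1 *: y <> 0.
Proof.
have Fyi i : (i < p)%N -> F ^+ p.-1 *: y = 0 -> F ^+ (p.-1 - i) *: y = 0.
  move=> ip Fy; elim: i => [|i IH] in ip *; first by rewrite subn0.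
  have [x'] : exists x', F ^+ (p.-1 - i.+1) *: y = F ^+ p.-1 *: x'.
    by apply: F_exactP; rewrite scalerA -exprS -[in RHS](IH (ltnW ip)); congr (F ^+ _ *: _); lia.
  have [c [d ->]] := span_P x'; rewrite scalerDr !Fp1 Fy scaler0 addr0 => e.
  have := congr1 phi e; rewrite linearZZ phi_y scaler0 => /esym.
  have p1 : (p.-1 < p)%N by rewrite prednK.
  rewrite -(comb_single F w (Ordinal p1) (c o)) => /phi_comb/(_ (Ordinal p1)).
  by rewrite eqxx => c0; rewrite e c0 scaleA0.
move=> Fy; apply: y_neq0; have := Fyi p.-1 _ Fy; rewrite subnn scale1r prednK //.
by apply.
Qed.

Let y_free (c : 'I_p -> K) : comb F y c = 0 -> forall S, c S = 0.
Proof.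
move=> c0 S; elim/ltn_ind: {S}(S : nat) {-2}S (erefl (S : nat)) => i IH S Si.
have : F ^+ (p.-1 - S) *: comb F y c = (c S)%:A *: (F ^+ p.-1 *: y).
  rewrite /comb scaler_sumr (bigD1 S) //= big1 ?addr0 => [|R RS].
    by rewrite scaleAC scalerA -exprD subnK // -ltnS prednK.
  rewrite scaleAC scalerA -exprD; case: (ltngtP R S) => [lt|lt|/ord_inj eq].
  - by rewrite (IH R _ R erefl) ?scaleA0 -?Si.
  - have -> : (p.-1 - S + R = (R - S).-1 + p)%N by have := ltn_ord R; lia.
    by rewrite exprD Fp mulr0 scale0r scaler0.
  - by rewrite eq eqxx in RS.
rewrite c0 scaler0 => /esym e; apply/eqP/negP => /negP cS; apply: Fy_neq0.
exact: scaleAI cS e.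
Qed.

Lemma cover_exact (D' : lmodType u) (v' : D') (mu : 'I_p) :
  mu = (p - lam - 2)%N :> nat -> verma_mod E F H v' mu -> short_exact D' P D.
Proof.
move=> mul vD'.
have y_mu : hw_vector E H mu%:Z y.
  split; first exact: y_hw.1.
  apply: weight_mod y_hw.2; apply/eqP; rewrite (intr_eq_mod charK) eqz_mod_dvd mul.
  have -> : - (lam + 2)%:Z - (p - lam - 2)%N%:Z = - (p%:Z) by lia.
  by rewrite dvdzE abszN.
have [g gv] := verma_linear charK hu vD'.2 vD'.1 y_mu.
exists g, phi; split=> //.
- apply: injective_linear => x; have [c ->] := vD'.2.1 x.
  by rewrite linear_comb gv => /y_free c0; rewrite big1 // => S _; rewrite c0 scaleA0.
move=> x; split=> [|[x' <-]]; last first.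
  have [c ->] := vD'.2.1 x'; rewrite linear_comb gv linear_comb phi_y /comb big1 // => S _.
  by rewrite !scaler0.
have [c [d ->]] := span_P x; rewrite linearD [phi (comb F y d)]linear_comb phi_y.
rewrite [X in _ + X]big1 ?addr0 => [|S _]; last by rewrite !scaler0.
move/phi_comb => c0; exists (comb F v' d); rewrite linear_comb gv.
by rewrite [X in X + _]big1 ?add0r // => S _; rewrite c0 scaleA0.
Qed.

End Generator.

Lemma projective_cover_top : lam = p.-1 :> nat -> isomorphic P D.
Proof.
have [w [ww [k k0 fw] Cw]] := good_generator; have [phi phiE] := projP f qL.1.
exact: cover_top ww k0 fw Cw phi phiE.
Qed.

Lemma projective_cover_exact (D' : lmodType u) (v' : D') (mu : 'I_p) :
  (lam <= p - 2)%N -> mu = (p - lam - 2)%N :> nat -> verma_mod E F H v' mu ->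
  short_exact D' P D.
Proof.
have [w [ww [k k0 fw] Cw]] := good_generator; have [phi phiE] := projP f qL.1.
by move=> ll mul; apply: (cover_exact ww k0 fw Cw phiE).
Qed.

End ProjectiveCover.

(** * Semisimplicity and the core *)

Section NotSemisimple.
Context (K : fieldType) (p : nat) (p_gt2 : (2 < p)%N) (charK : p \in [pchar K]).
Context (u : algType K) (E F H : u).
Hypothesis hu : restricted_enveloping_sl2 p E F H.
Context (lam : 'I_p) (D L : lmodType u) (v : D) (pi : {linear D -> L}).
Hypotheses (vD : verma_mod E F H v lam) (qL : verma_quotient F v lam pi).

Lemma quotient_lift x : pi x <> 0 -> exists a, a *: x = v.
Proof.
move=> px; have [c xc] := vD.2.1 x.
have [S [Sl cS]] : exists S : 'I_p, (S <= lam)%N /\ c S != 0.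
  apply/not_existsP => h; case: px; rewrite xc; apply/(qL.2 c) => S Sl.
  by apply/eqP; have /not_andP [//|/negP/negPn] := h S.
have [a av] := verma_generated charK hu p_gt2 vD.1 Sl cS.
by exists a; rewrite xc av.
Qed.

(** By [quotient_lift], some simple summand of u would map onto Delta(lam) under x |-> x v. But
    Delta(lam) is not simple: F^(lam+1) v is a nonzero element of the kernel of [pi]. *)
Lemma not_semisimple : (lam.+1 < p)%N -> ~ semisimple_ring u.
Proof.
move=> lp [n [N [simp dec]]]; have [y [[yN y1] _]] := dec 1.
have [i pyi] : exists i, pi ((y i : u) *: v) <> 0.
  apply/not_existsP => h; case: (quotient_neq0 charK qL).
  rewrite -[v]scale1r [1 in LHS]y1 scaler_suml linear_sum big1 // => i _.
  by apply: contrapT; apply: h.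
have [hN _ minN] := simp i; have [N0 NZ] := hN.
have NZ' a x : x \in N i -> a *: x \in N i by move=> xN; rewrite -[_ *: _]addr0; apply: NZ.
have [a av] := quotient_lift pyi.
pose N' := [pred x : u^o | (x \in N i) && (pi ((x : u) *: v) == 0)].
have hN' : submod_closed N'.
  split=> [|b x z]; rewrite !inE; first by rewrite N0 scale0r linear0 eqxx.
  move=> /andP [xN /eqP px] /andP [zN /eqP pz]; rewrite NZ //=.
  by rewrite [(_ + _) *: v]scalerDl -[(b *: x) *: v]scalerA linearD linearZZ px pz scaler0 addr0.
have [|N'0|NN'] := minN N' hN'; first by move=> x /andP [].
  pose b : u^o := (F ^+ lam.+1 * a) *: y i.
  have bv : (b : u) *: v = F ^+ lam.+1 *: v by rewrite -[LHS]scalerA -[LHS]scalerA av.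
  have b0 : b = 0.
    apply: N'0; rewrite inE NZ' //= bv linearZZ.
    by rewrite (quotient_Fn hu qL) // eqxx.
  have := vD.2.2 (fun S => if S == Ordinal lp then 1 else 0).
  rewrite -[X in X = 0 -> _]/(comb F v _) comb_single scaleA1 /= -bv b0 scale0r.
  by move=> /(_ erefl (Ordinal lp)); rewrite eqxx => /eqP; rewrite oner_eq0.
by have /andP [_ /eqP] := NN' _ (yN i).
Qed.

End NotSemisimple.

Lemma is_basis_reindex (K : fieldType) (V : lmodType K) (I J : eqType) (h : I -> J) (b : J -> V) :
  injective h -> surj h -> is_basis b -> is_basis (b \o h).
Proof.
move=> ih sh [sp fr]; split=> [x|s c us c0].
  have [n [c [g [gb ->]]]] := sp x; exists n, c, g; split=> // i.
  by have [j ->] := gb i; have [k <-] := sh j; exists k.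
have shb j : exists k, h k == j by have [k <-] := sh j; exists k.
move=> i si.
have [g gK] : exists g, cancel h g.
  have [g gP] := choice sh; exists g => k; apply: ih; exact: gP.
have := fr (map h s) (c \o g) _ _ (h i); rewrite /= gK; apply.
- by rewrite map_inj_uniq.
- by rewrite big_map -[RHS]c0; apply: eq_bigr => k _; rewrite /= gK.
- exact: map_f.
Qed.

(** * The core and its triangular basis *)

Section Core.
Context (K : fieldType) (p : nat) (p_gt2 : (2 < p)%N) (charK : p \in [pchar K]).
Context (u : algType K) (E F H : u).
Hypothesis hu : restricted_enveloping_sl2 p E F H.

Let rel : sl2_relations p E F H := hu.1.
Let Ep : E ^+ p = 0. Proof. by case: rel. Qed.
Let p_gt0 : (0 < p)%N := prime_gt0 (pcharf_prime charK).
Let o : 'I_p := Ordinal p_gt0.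

Notation one_ lam := (idem p H (lam : 'I_p)%:Z).

Definition core_vec (lam S : 'I_p) : u := F ^+ S * E ^+ S * one_ lam.

Lemma idem_orth (lam mu : 'I_p) : one_ lam * one_ mu = if mu == lam then one_ mu else 0.
Proof.
rewrite (idemM charK rel); case: (mu =P lam) => [->|ml]; first by rewrite eqxx.
case: eqP => // /(natr_inj_pchar charK (ltn_ord _) (ltn_ord _)) e.
by case: ml; apply: ord_inj.
Qed.

Lemma core_vec_cell lam S :
  core_vec lam S = cellC E F H (ord_of_int charK (lam%:Z + (2 * S)%:Z)) S S.
Proof.
rewrite /core_vec /cellC -!mulrA; congr (_ * _).
have := idem_En charK rel (lam%:Z + (2 * S)%:Z) S; rewrite addrK => <-.
by congr (_ * _); apply/esym/(idem_congr charK)/(ord_of_intE charK).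
Qed.

Lemma idem_core_vec lam S : one_ lam * core_vec lam S = core_vec lam S.
Proof.
rewrite /core_vec !mulrA (idem_Fn charK rel) -[F ^+ S * _ * _]mulrA (idem_En charK rel).
by rewrite addrK -!mulrA idem_orth eqxx.
Qed.

Let addr_modl_inj (a b c : nat) : (a < p)%N -> (b < p)%N ->
  (c%:Z + (2 * a)%:Z)%:~R = (c%:Z + (2 * b)%:Z)%:~R :> K -> a = b.
Proof.
move=> ap bp /eqP; rewrite (intr_eq_mod charK) eqz_mod_dvd.
move=> dv; have {}dv : (p%:Z %| 2 * (a%:Z - b%:Z))%Z by move: dv; congr (_ %| _)%Z; lia.
move: dv; rewrite dvdzE abszM Euclid_dvdM ?(pcharf_prime charK) // => /orP [] //=.
  by rewrite gtnNdvd.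
move=> dv; have [|d0] := posnP `|(a : int) - (b : int)|%N; first by lia.
by have := dvdn_leq d0 dv; lia.
Qed.

(** Between two copies of 1_lam only the terms F^A 1_nu E^(B+S) with A = B + S survive, by weights,
    and then A >= S. The case S = 0 spans the core; the general case is the triangularity that a
    cell structure requires. *)
Lemma core_triangular lam (S : nat) z : exists d : 'I_p -> K,
  one_ lam * (z * E ^+ S) * one_ lam = \sum_(R < p | (S <= R)%N) d R *: core_vec lam R.
Proof.
pose Q x := exists d : 'I_p -> K, x = \sum_(R < p | (S <= R)%N) d R *: core_vec lam R.
have Q0 : Q 0 by exists (fun=> 0); rewrite big1 // => R _; rewrite scale0r.
have QD x y : Q x -> Q y -> Q (x + y).
  move=> [d ->] [d' ->]; exists (fun R => d R + d' R); rewrite -big_split.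
  by apply: eq_bigr => R _; rewrite /= scalerDl.
have QZ k x : Q x -> Q (k *: x).
  move=> [d ->]; exists (fun R => k * d R); rewrite scaler_sumr.
  by apply: eq_bigr => R _; rewrite scalerA.
rewrite -/(Q _); have [c ->] := in_pbwT charK hu z; rewrite /pbw.
rewrite mulr_suml mulr_sumr mulr_suml; elim/big_ind: _ => [//|//|nu _].
rewrite mulr_suml mulr_sumr mulr_suml; elim/big_ind: _ => [//|//|A _].
rewrite mulr_suml mulr_sumr mulr_suml; elim/big_ind: _ => [//|//|B _].
rewrite -scalerAl -scalerAr -scalerAl; apply: QZ; rewrite /cellC.
have [pT|Tp] := leqP p (B + S).
  rewrite -[_ * E ^+ B * _]mulrA -exprD -(subnK pT) exprD Ep !mulr0 mul0r; exact: Q0.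
rewrite -[_ * E ^+ B * _]mulrA -exprD !mulrA (idem_Fn charK rel) -!mulrA.
have -> : E ^+ (B + S) * one_ lam = idem p H (lam%:Z + (2 * (B + S))%:Z) * E ^+ (B + S).
  by rewrite (idem_En charK rel) addrK.
rewrite [one_ nu * (_ * _)]mulrA (idemM charK rel); case: eqP => _; last by rewrite mul0r !mulr0.
rewrite [X in F ^+ A * X]mulrA (idemM charK rel); case: eqP => [e|_]; last by rewrite mul0r !mulr0.
have eA : A = (B + S)%N :> nat by apply: (addr_modl_inj (ltn_ord A) Tp (esym e)).
exists (fun R => if R == A then 1 else 0).
rewrite (bigD1 A) ?eA ?leq_addl //= eqxx scale1r big1 ?addr0 => [|R /andP [_ /negbTE ->]].
  by rewrite (idem_En charK rel) addrK /core_vec eA mulrA.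
by rewrite scale0r.
Qed.

Lemma core_spanned x : core p H x <-> exists d : 'I_p -> 'I_p -> K,
  x = \sum_lam \sum_S d lam S *: core_vec lam S.
Proof.
split=> [[y ->]|[d ->]].
  have [d dE] := choice (fun lam => core_triangular lam 0 (y lam)).
  exists d; apply: eq_bigr => lam _.
  by have := dE lam; rewrite expr0 mulr1 => ->.
exists (fun lam => \sum_S d lam S *: core_vec lam S); apply: eq_bigr => lam _.
rewrite mulr_sumr mulr_suml; apply: eq_bigr => S _.
by rewrite -scalerAr idem_core_vec -scalerAl /core_vec -!mulrA idem_orth eqxx.
Qed.

Definition core_pred : {pred u} :=
  [pred x | x == \sum_(lam < p) one_ lam * x * one_ lam].

Lemma corner_sum (y : 'I_p -> u) (lam : 'I_p) :
  one_ lam * (\sum_mu one_ mu * y mu * one_ mu) = one_ lam * y lam * one_ lam /\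
  (\sum_mu one_ mu * y mu * one_ mu) * one_ lam = one_ lam * y lam * one_ lam.
Proof.
rewrite mulr_sumr mulr_suml; split; rewrite (bigD1 lam) //= big1 ?addr0 => [|mu ml].
- by rewrite !mulrA idem_orth eqxx.
- by rewrite !mulrA idem_orth (negbTE ml) !mul0r.
- by rewrite -mulrA idem_orth eqxx.
- by rewrite -mulrA idem_orth eq_sym (negbTE ml) mulr0.
Qed.

Lemma core_predP x : reflect (core p H x) (x \in core_pred).
Proof.
apply: (iffP eqP) => [->|[y xE]]; first by exists (fun=> x).
rewrite {1}xE; apply: eq_bigr => lam _.
by rewrite xE (corner_sum y lam).1 -!mulrA idem_orth eqxx.
Qed.

Lemma core_comm x lam : core p H x -> one_ lam * x = x * one_ lam.
Proof. by move=> [y ->]; rewrite (corner_sum y lam).1 (corner_sum y lam).2. Qed.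

(** The core is the centralizer of the 1_lam, which makes it a subalgebra. *)
Lemma core_of_comm x : (forall lam, one_ lam * x = x * one_ lam) -> core p H x.
Proof.
move=> cx; exists (fun=> x); rewrite -[LHS]mulr1 -(sum_idem charK H) mulr_sumr.
by apply: eq_bigr => lam _; rewrite cx -mulrA idem_orth eqxx.
Qed.

Lemma core_subalg : subalg_closed core_pred.
Proof.
split=> [|k x y /core_predP cx /core_predP cy|x y /core_predP cx /core_predP cy];
  apply/core_predP/core_of_comm => lam.
- by rewrite mul1r mulr1.
- by rewrite mulrDl mulrDr -scalerAl -scalerAr (core_comm _ cx) (core_comm _ cy).
- by rewrite mulrA (core_comm _ cx) -mulrA (core_comm _ cy) mulrA.
Qed.

Lemma core_vec_in lam S : core_vec lam S \in core_pred.
Proof.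
apply/core_predP/core_spanned; exists (fun l T => if (l == lam) && (T == S) then 1 else 0).
rewrite (bigD1 lam) //= (bigD1 S) //= !eqxx scale1r !big1 ?addr0 // => [l /negbTE ll|T /negbTE ->].
  by rewrite big1 // => T _; rewrite ll scale0r.
by rewrite andbF scale0r.
Qed.

Lemma core_vec_free (d : 'I_p -> 'I_p -> K) :
  \sum_lam \sum_S d lam S *: core_vec lam S = 0 -> forall lam S, d lam S = 0.
Proof.
move=> d0 lam S.
have {}d0 : \sum_S d lam S *: core_vec lam S = 0.
  transitivity (one_ lam * (\sum_lam \sum_S d lam S *: core_vec lam S)); last by rewrite d0 mulr0.
  rewrite mulr_sumr [RHS](bigD1 lam) //= [X in _ + X]big1 ?addr0 => [|mu ml].
    by rewrite mulr_sumr; apply: eq_bigr => R _; rewrite -scalerAr idem_core_vec.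
  rewrite mulr_sumr big1 // => R _; rewrite -scalerAr -idem_core_vec mulrA idem_orth.
  by rewrite (negbTE ml) mul0r scaler0.
pose w (R : 'I_p) := ord_of_int charK (lam%:Z + (2 * R)%:Z).
pose c nu R T := if (nu == w R) && (R == T) then d lam R else 0.
have : pbw E F H c = 0.
  rewrite -[RHS]d0 /pbw exchange_big; apply: eq_bigr => R _ /=.
  rewrite (bigD1 (w R)) //= (bigD1 R) //= big1 ?addr0 => [|T /negbTE TR].
    rewrite big1 ?addr0 => [|nu /negbTE nw]; first by rewrite /c !eqxx core_vec_cell.
    by rewrite big1 // => T _; rewrite /c nw scale0r.
  by rewrite /c [R == T]eq_sym TR andbF scale0r.
by move/(pbw_coeff0 charK hu)/(_ (w S) S S); rewrite /c !eqxx.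
Qed.

End Core.

Lemma span_sum (K : fieldType) (V : lmodType K) (G : V -> Prop) (I : eqType) (s : seq I)
    (P : pred I) (c : I -> K) (g : I -> V) :
  (forall i, P i -> G (g i)) -> Defs.span G (\sum_(i <- s | P i) c i *: g i).
Proof.
move=> hG; rewrite -big_filter big_tnth.
eexists _, (fun i => c (tnth _ i)), (fun i => g (tnth _ i)); split=> // i.
by apply: hG; have := mem_tnth i (in_tuple (filter P s)); rewrite mem_filter => /andP [].
Qed.

Section CoreCellular.
Context (K : fieldType) (p : nat) (p_gt2 : (2 < p)%N) (charK : p \in [pchar K]).
Context (u : algType K) (E F H : u).
Hypothesis hu : restricted_enveloping_sl2 p E F H.
Context (star : u -> u) (hstar : anti_involution star).
Hypothesis star_cell : forall lam S T : 'I_p, star (cellC E F H lam S T) = cellC E F H lam T S.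

(* The core is commutative since the anti-involution fixes it pointwise; hence the identity is
   an anti-involution of the core. *)
Lemma star_core x : core p H x -> star x = x.
Proof.
have [starP _ _] := hstar.
have star0 : star 0 = 0.
  by have := starP (-1) 0 0; rewrite scaler0 addr0 scaleN1r addNr.
move=> /(core_spanned p_gt2 charK hu) [d ->].
elim/big_rec: _ => [|lam y _ IH]; first exact: star0.
elim/big_rec: _ => [|S z _ IHz]; first by rewrite add0r.
rewrite -addrA starP IHz; congr (_ *: _ + _).
by rewrite (core_vec_cell charK hu) star_cell.
Qed.

Lemma core_mulC x y : core p H x -> core p H y -> x * y = y * x.
Proof.
have core1 z : core p H z -> z \in core_pred p H by move/(core_predP charK hu).
move=> cx cy; have cxy : core p H (x * y).
  have [_ _ cM] := core_subalg charK hu.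
  exact/(core_predP charK hu)/cM/core1/cy/core1.
have [_ starM _] := hstar.
by rewrite -[LHS](star_core cxy) starM (star_core cx) (star_core cy).
Qed.

Let A := subalg (core_subalg charK hu).
(** All cells will have one element. Triangularity only compares labels with the same lam, and the
    lexicographic order contains these comparisons. *)
Let Y := ('I_p *l 'I_p)%type.

(* F^S E^S 1_lam is smaller for larger S, hence [rev_ord]. *)
Let vec (l : Y) : A := Subalg (core_subalg charK hu) (core_vec_in p_gt2 charK hu l.1 (rev_ord l.2)).

Let val_sum (I : Type) (s : seq I) (P : pred I) (c : I -> K) (g : I -> A) :
  \val (\sum_(i <- s | P i) c i *: g i) = \sum_(i <- s | P i) c i *: \val (g i).
Proof. by rewrite linear_sum; apply: eq_bigr => i _; rewrite linearZ. Qed.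

Let sum_core (d : 'I_p -> 'I_p -> K) : \sum_lam \sum_S d lam S *: core_vec E F H lam S =
  \sum_(l : 'I_p * 'I_p) d l.1 (rev_ord l.2) *: \val (vec l).
Proof.
rewrite pair_big /= (reindex (fun l : 'I_p * 'I_p => (l.1, rev_ord l.2))) //=.
by exists (fun l : 'I_p * 'I_p => (l.1, rev_ord l.2)) => l _ /=; rewrite rev_ordK; case: l.
Qed.

Let vec_basis : is_basis (vec : 'I_p * 'I_p -> A).
Proof.
apply: is_basisP => [x|c c0 l].
  have /(core_predP charK hu)/(core_spanned p_gt2 charK hu) [d dE] := subalg_valP x.
  exists (fun l => d l.1 (rev_ord l.2)); apply: val_inj.
  by rewrite val_sum -sum_core -dE.
have := core_vec_free charK hu (d := fun lam S => c (lam, rev_ord S)) _ l.1 (rev_ord l.2).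
rewrite rev_ordK; case: l => l1 l2 /=; apply.
rewrite sum_core; have := congr1 \val c0; rewrite val_sum => e; apply: etrans e.
by apply: eq_bigr => -[a b] _ /=; rewrite rev_ordK.
Qed.

Lemma core_cellular : exists (B : algType K) (f : {lrmorphism B -> u}),
  [/\ injective f, forall x, core p H x <-> exists a, f a = x & cellular B].
Proof.
exists A, (@subalg_incl _ _ _ (core_subalg charK hu)); split.
- exact: subalg_incl_inj.
- move=> x; split=> [/(core_predP charK hu) cx|[a <-]].
    by exists (Subalg (core_subalg charK hu) cx).
  exact/(core_predP charK hu)/(subalg_valP a).
exists _, Y, (fun=> unit : finType), (fun l _ _ => vec l), id; split.
- apply: (@is_basis_reindex _ _ _ ('I_p * 'I_p)%type (fun i => tag i : 'I_p * 'I_p)) vec_basis.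
    by move=> [a [[] []]] [b [[] []]] /= ->.
  by move=> l; exists (existT (fun=> (unit * unit)%type) (l : Y) (tt, tt)).
- split=> // x y; apply: val_inj; rewrite !rmorphM; apply: core_mulC;
    exact/(core_predP charK hu)/subalg_valP.
- by [].
move=> l; pose lam := l.1; pose S := rev_ord l.2.
have ex (a : A) : exists d : 'I_p -> K,
    \val a * core_vec E F H lam S = \sum_(R < p | (S <= R)%N) d R *: core_vec E F H lam R.
  have /(core_predP charK hu) ca := subalg_valP a.
  have [d dE] := core_triangular p_gt2 charK hu lam S (\val a * F ^+ S).
  exists d; rewrite -dE -mulrA -[X in _ * X = _](idem_core_vec charK hu) mulrA.
  by rewrite -(core_comm charK hu _ ca) /core_vec -!mulrA.
have [d dE] := choice ex; exists (fun a _ _ => d a S) => a [] [].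
pose x : A := \sum_(R < p | (S < R)%N) d a R *: vec (lam, rev_ord R).
exists x.
  apply: span_sum => R SR; exists (lam, rev_ord R), tt, tt; split=> //.
  have -> : l = (lam, rev_ord S) by rewrite /lam /S rev_ordK; case: (l).
  rewrite ltxi_pair !lexx /= ltEord /=; move: SR; rewrite /S /=.
  by have := ltn_ord R; have := ltn_ord l.2; lia.
rewrite (bigD1 tt) //= big1 ?addr0 => [|[]//]; apply: val_inj.
rewrite [LHS]rmorphM [RHS]rmorphD [X in _ = X + _]linearZ [LHS]dE (bigD1 S) //=; congr (_ + _).
rewrite [RHS]val_sum; apply: eq_big => [R|R _]; last by rewrite /= rev_ordK.
by rewrite ltn_neqAle andbC eq_sym.
Qed.

End CoreCellular.

(** * Non-cellularity *)

Lemma seq_maximal d (Y : porderType d) (s : seq Y) : s != [::] ->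
  exists2 l, l \in s & forall l', l' \in s -> ~~ (l < l')%O.
Proof.
elim: s => // a s IH _; have [->|s0] := eqVneq s [::].
  by exists a; rewrite ?mem_head // => l'; rewrite inE => /eqP ->; rewrite ltxx.
have [l ls lmax] := IH s0; have [la|nla] := boolP (l < a)%O.
  exists a; rewrite ?mem_head // => l'; rewrite inE => /predU1P [->|l's]; rewrite ?ltxx //.
  by apply: contra (lmax _ l's) => al'; apply: lt_trans al'.
exists l; first by rewrite inE ls orbT.
by move=> l'; rewrite inE => /predU1P [->//|/lmax].
Qed.

(** Full rank factorisations of A and B parametrise the image injectively by matrices of size rank A
    times rank B. *)
Lemma dim_sandwich (K : fieldType) m n (A : 'M[K]_m) (B : 'M[K]_n) (U : vectType K)
    (W : {vspace 'M[K]_(m, n)}) :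
  (forall Z, Z \in W <-> exists X, Z = A *m X *m B) -> \dim W = (\rank A * \rank B)%N.
Proof.
move=> WP.
have [g gE] : exists g : {linear 'M[K]_(\rank A, \rank B) -> 'M[K]_(m, n)},
    g =1 fun X => col_base A *m X *m row_base B.
  by apply: linear_of_fun => k X X'; rewrite mulmxDr mulmxDl -scalemxAr -scalemxAl.
have gW : (linfun g @: fullv)%VS = W.
  apply/vspaceP => Z; apply/idP/idP => [/memv_imgP [X _ ->]|/WP [X ->]].
    rewrite lfunE /= gE; apply/WP.
    have [P <-] : exists P, A *m P = col_base A.
      by exists (pinvmx (row_base A)); rewrite -[X in X *m _](mulmx_base A) mulmxKp ?row_base_free.
    have [Q <-] : exists Q, Q *m B = row_base B.
      exists (pinvmx (col_base B)).
      by rewrite -[X in _ *m X](mulmx_base B) mulmxA mulVpmx ?col_base_full ?mul1mx.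
    by exists (P *m X *m Q); rewrite !mulmxA.
  apply/memv_imgP; exists (row_base A *m X *m col_base B); rewrite ?memvf // lfunE /= gE.
  have assoc (a : 'M_(m, \rank A)) b c (e : 'M_(_, n)) : a *m (b *m X *m c) *m e = (a *m b) *m X *m (c *m e).
    by rewrite !mulmxA.
  by rewrite assoc !mulmx_base.
rewrite -gW limg_dim_eq ?dimvf ?dim_matrix //.
apply/eqP; rewrite -subv0; apply/subvP => X; rewrite memv_cap memv_ker memv0 => /andP [_].
rewrite lfunE /= gE => /eqP X0.
have AX0 : col_base A *m X = 0.
  by apply: (row_free_inj (row_base_free B)); rewrite X0 mul0mx.
by apply/eqP; apply: (row_full_inj (col_base_full A)); rewrite AX0 mulmx0.
Qed.

(** * The rank of an idempotent that is triangular along a filtration *)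

Section TriangularRank.
Context (K : fieldType) (V : vectType K) (d : Order.disp_t) (Y : porderType d).
Context (ls : seq Y) (m : Y -> nat) (pi : forall l, 'Hom(V, 'M[K]_(m l))).
Context (Theta : 'End(V)) (A B : forall l, 'M[K]_(m l)).
Hypothesis pi_inj : forall x, (forall l, l \in ls -> pi l x = 0) -> x = 0.
Hypothesis pi_surj : forall l (X : 'M_(m l)), l \in ls ->
  exists2 x, pi l x = X & forall l', l' \in ls -> l' != l -> pi l' x = 0.
Hypothesis Theta_tri : forall x l, l \in ls ->
  (forall l', l' \in ls -> (l < l')%O -> pi l' x = 0) ->
  pi l (Theta x) = A l *m pi l x *m B l.
Hypothesis Theta_idem : forall x, Theta (Theta x) = Theta x.
Hypothesis ls_uniq : uniq ls.

Let lower (D : seq Y) : {vspace V} := (\bigcap_(l <- ls | l \notin D) lker (pi l))%VS.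

Let lowerP D x : reflect (forall l, l \in ls -> l \notin D -> pi l x = 0) (x \in lower D).
Proof.
have -> : (x \in lower D) = all (fun l => (l \notin D) ==> (pi l x == 0)) ls.
  rewrite /lower; elim: (ls) => [|l s IH]; first by rewrite big_nil memvf.
  by rewrite big_cons /=; case: (l \notin D); rewrite ?memv_cap ?memv_ker IH.
by apply: (iffP allP) => [h l ls_l lD|h l ls_l]; [apply/eqP; have /implyP := h _ ls_l; apply|
  apply/implyP => lD; apply/eqP/h].
Qed.

(** Induction over down-closed sets D of labels: [lower D] consists of the vectors supported on D,
    and removing a maximal label l splits off the graded piece on which Theta acts as X |-> A l X B
    l. *)
Lemma triangular_rank : \dim (limg Theta) = (\sum_(l <- ls) \rank (A l) * \rank (B l))%N.
Proof.
suff dimD (n : nat) (D : seq Y) : size D = n -> uniq D -> {subset D <= ls} ->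
    (forall l mu, l \in D -> mu \in ls -> (mu < l)%O -> mu \in D) ->
    \dim (Theta @: lower D) = (\sum_(l <- D) \rank (A l) * \rank (B l))%N.
  rewrite -(dimD _ ls erefl) //; congr (\dim (_ @: _)); apply/esym/vspaceP => x.
  by rewrite memvf; apply/lowerP => l ->.
elim: n D => [|n IH] D.
  move/size0nil => -> _ _ _; rewrite big_nil.
  have -> : lower [::] = 0%VS; last by rewrite limg0 dimv0.
  apply/vspaceP => x; rewrite memv0; apply/lowerP/eqP => [h|-> l _ _]; last by rewrite linear0.
  by apply: pi_inj => l ls_l; apply: h.
move=> sD uD Dls Ddown; have [l lD lmax] : exists2 l, l \in D & forall l', l' \in D -> ~~ (l < l')%O.
  by apply: seq_maximal; rewrite -size_eq0 sD.
have ls_l := Dls _ lD.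
pose D' := rem l D.
have D'E l' : (l' \in D') = (l' != l) && (l' \in D) by rewrite mem_rem_uniq // inE.
rewrite (perm_big _ (perm_to_rem lD)) big_cons -(IH D'); first last.
- move=> a mu; rewrite !D'E => /andP [al aD] mls mua; rewrite (Ddown a mu) // andbT.
  by apply/eqP => ml; have := lmax a aD; rewrite -ml mua.
- by move=> a; rewrite D'E => /andP [_ /Dls].
- exact: rem_uniq.
- by rewrite size_rem // sD.
have stab x : x \in lower D -> Theta x \in lower D.
  move=> /lowerP xD; apply/lowerP => a als aD; rewrite Theta_tri // ?xD ?mulmx0 ?mul0mx // => b bls ab.
  by apply: xD => //; apply: contra aD => bD; apply: Ddown ab.
have D'D x : x \in lower D' -> x \in lower D.
  by move=> /lowerP xD; apply/lowerP => a als aD; apply: xD => //; rewrite D'E (negbTE aD) andbF.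
have D_pi x : x \in lower D -> pi l x = 0 -> x \in lower D'.
  move=> /lowerP xD x0; apply/lowerP => a als; rewrite D'E negb_and negbK => /orP [/eqP ->//|].
  exact: xD.
have piT x : x \in lower D -> pi l (Theta x) = A l *m pi l x *m B l.
  move=> /lowerP xD; apply: Theta_tri => // l' ls' ll'; apply: xD => //.
  by apply/negP => /lmax; rewrite ll'.
rewrite -(limg_ker_dim (pi l) (Theta @: lower D)) addnC; congr (_ + _)%N.
  apply: dim_sandwich => // Z; split=> [/memv_imgP [_ /memv_imgP [x xD ->] ->]|[X ->]].
    by exists (pi l x); apply: piT.
  have [x <- x0] := pi_surj X ls_l.
  have xD : x \in lower D.
    by apply/lowerP => a als aD; apply: x0 => //; apply: contra aD => /eqP ->.
  by rewrite -piT //; apply/memv_img/memv_img.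
(* Idempotence enters here: an element of the image is fixed by Theta, so the part of the image
   killed by [pi l] is the image of [lower D']. For a general triangular map it could be larger. *)
congr (\dim _); apply/vspaceP => x; rewrite memv_cap memv_ker.
apply/andP/idP => [[/memv_imgP [z zD xE] /eqP px]|/memv_imgP [z zD ->]].
  apply/memv_imgP; exists x; last by rewrite xE Theta_idem.
  by apply: D_pi => //; rewrite xE; apply: stab.
split; first by apply/memv_img/D'D.
rewrite piT ?D'D // (lowerP _ _ zD) ?mulmx0 ?mul0mx //.
by rewrite D'E eqxx.
Qed.

End TriangularRank.

Lemma basis_vector_iso (K : fieldType) (U : lmodType K) (J : finType) (b : J -> U) :
  is_basis b -> exists f : U -> 'rV[K]_#|J|, linear f /\ bijective f.
Proof.
move=> /is_basis_sum [sp fr]; have [co coE] := choice sp.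
pose f x : 'rV[K]_#|J| := \row_i co x (enum_val i).
pose g (r : 'rV[K]_#|J|) : U := \sum_j r 0 (enum_rank j) *: b j.
have fK : cancel f g.
  by move=> x; rewrite [RHS]coE; apply: eq_bigr => j _; rewrite mxE enum_rankK.
have g_lin k r s : g (k *: r + s) = k *: g r + g s.
  rewrite /g scaler_sumr -big_split; apply: eq_bigr => j _.
  by rewrite !mxE scalerDl scalerA.
have g_inj : injective g.
  move=> r s rs; have : g (-1 *: r + s) = 0 by rewrite g_lin rs scaleN1r addNr.
  move=> e0; apply/rowP => i; have := fr _ e0 (enum_val i); rewrite !mxE enum_valK mulN1r.
  by move/eqP; rewrite addrC subr_eq0 => /eqP.
have gK : cancel g f by move=> r; apply: g_inj; rewrite fK.
exists f; split; last by exists g.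
by move=> k x y; apply: g_inj; rewrite g_lin !fK.
Qed.

Section Dimensions.
Context (K : fieldType) (p : nat) (p_gt2 : (2 < p)%N) (charK : p \in [pchar K]).
Context (u : algType K) (E F H : u).
Hypothesis hu : restricted_enveloping_sl2 p E F H.

Let rel : sl2_relations p E F H := hu.1.
Let Ep : E ^+ p = 0. Proof. by case: rel. Qed.
Let p_gt0 : (0 < p)%N := prime_gt0 (pcharf_prime charK).

Lemma pbw_basis : is_basis (fun i : 'I_p * 'I_p * 'I_p => cellC E F H i.1.1 i.1.2 i.2).
Proof.
have e (c : 'I_p -> 'I_p -> 'I_p -> K) :
    \sum_(i : 'I_p * 'I_p * 'I_p) c i.1.1 i.1.2 i.2 *: cellC E F H i.1.1 i.1.2 i.2 = pbw E F H c.
  by rewrite /pbw pair_big pair_big.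
apply: is_basisP => [x|c c0 [[a b] d]].
  have [c ->] := in_pbwT charK hu x; exists (fun i => c i.1.1 i.1.2 i.2); exact/esym/e.
apply: (pbw_coeff0 charK hu (c := fun a b d => c (a, b, d))).
by rewrite -e -[RHS]c0; apply: eq_bigr => -[[]].
Qed.

Let iso := cid (basis_vector_iso pbw_basis).

Fact enveloping_vect_axiom : Vector.axiom #|{: 'I_p * 'I_p * 'I_p}| u.
Proof. by case: iso => f [lf bf]; exists f. Qed.

Definition enveloping_vect : vectType K :=
  HB.pack (GRing.Algebra.sort u) (Lmodule_hasFinDim.Build K u enveloping_vect_axiom).

Let V := enveloping_vect.

Let sandwich_linear (a b : u) : linear (fun x : V => (a * (x : u) * b) : V).
Proof. by move=> k x y; rewrite mulrDr mulrDl -scalerAr -scalerAl. Qed.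

Definition sandwich (a b : u) : 'End(V) :=
  linfun (HB.pack_for {linear V -> V} (fun x : V => (a * (x : u) * b) : V)
    (GRing.isLinear.Build _ _ _ _ _ (sandwich_linear a b))).

Lemma sandwichE a b (x : u) : sandwich a b x = a * x * b.
Proof. by rewrite lfunE. Qed.

Lemma weight_dim_eq (f' : u) : f' * f' = f' ->
  \dim (limg (sandwich (idem p H 0) f')) = \dim (limg (sandwich (idem p H 2) f')).
Proof.
(* On u f', as on u, left multiplication by E has kernel E^(p-1) u f' and that by E^(p-1) has
   kernel E u f'. *)
move=> ff; pose e0 := idem p H 0; pose e2 := idem p H 2.
have e00 : e0 * e0 = e0 by have := idemM charK rel 0 0; rewrite eqxx.
have e22 : e2 * e2 = e2 by have := idemM charK rel 2 2; rewrite eqxx.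
have e2E : e2 * E = E * e0.
  by have := idem_En charK rel 2 1; rewrite expr1 muln1 subrr.
(* E^(p-1) raises the weight 2 to 2 + 2(p-1) = 2p, which is 0: it leads back from weight 2 to weight
   0. *)
have e0E : e0 * E ^+ p.-1 = E ^+ p.-1 * e2.
  rewrite (idem_En charK rel); congr (_ * _); apply: (idem_congr charK); apply/eqP.
  rewrite (intr_eq_mod charK) eqz_mod_dvd sub0r.
  by rewrite (_ : _ - 2 = - (2 * p)%N%:Z) ?dvdzE ?abszN /= ?dvdn_mull //; lia.
have memP e (x : u) : e * e = e -> (x \in limg (sandwich e f')) = (e * x * f' == x).
  move=> ee; apply/memv_imgP/eqP => [[y _ ->]|<-]; last by exists x; rewrite ?memvf ?sandwichE.
  by rewrite !sandwichE !mulrA ee -mulrA ff.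
have EkE : E ^+ p.-1 * E = 0 by rewrite -exprSr prednK.
have EEk : E * E ^+ p.-1 = 0 by rewrite -exprS prednK.
(* Rank-nullity for E on weight 0 and for E^(p-1) on weight 2: the kernel of each map is the image
   of the other. *)
rewrite -[RHS](limg_ker_dim (sandwich (E ^+ p.-1) 1)).
rewrite -[LHS](limg_ker_dim (sandwich E 1)) addnC; congr (_ + _)%N; congr (\dim _).
  apply/vspaceP => x; rewrite memv_cap memv_ker sandwichE mulr1 memP //.
  apply/memv_imgP/andP => [[y]|[/eqP xe /eqP Ekx]].
    rewrite memP // sandwichE mulr1 => /eqP <- ->.
    by rewrite !mulrA EkE !mul0r e2E -[E * _ * e0]mulrA e00 -[_ * f' * f']mulrA ff.
  have [y xE] := E_exact p_gt2 charK hu (leq_pred p) Ekx.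
  have p1 : (p - p.-1 = 1)%N by lia.
  rewrite p1 expr1 in xE; exists (e0 * y * f').
    by rewrite memP // !mulrA e00 -[_ * f' * f']mulrA ff.
  by rewrite sandwichE mulr1 -xe {1}xE !mulrA e2E.
apply/vspaceP => x; rewrite memv_cap memv_ker sandwichE mulr1 memP //.
apply/andP/memv_imgP => [[/eqP xe /eqP Ex]|[y]].
  have := E_exact p_gt2 charK hu (k := 1) (ltnW (ltnW p_gt2)); rewrite expr1 subn1 => /(_ x Ex) [y xE].
  exists (e2 * y * f').
    by rewrite memP // !mulrA e22 -[_ * f' * f']mulrA ff.
  by rewrite sandwichE mulr1 -xe {1}xE !mulrA e0E.
rewrite memP // sandwichE mulr1 => /eqP <- ->.
by rewrite !mulrA EEk !mul0r e0E -[_ * e2 * e2]mulrA e22 -[_ * f' * f']mulrA ff.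
Qed.

End Dimensions.

Section MatrixModule.
Context (K : fieldType) (u : algType K) (n : nat) (R : u -> 'M[K]_n).
Hypothesis R1 : R 1 = 1%:M.
Hypothesis RP : forall k a b, R (k *: a + b) = k *: R a + R b.
Hypothesis RM : forall a b, R (a * b) = R a *m R b.

(** A copy of the columns that keeps only their addition, so that u can act on it in place of K. *)
Definition colmod : Type := 'cV[K]_n.
HB.instance Definition _ := GRing.Zmodule.on colmod.

Definition colmod_scale (a : u) (w : colmod) : colmod := R a *m w.

Let RD a b : R (a + b) = R a + R b.
Proof. by have := RP 1 a b; rewrite !scale1r. Qed.

Fact colmod_scaleA a b w : colmod_scale a (colmod_scale b w) = colmod_scale (a * b) w.
Proof. by rewrite /colmod_scale RM mulmxA. Qed.

Fact colmod_scale1 : left_id 1 colmod_scale.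
Proof. by move=> w; rewrite /colmod_scale R1 mul1mx. Qed.

Fact colmod_scaleDr : right_distributive colmod_scale +%R.
Proof. by move=> a w w'; rewrite /colmod_scale mulmxDr. Qed.

Fact colmod_scaleDl w : {morph colmod_scale^~ w : a b / a + b}.
Proof. by move=> a b; rewrite /colmod_scale RD mulmxDl. Qed.

Definition matrix_module : lmodType u :=
  HB.pack colmod (GRing.Zmodule_isLmodule.Build u colmod
    colmod_scaleA colmod_scale1 colmod_scaleDr colmod_scaleDl).

Lemma matrix_moduleE (a : u) (w : matrix_module) : a *: w = R a *m w :> 'cV_n.
Proof. by []. Qed.

(** X embeds the image of e' into the image of e. The embedded part dies under [theta], on which the
    image of e does not, so it is proper. Transposes occur because ranks are compared through row
    spaces while the module consists of columns. *)
Lemma matrix_rank_lt (L : lmodType u) (theta : {linear matrix_module -> L}) (e e' X : u) :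
  e' * e' = e' -> X * e' = e * (X * e') ->
  (forall w : matrix_module, e' *: w = w -> X *: w = 0 -> w = 0) ->
  (forall y : L, X *: (e' *: y) = 0) ->
  (exists w, e *: theta w <> 0) ->
  (\rank (R e') < \rank (R e))%N.
Proof.
move=> ee Xe inj Xe0 [w0 ew0]; pose T := (R (X * e'))^T.
have rT : \rank T = \rank (R e').
  rewrite /T RM trmx_mul -(mxrank_tr (R e')) -[RHS](mxrank_mul_ker _ (R X)^T).
  rewrite [X in (_ + X)%N](_ : _ = 0%N) ?addn0 //; apply/eqP; rewrite mxrank_eq0 -submx0.
  apply/rV_subP => v; rewrite sub_capmx => /andP [/submxP [v' vE] /sub_kermxP vX].
  have v0 : v^T = 0.
    apply: (inj (v^T : matrix_module)); rewrite matrix_moduleE.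
      by rewrite vE trmx_mul trmxK mulmxA -RM ee.
    by have := congr1 trmx vX; rewrite trmx_mul trmxK trmx0.
  by rewrite -[v]trmxK v0 trmx0 sub0mx.
rewrite -rT -(mxrank_tr (R e)); apply: rank_ltmx; rewrite /ltmx; apply/andP; split.
  by rewrite /T Xe RM trmx_mul submxMl.
apply/negP => sub; case: ew0.
have /submxP [v vE] : (w0^T *m (R e)^T <= T)%MS by apply: submx_trans sub; apply: submxMl.
have -> : e *: theta w0 = theta (X *: (e' *: (v^T : matrix_module))).
  rewrite -linearZZ; congr (theta _); rewrite scalerA !matrix_moduleE.
  by have := congr1 trmx vE; rewrite !trmx_mul !trmxK.
by rewrite !linearZZ Xe0.
Qed.

End MatrixModule.

Section Transfer.
Context (K : fieldType) (p : nat) (p_gt2 : (2 < p)%N) (charK : p \in [pchar K]).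

(** The submodule generated by w is a nonzero quotient of Delta(lam), so it still has L(lam) as a
    quotient, and what kills w kills l. On coefficients: those with S <= lam are zero because kappa
    is not, and the others act on l by 0. *)
Lemma hw_transfer (u : algType K) (E F H : u) (lam : 'I_p) (V L : lmodType u)
    (w : V) (l : L) (a : u) : restricted_enveloping_sl2 p E F H ->
  hw_vector E H lam%:Z w -> w <> 0 ->
  hw_vector E H lam%:Z l -> (forall n, (lam < n)%N -> F ^+ n *: l = 0) ->
  a *: w = 0 -> a *: l = 0.
Proof.
move=> hu hw w0 hl Fl; have [beta act] := hw_action charK hu a lam%:Z.
rewrite (act _ _ hw.1 hw.2) (act _ _ hl.1 hl.2) => e.
rewrite big1 // => S _; have [Sl|lS] := leqP S lam; last by rewrite Fl ?scaler0.
have := congr1 (fun x => (idem p H lam%:Z * E ^+ S) *: x) e; rewrite scaler0.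
rewrite scaler_sumr (bigD1 S) //= scaleAC (idem_En_Fn charK hu _ _ p_gt2 hw) eqxx.
rewrite big1 ?addr0 => [|T /negbTE TS]; last first.
  by rewrite scaleAC (idem_En_Fn charK hu _ _ p_gt2 hw) TS scaler0.
rewrite scaleAA => b0; have [->|bS] := eqVneq (beta S) 0; first exact: scaleA0.
case: w0; apply: scaleAI b0; rewrite mulf_neq0 //.
exact: (kappa_neq0 charK Sl (ltn_ord lam)).
Qed.

End Transfer.

(** The index type is not assumed finite. Independent lists are bounded by the dimension, and one of
    maximal length exhausts it. *)
Lemma basis_enum (K : fieldType) (V : vectType K) (I : eqType) (b : I -> V) :
  is_basis b -> exists s : seq I, uniq s /\ forall i, i \in s.
Proof.
move=> [_ fr].
have bound (s : seq I) : uniq s -> (size s <= \dim {:V})%N.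
  move=> us; have fs : free (in_tuple (map b s)).
    apply/freeP; rewrite /= size_map => k k0 i.
    have i0 : I by case: s us i k k0 => [|j s] // _ [].
    have := fr s (fun j => if insub (index j s) is Some i' then k i' else 0) us.
    have kE (j : 'I_(size s)) : (if insub (index (nth i0 s j) s) is Some i' then k i' else 0) = k j.
      by rewrite index_uniq // insubT //= => jl; congr k; apply: ord_inj.
    move=> /(_ _ (nth i0 s i) (mem_nth _ (ltn_ord i))); rewrite kE; apply.
    rewrite -[RHS]k0 (big_nth i0) big_mkord; apply: eq_bigr => j _.
    by rewrite kE (nth_map i0).
  by move: fs; rewrite /free /= size_map => /eqP <-; apply/dimvS/subvf.
have ex : exists n, `[< exists s : seq I, uniq s /\ size s = n >].
  by exists 0%N; apply/asboolP; exists [::].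
have ub n : `[< exists s : seq I, uniq s /\ size s = n >] -> (n <= \dim {:V})%N.
  by move=> /asboolP [s [us <-]]; apply: bound.
have [n /asboolP [s [us sn]] nmax] := ex_maxnP ex ub.
exists s; split=> // i; apply/negPn/negP => si.
suff /nmax : `[< exists t : seq I, uniq t /\ size t = n.+1 >] by rewrite ltnn.
apply/asboolP; exists (i :: s).
by rewrite /= si us sn.
Qed.

(** * Cell modules of an abstract cellular algebra *)

Section CellData.
Context (K : fieldType) (A : algType K) (d : Order.disp_t) (Y : porderType d) (M : Y -> finType).
Context (C : forall l, M l -> M l -> A) (star : A -> A).
Let I : eqType := {l : Y & (M l * M l)%type}.
Let Cc (i : I) : A := C (tagged i).1 (tagged i).2.
Hypotheses (hb : is_basis Cc) (hstar : anti_involution star).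
Hypothesis star_C : forall l S T, star (@C l S T) = C T S.
Context (r : forall l, A -> M l -> M l -> K).
Hypothesis hr : forall l a S T,
  exists2 x, Defs.span (fun y => exists mu S' T', (mu < l)%O /\ y = @C mu S' T') x
           & a * @C l S T = \sum_S' r a S' S *: C S' T + x.
Context (s : seq I) (s_uniq : uniq s) (s_all : forall i, i \in s).

Let co_ex (x : A) : exists c : I -> K, x = \sum_(i <- s) c i *: Cc i.
Proof.
have [n [c [g [gb ->]]]] := hb.1 x.
have [h hE] := choice gb.
exists (fun i => \sum_(k | h k == i) c k).
under [RHS]eq_bigr do rewrite scaler_suml big_mkcond.
rewrite exchange_big; apply: eq_bigr => k _ /=.
rewrite (bigD1_seq (h k)) //= eqxx big1 ?addr0 ?hE // => i ik.
by rewrite eq_sym (negbTE ik).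
Qed.

Definition co (x : A) : I -> K := projT1 (cid (co_ex x)).

Lemma coE x : x = \sum_(i <- s) co x i *: Cc i.
Proof. exact: projT2 (cid (co_ex x)). Qed.

Lemma co_uniq x c : x = \sum_(i <- s) c i *: Cc i -> forall i, co x i = c i.
Proof.
move=> xE i; apply/eqP; rewrite -subr_eq0; apply/eqP.
apply: (hb.2 s (fun i => co x i - c i)) => //.
by under eq_bigr do rewrite scalerBl; rewrite sumrB -coE -xE subrr.
Qed.

Lemma coP k x y i : co (k *: x + y) i = k * co x i + co y i.
Proof.
apply: (co_uniq (c := fun i => k * co x i + co y i)); rewrite {1}(coE x) {1}(coE y).
by rewrite scaler_sumr -big_split; apply: eq_bigr => j _; rewrite scalerDl scalerA.
Qed.

Lemma co0 i : co 0 i = 0.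
Proof. by apply: (co_uniq (c := fun=> 0)); rewrite big1 // => j _; rewrite scale0r. Qed.

Lemma coD x y i : co (x + y) i = co x i + co y i.
Proof. by have := coP 1 x y i; rewrite scale1r mul1r. Qed.

Lemma coZ k x i : co (k *: x) i = k * co x i.
Proof. by rewrite -[k *: x]addr0 coP co0 addr0. Qed.

Lemma co_sum (J : Type) (t : seq J) (P : pred J) (f : J -> A) i :
  co (\sum_(j <- t | P j) f j) i = \sum_(j <- t | P j) co (f j) i.
Proof. by apply: (big_morph (co^~ i)) => [x y|]; [apply: coD|apply: co0]. Qed.

Lemma co_Cc j i : co (Cc j) i = (i == j)%:R.
Proof.
apply: (co_uniq (c := fun i => (i == j)%:R)); rewrite (bigD1_seq j) //= eqxx scale1r.
by rewrite big1 ?addr0 // => i' /negbTE ->; rewrite scale0r.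
Qed.

Definition ix l (S T : M l) : I := existT _ l (S, T).

Lemma co_C l S T i : co (@C l S T) i = (i == ix S T)%:R.
Proof. exact: (co_Cc (ix S T)). Qed.

(* Membership in A(< l), read off the coordinates. *)
Definition below (l : Y) (x : A) : Prop := forall i, ~~ (tag i < l)%O -> co x i = 0.

Lemma span_below l x :
  Defs.span (fun y => exists mu S' T', (mu < l)%O /\ y = @C mu S' T') x -> below l x.
Proof.
move=> [n [c [g [gb ->]]]] i il; rewrite co_sum big1 // => k _; rewrite coZ.
have [mu [S [T [mul ->]]]] := gb k; rewrite co_C; case: eqP => [ii|]; last by rewrite mulr0.
by rewrite ii /= mul in il.
Qed.

Lemma co_star x i : co (star x) i = co x (ix (tagged i).2 (tagged i).1).
Proof.
have [starP starM starK] := hstar.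
have star0 : star 0 = 0.
  by have := starP (-1) 0 0; rewrite scaler0 addr0 scaleN1r addNr.
rewrite {1}(coE x).
have -> : star (\sum_(j <- s) co x j *: Cc j) = \sum_(j <- s) co x j *: Cc (ix (tagged j).2 (tagged j).1).
  elim: s => [|j t IH]; first by rewrite !big_nil.
  by rewrite !big_cons starP IH star_C.
rewrite co_sum (bigD1_seq (ix (tagged i).2 (tagged i).1)) //= coZ co_Cc.
have -> : ix (tagged i).1 (tagged i).2 = i by case: (i) => l [].
rewrite eqxx mulr1 big1 ?addr0 // => j ji; rewrite coZ co_Cc.
case: eqP => [ij|]; last by rewrite mulr0.
by case/eqP: ji; rewrite ij; case: (j) => l [].
Qed.

Lemma below_star l x : below l x -> below l (star x).
Proof. by move=> bx i il; rewrite co_star bx. Qed.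

Lemma co_mul l a S T S' T' :
  co (a * @C l S T) (ix S' T') = if T' == T then r a S' S else 0.
Proof.
have [x /span_below bx ->] := hr a S T; rewrite coD bx ?ltxx // addr0 co_sum.
rewrite (bigD1 S') //= coZ co_C big1 ?addr0 => [|R RS].
  by rewrite eq_Tagged /= xpair_eqE eqxx /=; case: eqP => _; rewrite ?mulr1 ?mulr0.
by rewrite coZ co_C eq_Tagged /= xpair_eqE eq_sym (negbTE RS) mulr0.
Qed.

Lemma co_mul_le l a S T i : co (a * @C l S T) i != 0 -> (tag i <= l)%O.
Proof.
have [x /span_below bx ->] := hr a S T; rewrite coD co_sum.
have [//|il] := boolP (tag i <= l)%O; rewrite bx; last first.
  by apply: contra il; apply: ltW.
rewrite big1 ?addr0 ?eqxx // => R _; rewrite coZ co_C; case: eqP => [ii|]; last by rewrite mulr0.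
by rewrite ii /= lexx in il.
Qed.

Lemma co_mulr l a S T S' T' :
  co (@C l S T * a) (ix S' T') = if S' == S then r (star a) T' T else 0.
Proof.
have [starP starM starK] := hstar.
by rewrite -[_ * a]starK co_star starM star_C /= co_mul.
Qed.

Lemma co_mulr_le l a S T i : co (@C l S T * a) i != 0 -> (tag i <= l)%O.
Proof.
have [starP starM starK] := hstar.
by rewrite -[_ * a]starK co_star starM star_C => /co_mul_le.
Qed.

Lemma belowM l a x : below l x -> below l (a * x).
Proof.
move=> bx i il; rewrite (coE x) mulr_sumr co_sum big1 // => j _; rewrite -scalerAr coZ.
apply/eqP; rewrite mulf_eq0 -implyNb; apply/implyP => xj; apply/negPn/negP => /co_mul_le ij.
have jl : (tag j < l)%O by apply/negPn/negP => /bx e; rewrite e eqxx in xj.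
by case/negP: il; apply: le_lt_trans jl.
Qed.

Lemma belowMr l a x : below l x -> below l (x * a).
Proof.
have [starP starM starK] := hstar.
by move=> bx; rewrite -[x * a]starK starM; apply/below_star/belowM/below_star.
Qed.

Lemma r_mul l a b (S' S : M l) : r (a * b) S' S = \sum_T r a S' T * r b T S.
Proof.
have := co_mul (a * b) S S S' S; rewrite eqxx => <-; rewrite -mulrA.
have [x /span_below bx ->] := hr b S S; rewrite mulrDr coD (belowM _ bx) ?ltxx // addr0.
rewrite mulr_sumr co_sum; apply: eq_bigr => T _.
by rewrite -scalerAr coZ co_mul eqxx mulrC.
Qed.

Lemma r_one l (S' S : M l) : r 1 S' S = (S' == S)%:R.
Proof.
have := co_mul 1 S S S' S; rewrite eqxx => <-; rewrite mul1r co_C eq_Tagged /= xpair_eqE eqxx.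
by rewrite andbT.
Qed.

Lemma r_lin l k a b (S' S : M l) : r (k *: a + b) S' S = k * r a S' S + r b S' S.
Proof.
have := co_mul (k *: a + b) S S S' S; rewrite eqxx => <-.
by rewrite mulrDl -scalerAl coP !co_mul eqxx.
Qed.

(** Right multiplication of a cell element of label mu stays within labels at most mu, so the
    product with [C S S] has no component of label l. *)
Lemma r_cell_eq0 l mu U V (S' S : M l) : ~~ (l <= mu)%O -> r (@C mu U V) S' S = 0.
Proof.
move=> lmu; have := co_mul (@C mu U V) S S S' S; rewrite eqxx => <-.
by apply/eqP/negPn/negP => /co_mulr_le; rewrite (negbTE lmu).
Qed.

(** [C U T] acts on the cell module with rank at most one; the scalar, independent of U, is the
    value of the Graham-Lehrer form at S and T. *)
Lemma r_cell l (U T S' S : M l) :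
  r (C U T) S' S = if S' == U then r (C S S) S T else 0.
Proof.
have := co_mul (C U T) S S S' S; rewrite eqxx => <-.
by rewrite co_mulr star_C.
Qed.

Definition cell_mx l (a : A) : 'M[K]_#|M l| := \matrix_(i, j) r a (enum_val i) (enum_val j).

Lemma cell_mx1 l : cell_mx l 1 = 1%:M.
Proof. by apply/matrixP => i j; rewrite !mxE r_one (inj_eq enum_val_inj). Qed.

Lemma cell_mxP l k a b : cell_mx l (k *: a + b) = k *: cell_mx l a + cell_mx l b.
Proof. by apply/matrixP => i j; rewrite !mxE r_lin. Qed.

Lemma cell_mxM l a b : cell_mx l (a * b) = cell_mx l a *m cell_mx l b.
Proof.
apply/matrixP => i j; rewrite !mxE r_mul (reindex _ (onW_bij _ (@enum_val_bij (M l)))).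
by apply: eq_bigr => k _; rewrite !mxE.
Qed.

Definition cell_rep l : lmodType A := matrix_module (cell_mx1 l) (cell_mxP l) (cell_mxM l).

(** For simple L, a minimal label that is not dead is the label of the cell module with head L. *)
Definition dead (L : lmodType A) (l : Y) : Prop := forall S T (y : L), @C l S T *: y = 0.

Lemma below_dead (L : lmodType A) l x (y : L) :
  (forall mu, (mu < l)%O -> dead L mu) -> below l x -> x *: y = 0.
Proof.
move=> dl bx; rewrite (coE x) scaler_suml big1 // => i _.
have [il|il] := boolP (tag i < l)%O; last by rewrite bx // scale0r scale0r.
by rewrite scaleAe dl // scaler0.
Qed.

Lemma minimal_label (L : lmodType A) : (exists y : L, y <> 0) ->
  exists l, ~ dead L l /\ forall mu, (mu < l)%O -> dead L mu.
Proof.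
(* The order is reversed so that [seq_maximal] produces a minimal label. *)
move=> [y y0]; pose t : seq Y^d := [seq l <- map tag s | ~~ `[< dead L l >]].
have tP l : ~ dead L l -> l \in t.
  move=> nd; rewrite mem_filter; apply/andP; split; first by apply/asboolPn.
  have [S [T _]] : exists S T, exists z : L, @C l S T *: z <> 0.
    apply: contrapT => h; apply: nd => S T z; apply: contrapT => ne; apply: h.
    by exists S, T, z.
  by apply/mapP; exists (ix S T).
have t0 : t != [::].
  apply/eqP => t0; case: y0; rewrite -[y]scale1r (coE 1) scaler_suml big1 // => i _.
  have [dl|/tP] := EM (dead L (tag i)); last by rewrite t0.
  by rewrite scaleAe dl scaler0.
have [l lt lmin] := seq_maximal t0; exists l; split.
  by move: lt; rewrite mem_filter => /andP [/asboolP].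
move=> mu mul; apply: contrapT => /tP /lmin /negP; apply; exact: mul.
Qed.

(** Sending the basis vector S of the cell module to [C S T *: y] respects the action because the
    lower terms of the cell condition kill y. *)
Lemma cell_hom (L : lmodType A) l (T : M l) (y : L) :
  (forall mu, (mu < l)%O -> dead L mu) ->
  exists theta : {linear cell_rep l -> L},
    forall w : cell_rep l, theta w = \sum_j ((w : 'cV_#|M l|) j 0)%:A *: (C (enum_val j) T *: y).
Proof.
move=> dl; apply: linear_of_fun => a w w'.
rewrite scaler_sumr -big_split /=.
have mulC (j : 'I_#|M l|) : a *: (C (enum_val j) T *: y) =
    \sum_(i < #|M l|) (r a (enum_val i) (enum_val j))%:A *: (C (enum_val i) T *: y).
  have [x /span_below bx e] := hr a (enum_val j) T.
  rewrite scalerA e [LHS]scalerDl (below_dead _ dl bx) addr0 scaler_suml.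
  rewrite (reindex (fun k : 'I_#|M l| => enum_val k)); last exact/onW_bij/enum_val_bij.
  by apply: eq_bigr => i _; rewrite [LHS]scaleAe.
rewrite [RHS]big_split /=; under [X in _ = X + _]eq_bigr do rewrite scaleAC mulC scaler_sumr.
rewrite exchange_big -big_split /=; apply: eq_bigr => i _.
rewrite mxE scaleADl; congr (_ + _); rewrite matrix_moduleE mxE.
rewrite !scaler_suml; apply: eq_bigr => k _.
by rewrite mxE scaleAA mulrC.
Qed.

Let co_sandwich_le a b l S T i : co (a * @C l S T * b) i != 0 -> (tag i <= l)%O.
Proof.
apply: contraNT => il; rewrite (coE (a * _)) mulr_suml co_sum big1 // => j _.
rewrite -scalerAl coZ; apply/eqP; rewrite mulf_eq0 -implyNb; apply/implyP => /co_mul_le jl.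
apply: contraNT il => /co_mulr_le ij; exact: le_trans jl.
Qed.

(** The layer of label l is the tensor square of the cell module: a acts on one factor and, through
    [star], b acts on the other. *)
Let co_sandwich a b l S T S' T' :
  co (a * @C l S T * star b) (ix S' T') = r a S' S * r b T' T.
Proof.
have [x /span_below bx ->] := hr a S T; have [starP starM starK] := hstar.
rewrite mulrDl coD (belowMr _ bx) ?ltxx // addr0 mulr_suml co_sum (bigD1 S') //=.
rewrite -scalerAl coZ co_mulr eqxx starK big1 ?addr0 // => R RS.
by rewrite -scalerAl coZ co_mulr eq_sym (negbTE RS) mulr0.
Qed.

Let sum_fiber l (F : I -> K) :
  \sum_(j <- s | tag j == l) F j = \sum_(q : M l * M l) F (ix q.1 q.2).
Proof.
rewrite -big_filter -[RHS](big_map (fun q : M l * M l => ix q.1 q.2) xpredT F).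
apply: perm_big; apply: uniq_perm; first exact: filter_uniq.
  rewrite map_inj_uniq ?index_enum_uniq // => -[a b] [a' b'] /eqP.
  by rewrite eq_Tagged /= => /eqP.
move=> [l' [S T]]; rewrite mem_filter s_all andbT /=; apply/eqP/mapP => [ll|[q _ e]].
  by rewrite ll in S T *; exists (S, T); rewrite ?mem_index_enum.
exact: (congr1 tag e).
Qed.

Lemma cell_rank_sum (V : vectType K) (g : {linear V -> A}) (Theta : 'End(V)) e f :
  bijective g -> (forall x, g (Theta x) = e * g x * star f) -> e * e = e -> f * f = f ->
  \dim (limg Theta) =
    (\sum_(l <- undup (map tag s)) \rank (cell_mx l e) * \rank (cell_mx l f))%N.
Proof.
move=> [g' gK g'K] gT ee ff; set ls := undup _.
have inls (i : I) : tag i \in ls by rewrite mem_undup (map_f tag (s_all i)).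
have pi_ex l : exists q : 'Hom(V, 'M[K]_#|M l|),
    forall x i j, q x i j = co (g x) (ix (enum_val i) (enum_val j)).
  pose h (x : V) : 'M[K]_#|M l| := \matrix_(i, j) co (g x) (ix (enum_val i) (enum_val j)).
  have [h' hE] : exists h' : {linear V -> 'M[K]_#|M l|}, h' =1 h.
    by apply: linear_of_fun => k x y; apply/matrixP => i j; rewrite !mxE linearP coP.
  by exists (linfun h') => x i j; rewrite lfunE /= hE mxE.
pose q l := projT1 (cid (pi_ex l)).
have qE l x i j : q l x i j = co (g x) (ix (enum_val i) (enum_val j)).
  exact: (projT2 (cid (pi_ex l))).
have qE' l x S T : co (g x) (@ix l S T) = q l x (enum_rank S) (enum_rank T).
  by rewrite qE !enum_rankK.
have [starP starM starK] := hstar.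
rewrite (@triangular_rank _ V _ Y ls (fun l => #|M l|) q Theta (fun l => cell_mx l e)
  (fun l => (cell_mx l f)^T)).
- by apply: eq_bigr => l _; rewrite mxrank_tr.
- move=> x x0; rewrite -[x]gK (_ : g x = 0) ?(can2_linear) //; last first.
    rewrite (coE (g x)) big1 // => -[l [S T]] _.
    by rewrite [co _ _](qE' l x S T) x0 ?inls ?mxE ?scale0r // (inls (ix S T)).
  by rewrite -[0 in LHS](linear0 g) gK.
- move=> l X lls; exists (g' (\sum_i \sum_j X i j *: C (enum_val i) (enum_val j))).
    apply/matrixP => i j; rewrite qE g'K co_sum (bigD1 i) //= co_sum (bigD1 j) //=.
    rewrite coZ co_C eqxx mulr1 !big1 ?addr0 // => [i' ii'|j' jj'].
      rewrite co_sum big1 // => j' _; rewrite coZ co_C eq_Tagged /= xpair_eqE.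
      by rewrite (inj_eq enum_val_inj) eq_sym (negbTE ii') mulr0.
    rewrite coZ co_C eq_Tagged /= xpair_eqE andbC (inj_eq enum_val_inj) eq_sym.
    by rewrite (negbTE jj') mulr0.
  move=> l' _ l'l; apply/matrixP => i j; rewrite qE g'K mxE co_sum big1 // => i' _.
  rewrite co_sum big1 // => j' _; rewrite coZ co_C; case: eqP => [e1|]; last by rewrite mulr0.
  by have := congr1 tag e1 => /= ll; rewrite ll eqxx in l'l.
- move=> x l lls hx; apply/matrixP => i j; rewrite qE gT (coE (g x)) mulr_sumr mulr_suml co_sum.
  (* A term whose label is not above l contributes nothing in degree l, and those strictly above l
     have coefficient 0 by hypothesis. *)
  rewrite (bigID (fun k => tag k == l)) /= [X in _ + X]big1 ?addr0 => [|[l' [S T]] /= l'l]; last first.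
    rewrite -scalerAr -scalerAl coZ; apply/eqP; rewrite mulf_eq0 -implyNb; apply/implyP.
    apply: contraNT => /co_sandwich_le /= ll'; rewrite [co _ _](qE' l' x S T) hx ?mxE //.
      exact: (inls (ix S T)).
    by rewrite lt_neqAle ll' eq_sym l'l.
  rewrite (sum_fiber l (fun k => co (e * (co (g x) k *: Cc k) * star f) _)).
  under eq_bigr => k _ do rewrite -scalerAr -scalerAl coZ co_sandwich.
  rewrite -(pair_bigA _ (fun S T : M l => co (g x) (ix S T) *
    (r e (enum_val i) S * r f (enum_val j) T))) /= exchange_big mxE.
  rewrite (reindex (fun k : 'I_#|M l| => enum_val k)); last exact/onW_bij/enum_val_bij.
  apply: eq_bigr => k _; rewrite !mxE mulr_suml.
  rewrite (reindex (fun k : 'I_#|M l| => enum_val k)); last exact/onW_bij/enum_val_bij.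
  by apply: eq_bigr => h _; rewrite !mxE qE mulrA [in LHS](mulrC (co _ _)).
- by move=> x; apply: (can_inj gK); rewrite !gT !mulrA ee -mulrA -starM ff.
- exact: undup_uniq.
Qed.

End CellData.

(** The two equations add up to the vanishing of the sum of the (a - b)^2, expressed in nat as
    equality in 2ab <= a^2 + b^2. *)
Lemma eq_of_sum_mul (I : eqType) (s : seq I) (a b : I -> nat) :
  (\sum_(i <- s) a i * a i = \sum_(i <- s) b i * a i)%N ->
  (\sum_(i <- s) a i * b i = \sum_(i <- s) b i * b i)%N ->
  forall i, i \in s -> a i = b i.
Proof.
move=> e1 e2.
have e : (\sum_(i <- s) 2 * (a i * b i) = \sum_(i <- s) (a i ^ 2 + b i ^ 2))%N.
  have -> : (\sum_(i <- s) 2 * (a i * b i) = 2 * \sum_(i <- s) a i * b i)%N by rewrite big_distrr.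
  rewrite big_split /= mul2n -addnn; congr (_ + _)%N.
    by under [RHS]eq_bigr do rewrite -mulnn; rewrite e1; apply: eq_bigr => i _; apply: mulnC.
  by under [RHS]eq_bigr do rewrite -mulnn; rewrite e2.
elim: s e {e1 e2} => // i s IH; rewrite !big_cons => e j.
have le1 := (nat_Cauchy (a i) (b i)).1.
have le2 : (\sum_(k <- s) 2 * (a k * b k) <= \sum_(k <- s) (a k ^ 2 + b k ^ 2))%N.
  by apply: leq_sum => k _; have [] := nat_Cauchy (a k) (b k).
rewrite inE => /predU1P [->|]; last by apply: IH; lia.
by apply/eqP; rewrite -(nat_Cauchy (a i) (b i)).2; apply/eqP; lia.
Qed.

(** * L(0) and L(p-2) in a putative cell structure *)

Section NotCellular.
Context (K : fieldType) (p : nat) (p_gt2 : (2 < p)%N) (charK : p \in [pchar K]).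
Context (u : algType K) (E F H : u).
Hypothesis hu : restricted_enveloping_sl2 p E F H.

Let rel : sl2_relations p E F H := hu.1.
Let p_gt0 : (0 < p)%N := prime_gt0 (pcharf_prime charK).
Let o : 'I_p := Ordinal p_gt0.
Let hu' : restricted_enveloping_sl2 p F E (- H) := enveloping_swap hu (odd_char p_gt2 charK).

Context (D0 L0 D1 L1 : lmodType u) (v0 : D0) (v1 : D1).
Context (pi0 : {linear D0 -> L0}) (pi1 : {linear D1 -> L1}) (mu : 'I_p) (mu_eq : mu = (p - 2)%N :> nat).
Hypotheses (vD0 : verma_mod E F H v0 o) (qL0 : verma_quotient F v0 o pi0).
Hypotheses (vD1 : verma_mod E F H v1 mu) (qL1 : verma_quotient F v1 mu pi1).

Let e0 := idem p H 0.
Let e2 := idem p H 2.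
Let x0 : L0 := pi0 v0.
(** The lowest weight vector of L(p-2). Its weight -(p-2) is 2 modulo p, and for the triple (F, E,
    -H) it is a highest weight vector of weight p - 2. *)
Let x1 : L1 := F ^+ (p - 2) *: pi1 v1.

Let e00 : e0 * e0 = e0. Proof. by have := idemM charK rel 0 0; rewrite eqxx. Qed.
Let e22 : e2 * e2 = e2. Proof. by have := idemM charK rel 2 2; rewrite eqxx. Qed.
Let e2E : e2 * E = E * e0.
Proof. by have := idem_En charK rel 2 1; rewrite expr1 muln1 subrr. Qed.
Let e0F : e0 * F = F * e2.
Proof. by have := idem_Fn charK rel 0 1; rewrite expr1 muln1 add0r. Qed.

Let line0 (y : L0) : exists k : K, y = k%:A *: x0.
Proof.
have [x <-] := qL0.1 y; have [c ->] := vD0.2.1 x; exists (c o).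
rewrite linear_comb /comb (bigD1 o) //= scale1r big1 ?addr0 // => S So.
by rewrite (quotient_Fn hu qL0) ?scaler0 // lt0n.
Qed.

Let hw0 : hw_vector E H o%:Z x0 := quotient_hw pi0 vD0.
Let hw1 : hw_vector E H mu%:Z (pi1 v1) := quotient_hw pi1 vD1.

Let e0L0 (y : L0) : e0 *: y = y.
Proof.
by have [k ->] := line0 y; rewrite scaleAC (idem_weight charK (hw0.2 : weight H 0 x0)).
Qed.

Let FL0 (y : L0) : F *: y = 0.
Proof.
have [k ->] := line0 y; have := quotient_Fn hu qL0 (n := 1) isT; rewrite expr1 => F0.
by rewrite scaleAC F0 scaler0.
Qed.

Let e0L1 (y : L1) : e0 *: y = 0.
Proof.
have [x <-] := qL1.1 y; have [c ->] := vD1.2.1 x; rewrite linear_comb scaler_sumr big1 // => S _.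
rewrite scaleAC; have [Sm|mS] := leqP S mu; last by rewrite (quotient_Fn hu qL1 mS) !scaler0.
rewrite (idem_weightE charK _ (weightFn charK rel S hw1.2)) ifN ?scaler0 //.
rewrite (intr_eq_mod charK) eqz_mod_dvd subr0 mu_eq.
apply/negP => dv; have {}dv : (p%:Z %| 2 * (S.+1)%:Z)%Z.
  have -> : (2 * (S.+1)%:Z = p%:Z - ((p - 2)%N%:Z - (2 * S)%N%:Z))%Z by lia.
  by apply: rpredB => //; apply: dvdzz.
move: dv; rewrite dvdzE abszM Euclid_dvdM ?(pcharf_prime charK) // => /orP [] /=.
  by rewrite gtnNdvd.
by rewrite gtnNdvd //; lia.
Qed.

Let x1_low : hw_vector F (- H) mu%:Z x1.
Proof.
split; first by rewrite scalerA -exprS (quotient_Fn hu qL1) // mu_eq.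
have w : weight H (- mu%:Z) x1.
  by have := weightFn charK rel (p - 2) hw1.2; congr (weight H _ _); rewrite mu_eq; lia.
by rewrite /weight scaleNr w -scaleAN rmorphN opprK.
Qed.

Let E_x1 : exists2 k : K, k != 0 & E ^+ (p - 2) *: x1 = k%:A *: pi1 v1.
Proof.
exists (kappa K mu%:Z (p - 2)); last exact: (En_Fn_hw hu _ hw1).
by apply: (kappa_neq0 charK) (ltn_ord mu); rewrite mu_eq.
Qed.

Let x1_top n : (mu < n)%N -> E ^+ n *: x1 = 0.
Proof.
move=> mn; have -> : n = ((n - (p - 1)).+1 + (p - 2))%N by lia.
have [k _ Ex] := E_x1.
by rewrite exprD -scalerA Ex scaleAC exprSr -scalerA hw1.1 !scaler0.
Qed.

Let x1_gen (y : L1) : exists b, y = b *: x1.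
Proof.
have [b ->] := quotient_generated vD1 qL1 y; have [k k0 Ex] := E_x1.
exists (b * (k^-1 *: E ^+ (p - 2))).
by rewrite -[RHS]scalerA scaleAe Ex scaleAA mulVf // scaleA1.
Qed.

Let x1_neq0 : x1 <> 0.
Proof.
move=> x10; have [k k0] := E_x1; rewrite x10 scaler0 => /esym /(scaleAI k0).
exact: (quotient_neq0 charK qL1).
Qed.

Let e2x1 : e2 *: x1 = x1.
Proof.
apply: (idem_weight charK); apply: weight_mod (weightFn charK rel (p - 2) hw1.2).
apply/eqP; rewrite (intr_eq_mod charK) eqz_mod_dvd mu_eq.
by rewrite (_ : _ - 2 = - p%:Z) ?dvdzE ?abszN //; lia.
Qed.

Lemma not_cellular : ~ cellular u.
Proof.
move=> [d [Y [M [C [star [hb hstar hC hr0]]]]]].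
pose r l := projT1 (cid (hr0 l)).
have hr l a S T : exists2 x,
    Defs.span (fun y => exists mu S' T', (mu < l)%O /\ y = C mu S' T') x
    & a * C l S T = \sum_S' r l a S' S *: C l S' T + x := projT2 (cid (hr0 l)) a S T.
have [s [us sall]] := @basis_enum K (enveloping_vect charK hu) _ _ hb.
have [starP starM starK] := hstar.
pose mx l := @cell_mx K u d Y M r l.
have rank_eq l : l \in undup (map tag s) -> \rank (mx l e0) = \rank (mx l e2).
  have [g gE] : exists g : {linear enveloping_vect charK hu -> u}, g =1 id by apply: linear_of_fun.
  have bg : bijective g by exists (fun x => x) => x; rewrite gE.
  have sum e f : e * e = e -> f * f = f ->
      \dim (limg (sandwich charK hu e (star f))) = 
      (\sum_(l <- undup (map tag s)) \rank (mx l e) * \rank (mx l f))%N.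
    move=> ee ff; apply: (cell_rank_sum hb hstar hC hr us sall bg) => // x.
    by rewrite !gE sandwichE.
  (* [weight_dim_eq] is applied to the idempotent [star f]; f = e0 and f = e2 give the two equations
     combined by [eq_of_sum_mul]. *)
  have dimf f : f * f = f -> (\sum_(l <- undup (map tag s)) \rank (mx l e0) * \rank (mx l f) =
      \sum_(l <- undup (map tag s)) \rank (mx l e2) * \rank (mx l f))%N.
    by move=> ff; rewrite -!sum //; apply: weight_dim_eq => //; rewrite -starM ff.
  exact: eq_of_sum_mul (dimf _ e00) (dimf _ e22) l.
pose rep l := cell_rep hb hr us sall l.
pose delta l (S : M l) : rep l := (delta_mx (enum_rank S) 0 : 'cV[K]_#|M l|).
have hom (L : lmodType u) l (T : M l) (y : L) : (forall nu, (nu < l)%O -> dead C L nu) ->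
    exists theta : {linear rep l -> L}, forall S, theta (delta l S) = C l S T *: y.
  move=> dl; have [theta thE] := cell_hom hb hr us sall T y dl; exists theta => S.
  rewrite thE (bigD1 (enum_rank S)) //= mxE !eqxx scaleA1 enum_rankK big1 ?addr0 // => j jS.
  by rewrite mxE (negbTE jS) scaleA0.
have notdead (L : lmodType u) l : ~ dead C L l -> exists S T (y : L), C l S T *: y <> 0.
  move=> nd; apply: contrapT => h; apply: nd => S T y; apply: contrapT => ne; apply: h.
  by exists S, T, y.
have in_ls l (S : M l) : l \in undup (map tag s).
  by rewrite mem_undup; apply/mapP; exists (ix S S).
have rep_kill l nu U T (w : rep l) : ~~ (l <= nu)%O -> C nu U T *: w = 0.
  move=> lnu; rewrite matrix_moduleE (_ : cell_mx r l (C nu U T) = 0) ?mul0mx //.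
  by apply/matrixP => i j; rewrite !mxE (r_cell_eq0 hb hstar hC hr us sall).
have [l0 [nd0 min0]] := minimal_label hb us sall (ex_intro _ x0 (quotient_neq0 charK qL0)).
have [l1 [nd1 min1]] := minimal_label hb us sall (ex_intro _ x1 x1_neq0).
have [S0 [T0 [y0 Cy0]]] := notdead _ _ nd0.
have [S1 [T1 [y1 Cy1]]] := notdead _ _ nd1.
have [th0 th0E] := hom L0 l0 T0 y0 min0.
have [th1 th1E] := hom L1 l1 T1 y1 min1.
(* Otherwise W_(l0) has no composition factor L1, so F embeds its weight space 2 into its weight
   space 0; the embedding is strict because L0 is a quotient of W_(l0). *)
have le01 : (l0 <= l1)%O.
  apply/negPn/negP => nle.
  suff : (\rank (mx l0 e2) < \rank (mx l0 e0))%N by rewrite (rank_eq _ (in_ls _ S0)) ltnn.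
  apply: (matrix_rank_lt (theta := th0) (X := F)) e22 _ _ _ _ => [|w e2w Fw|y|].
  - by rewrite -e0F mulrA e00.
  (* A nonzero w of weight 2 with F w = 0 would be a highest weight vector for (F, E, -H) of weight
     -2 = p - 2. Cell elements of label l1 kill it as l0 <= l1 fails, so they would kill L1, against
     the choice of l1. *)
  - apply: contrapT => w0; case: Cy1; have [b ->] := x1_gen y1; rewrite scalerA.
    apply: (hw_transfer p_gt2 charK hu' (w := w)) x1_low x1_top _ => //.
      split=> //; have ww : weight H 2 w by rewrite -e2w; apply: (weight_idem charK rel).
      rewrite /weight scaleNr ww -scaleAN; congr (_%:A *: _); apply/eqP.
      rewrite -rmorphN (intr_eq_mod charK) eqz_mod_dvd mu_eq.
      by rewrite (_ : - 2 - _ = - p%:Z) ?dvdzE ?abszN //; lia.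
    by rewrite -scalerA rep_kill.
  - by rewrite FL0.
  - by exists (delta l0 S0); rewrite e0L0 th0E.
have le10 : (l1 <= l0)%O.
  apply/negPn/negP => nle.
  suff : (\rank (mx l1 e0) < \rank (mx l1 e2))%N by rewrite (rank_eq _ (in_ls _ S1)) ltnn.
  apply: (matrix_rank_lt (theta := th1) (X := E)) e00 _ _ _ _ => [|w e0w Ew|y|].
  - by rewrite -e2E mulrA e22.
  - apply: contrapT => w0; case: Cy0; have [k ->] := line0 y0; rewrite scaleAC.
    have -> : C l0 S0 T0 *: x0 = 0; last by rewrite scaler0.
    apply: (hw_transfer p_gt2 charK hu (w := w)) hw0 _ _ => //.
    + by split=> //; rewrite -e0w; apply: (weight_idem charK rel).
    + by move=> n n0; apply: (quotient_Fn hu qL0).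
    + exact: rep_kill.
  - by rewrite e0L1 scaler0.
  (* By simplicity some a takes the nonzero image to the highest weight vector, and F^(p-2) leads
     from there to x1, which has weight 2. *)
  - have [a ax] := quotient_simple p_gt2 charK hu vD1 qL1 Cy1.
    exists (F ^+ (p - 2) *: (a *: delta l1 S1)).
    by rewrite !linearZZ th1E ax -/x1 e2x1.
(* Both L0 and L1 are now the quotient of one cell module by the radical of its form. *)
have l01 : l0 = l1 by apply: le_anti; rewrite le01.
case: _ / l01 in S1 T1 y1 Cy1 th1 th1E nd1 min1 le01 le10 *.
(* w lies outside the radical of the form, so it generates every basis vector of the cell module.
   But [th1] kills w, since 1_0 is zero on L1, whereas [th1] is not zero. *)
pose w : rep l0 := e0 *: delta l0 S0.
have th0w : th0 w = C l0 S0 T0 *: y0 by rewrite linearZZ e0L0 th0E.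
(* L0 is a line, so this cell element acts on it by a scalar, and the square of a nonzero scalar is
   nonzero. *)
have Cz0 : C l0 S0 T0 *: (C l0 S0 T0 *: y0) <> 0.
  have [k zE] := line0 (C l0 S0 T0 *: y0); have [k' yE] := line0 y0.
  have k0 : k != 0 by apply/eqP => k0; apply: Cy0; rewrite zE k0 scaleA0.
  rewrite zE scaleAC => /(scaleAI k0) Cx; apply: Cy0.
  by rewrite yE scaleAC Cx scaler0.
(* The Graham-Lehrer form at the basis vector T0 and w, written out by [r_cell]. *)
pose c := \sum_k r l0 (C l0 (enum_val k) (enum_val k)) (enum_val k) T0 * (w : 'cV[K]_#|M l0|) k 0.
have CU U : C l0 U T0 *: w = c%:A *: delta l0 U.
  have -> : c%:A *: delta l0 U = c *: (delta_mx (enum_rank U) 0 : 'cV[K]_#|M l0|) :> 'cV_#|M l0|.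
    have -> : c%:A = (c - 1) *: 1 + 1 :> u by rewrite scalerBl scale1r subrK.
    rewrite matrix_moduleE (cell_mxP hb hr us sall) (cell_mx1 hb hr us sall).
    by rewrite mulmxDl -scalemxAl mul1mx scalerBl scale1r subrK.
  apply/matrixP => i j; rewrite matrix_moduleE !mxE (ord1 j) eqxx andbT.
  have [iU|iU] := eqVneq i (enum_rank U); last first.
    rewrite mulr0 big1 // => k _; rewrite mxE (r_cell hb hstar hC hr us sall).
    by rewrite -(inj_eq enum_rank_inj) enum_valK (negbTE iU) mul0r.
  rewrite mulr1; apply: eq_bigr => k _.
  by rewrite mxE (r_cell hb hstar hC hr us sall) iU enum_rankK eqxx.
have c0 : c != 0.
  apply/eqP => c0; case: Cz0; rewrite -th0w -linearZZ CU c0 scaleA0 linear0.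
  by [].
case: Cy1; rewrite -th1E; apply: (scaleAI c0).
by rewrite -linearZZ -CU !linearZZ e0L1 scaler0.
Qed.

End NotCellular.

Theorem proposition4p11 (K : fieldType) (p : nat)
    (p_gt2 : (2 < p)%N) (charK : p \in [pchar K])
    (u : algType K) (E F H : u)
    (hu : restricted_enveloping_sl2 p E F H)
    (star : u -> u) (r : 'I_p -> u -> 'I_p -> 'I_p -> K)
    (hcell : relative_cell_datum E F H star r)
    (Delta : 'I_p -> lmodType u)
    (m : forall lam, 'I_p -> Delta lam)
    (hDelta : forall lam, cell_module r lam (m lam))
    (Phi : forall lam, kspace (Delta lam) -> kspace (Delta lam) -> K)
    (hPhi : forall lam, cell_form E F H r lam (m lam) (Phi lam))
    (L : 'I_p -> lmodType u)
    (pi : forall lam, {linear Delta lam -> L lam})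
    (hL : forall lam, form_quotient (Phi lam) (pi lam))
    (P : 'I_p -> lmodType u)
    (hP : forall lam, [/\ fin_dim (kspace (P lam)), projective (P lam),
                          indecomposable (P lam) & has_head (P lam) (L lam)]) :
  [/\ (* (a) *)
      forall lam : 'I_p,
        has_dim (kspace (Delta lam)) p /\
        exists V : lmodType u, is_baby_verma E H lam V /\ isomorphic (Delta lam) V,
      (* (b) *)
      [/\ forall lam : 'I_p, has_dim (kspace (L lam)) lam.+1,
          forall lam mu : 'I_p, (lam <= p - 2)%N -> mu = (p - lam - 2)%N :> nat ->
            short_exact (L mu) (Delta lam) (L lam)
        & forall lam : 'I_p, lam = p.-1 :> nat -> isomorphic (Delta lam) (L lam)],
      (* (c) *)
      (forall lam mu : 'I_p, (lam <= p - 2)%N -> mu = (p - lam - 2)%N :> nat ->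
         short_exact (Delta mu) (P lam) (Delta lam)) /\
      (forall lam : 'I_p, lam = p.-1 :> nat -> isomorphic (P lam) (Delta lam))
    & (* (d) *)
      [/\ ~ semisimple_ring u,
          ~ cellular u
        & exists (A : algType K) (f : {lrmorphism A -> u}),
            [/\ injective f,
                forall x, core p H x <-> exists a, f a = x
              & cellular A]]].
Proof.
pose o : 'I_p := Ordinal (prime_gt0 (pcharf_prime charK)).
pose v lam := m lam o.
have vD lam : verma_mod E F H (v lam) lam.
  by split; [apply: (cell_hw p_gt2 charK hu hcell (hDelta lam))|
             apply: (cell_verma p_gt2 charK hu hcell (hDelta lam))].
have qL lam : verma_quotient F (v lam) lam (pi lam).
  apply: (form_verma_quotient charK (vD lam) _ (hPhi lam) _ (hL lam)).
    exact: (cell_Fn p_gt2 charK hu hcell (hDelta lam)).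
  exact: (cell_formE p_gt2 charK hu hcell (hDelta lam) (hPhi lam)).
split.
- move=> lam; split; first by exists (m lam); case: (hDelta lam).
  exists (Delta lam); split; first exact: (verma_is_baby_verma charK hu (vD lam)).
  by exists idfun; exists id.
- split.
  + by move=> lam; eexists; apply: (quotient_basis hu (vD lam) (qL lam)).
  + move=> lam mu ll mul.
    exact: (verma_exact p_gt2 charK hu ll mul (vD lam) (qL lam) (vD mu) (qL mu)).
  + by move=> lam; apply: quotient_top (vD lam) (qL lam).
- split=> lam; have [fd proj _ [f [sf kf]]] := hP lam.
  + move=> mu ll mul.
    exact: (projective_cover_exact p_gt2 charK hu (vD lam) (qL lam) fd proj sf kf ll mul (vD mu)).
  + exact: (projective_cover_top p_gt2 charK hu (vD lam) (qL lam) fd proj sf kf).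
have [hstar hstarC _] := hcell; have mu_p : (p - 2 < p)%N by lia.
split.
- exact: (not_semisimple p_gt2 charK hu (vD o) (qL o) (ltnW p_gt2)).
- exact: (not_cellular p_gt2 hu (mu := Ordinal mu_p) erefl (vD o) (qL o) (vD _) (qL _)).
- exact: (core_cellular p_gt2 charK hu hstar hstarC).
Qed.
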